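(* Let $G$ be a simply connected nilpotent Lie group equipped with a left-invariant Riemannian distance. Then $G$ quasi-isometrically embeds into $L^1$ if and only if $G$ is abelian.
   Context: $L^1$ denotes the real Banach space $L^1([0,1])$ with Lebesgue measure. A simply connected Lie group is understood to be connected. A map $f:(X,d_X)\to(Y,d_Y)$ between metric spaces is a quasi-isometric embedding if there are $L\ge 1$, $C\ge 0$ with $L^{-1}d_X(x,y)-C\le d_Y(f(x),f(y))\le L d_X(x,y)+C$ for all $x,y\in X$; $X$ quasi-isometrically embeds into $Y$ if such a map exists. (The choice of left-invariant Riemannian distance is irrelevant, since all of them are quasi-isometrically equivalent.) *)

(* Defs.v *)
From HB Require Import structures.
From mathcomp Require Import all_boot all_order all_algebra.
From mathcomp Require Import all_classical all_reals all_analysis.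

Set Implicit Arguments.
Unset Strict Implicit.
Unset Printing Implicit Defensive.

Import Order.TTheory GRing.Theory Num.Theory.
Import numFieldNormedType.Exports.

Local Open Scope classical_set_scope.
Local Open Scope ring_scope.

Section Smoothness.
Context {R : realType}.

(* For an open set U of a finite-dimensional V: f is of class C^k on U, all
   iterated directional derivatives up to order k existing and being
   continuous. The values of f outside U play no role, as U is open. *)
Fixpoint Ck {V W : normedModType R} (k : nat) (U : set V) (f : V -> W) : Prop :=
  (forall x, U x -> {for x, continuous f}) /\
  match k with
  | 0 => True
  | k'.+1 => forall v, (forall x, U x -> derivable f x v) /\ Ck k' U ('D_v f)
  end.

Definition smooth_on {V W : normedModType R} (U : set V) (f : V -> W) : Prop :=
  forall k, Ck k U f.

End Smoothness.

(* Only the restriction of cmap to cdom, and of cinv to the image of cdom, is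
   meaningful. *)
Record chart (R : realType) (M : topologicalType) (V : normedModType R) :=
  Chart { cdom : set M; cmap : M -> V; cinv : V -> M }.

Section Charts.
Context {R : realType}.

Definition cimg {M : topologicalType} {V : normedModType R} (c : chart M V) :
  set V := cmap c @` cdom c.

Definition is_chart {M : topologicalType} {V : normedModType R}
    (c : chart M V) : Prop :=
  [/\ open (cdom c), open (cimg c),
      forall p, cdom c p -> cinv c (cmap c p) = p,
      forall p, cdom c p -> {for p, continuous (cmap c)} &
      forall x, cimg c x -> {for x, continuous (cinv c)}].

Definition prod_atlas {M N : topologicalType} {V W : normedModType R}
    (A : set (chart M V)) (B : set (chart N W)) :
    set (chart (M * N)%type (V * W)%type) :=
  [set Chart (cdom c `*` cdom d) (fun p => (cmap c p.1, cmap d p.2))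
         (fun x => (cinv c x.1, cinv d x.2)) | c in A & d in B].

Definition coord_rep {M N : topologicalType} {V W : normedModType R}
    (c : chart M V) (d : chart N W) (f : M -> N) : V -> W :=
  fun x => cmap d (f (cinv c x)).

Definition coord_dom {M N : topologicalType} {V W : normedModType R}
    (c : chart M V) (d : chart N W) (f : M -> N) : set V :=
  cimg c `&` [set x | cdom d (f (cinv c x))].

Definition smooth_map {M N : topologicalType} {V W : normedModType R}
    (A : set (chart M V)) (B : set (chart N W)) (f : M -> N) : Prop :=
  continuous f /\
  forall c d, A c -> B d -> smooth_on (coord_dom c d f) (coord_rep c d f).

End Charts.

HB.mixin Record isManifold (R : realType) (n : nat) M of Topological M := {
  atlas : set (chart M 'rV[R]_n);
  atlas_is_chart : forall c, atlas c -> is_chart c;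
  atlas_cover : forall p, exists c, atlas c /\ cdom c p;
  atlas_compatible : smooth_map atlas atlas id;
  manifold_hausdorff : hausdorff_space M;
  manifold_second_countable : @second_countable M
}.

#[short(type="manifoldType")]
HB.structure Definition Manifold (R : realType) (n : nat) :=
  {M of Topological M & isManifold R n M}.

HB.mixin Record isLieGroup (R : realType) (n : nat) G
    of Group G & Manifold R n G := {
  mulg_smooth : smooth_map (prod_atlas (@atlas R n G) (@atlas R n G))
    (@atlas R n G) (fun p : G * G => (p.1 * p.2)%g);
  invg_smooth : smooth_map (@atlas R n G) (@atlas R n G) (fun x : G => x^-1%g)
}.

#[short(type="lieGroupType")]
HB.structure Definition LieGroup (R : realType) (n : nat) :=
  {G of Group G & Manifold R n G & isLieGroup R n G}.

Section SimplyConnected.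
Context (R : realType) (M : topologicalType).

Definition path_connected : Prop :=
  forall p q : M, exists gamma : R -> M,
    [/\ {within `[0, 1], continuous gamma}, gamma 0 = p & gamma 1 = q].

Definition null_homotopic (gamma : R -> M) : Prop :=
  exists H : R * R -> M,
    [/\ {within `[0, 1] `*` `[0, 1], continuous H},
        forall t : R, t \in `[0, 1] -> H (0, t) = gamma t,
        forall t : R, t \in `[0, 1] -> H (1, t) = gamma 0 &
        forall s : R, s \in `[0, 1] -> H (s, 0) = gamma 0 /\ H (s, 1) = gamma 0].

Definition simply_connected : Prop :=
  path_connected /\
  forall gamma : R -> M, {within `[0, 1], continuous gamma} ->
    gamma 0 = gamma 1 -> null_homotopic gamma.

End SimplyConnected.

Section Nilpotent.
Context (G : groupType).

Definition is_subgroup (H : set G) : Prop :=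
  [/\ H 1%g, forall x y, H x -> H y -> H (x * y)%g & forall x, H x -> H x^-1%g].

Fixpoint lower_central (k : nat) : set G :=
  match k with
  | 0 => setT
  | k'.+1 => smallest is_subgroup
      [set [~ x, y]%g | x in lower_central k' & y in setT]
  end.

Definition nilpotent_group : Prop := exists k, lower_central k = [set 1%g].

Definition abelian_group : Prop := forall x y : G, (x * y = y * x)%g.

End Nilpotent.

Section Riemannian.
Context {R : realType} {n : nat}.

Definition inner (A : 'M[R]_n) (u v : 'rV[R]_n) : R := (u *m A *m v^T) 0 0.

(* mx c p is the Gram matrix at p of the metric in the chart c; it is relevant
   only for c in the atlas and p in the domain of c. The map f preserves mx
   when its differential, read in charts, preserves the inner products. *)
Definition preserves_metric {M : manifoldType R n}
    (mx : chart M 'rV[R]_n -> M -> 'M[R]_n) (f : M -> M) : Prop :=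
  forall c d p u v, atlas c -> atlas d -> cdom c p -> cdom d (f p) ->
    let df := 'd (coord_rep c d f) (cmap c p) in
    inner (mx d (f p)) (df u) (df v) = inner (mx c p) u v.

(* metric_change, the case f = id, is the tensor law under a change of chart. *)
Record riemannian_metric (M : manifoldType R n) := RiemannianMetric {
  metric_mx : chart M 'rV[R]_n -> M -> 'M[R]_n;
  metric_sym : forall c p, atlas c -> cdom c p ->
    (metric_mx c p)^T = metric_mx c p;
  metric_pos : forall c p u, atlas c -> cdom c p -> u != 0 ->
    0 < inner (metric_mx c p) u u;
  metric_change : preserves_metric metric_mx id;
  metric_smooth : forall c, atlas c ->
    smooth_on (cimg c) (fun x => metric_mx c (cinv c x))
}.

Definition left_invariant {G : lieGroupType R n} (g : riemannian_metric G) :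
  Prop := forall a : G, preserves_metric (metric_mx g) (fun x => (a * x)%g).

Definition chart_at {M : manifoldType R n} (p : M) : chart M 'rV[R]_n :=
  projT1 (cid (@atlas_cover R n M p)).

(* By metric_change the speed of a C^1 curve does not depend on the chart. *)
Definition speed {M : manifoldType R n} (g : riemannian_metric M)
    (gamma : R -> M) (t : R) : R :=
  let c := chart_at (gamma t) in
  let v := 'D_1 (cmap c \o gamma : R^o -> 'rV[R]_n) t in
  Num.sqrt (inner (metric_mx g c (gamma t)) v v).

Definition curve_length {M : manifoldType R n} (g : riemannian_metric M)
    (gamma : R -> M) : R :=
  \int[lebesgue_measure]_(t in `[0, 1]) speed g gamma t.

(* A C^1 curve on [0, 1] is one that is C^1 on an open neighbourhood of it. *)
Definition C1_curve {M : manifoldType R n} (gamma : R -> M) : Prop :=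
  exists U : set R^o, [/\ open U, `[0, 1] `<=` U,
    forall t, U t -> {for t, continuous gamma} &
    forall c : chart M 'rV[R]_n, atlas c ->
      Ck 1 (U `&` [set t | cdom c (gamma t)])
        (cmap c \o gamma : R^o -> 'rV[R]_n)].

(* Piecewise C^1 curves, as finite concatenations of C^1 curves. *)
Fixpoint piecewise_C1_from_to {M : manifoldType R n}
    (p : M) (s : seq (R -> M)) (q : M) : Prop :=
  match s with
  | [::] => p = q
  | gamma :: s' => [/\ C1_curve gamma, gamma 0 = p &
                       piecewise_C1_from_to (gamma 1) s' q]
  end.

Definition riemannian_dist {M : manifoldType R n} (g : riemannian_metric M)
    (p q : M) : R :=
  inf [set \sum_(gamma <- s) curve_length g gamma
      | s in [set s | piecewise_C1_from_to p s q]].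

End Riemannian.

Section L1.
Context (R : realType).

Definition lebesgue01 : {measure set (measurableTypeR R) -> \bar R} :=
  mrestr lebesgue_measure (measurable_itv `[0, 1]%R).

Definition L1 : Type := LspaceType1 lebesgue01.

Definition L1_dist (f g : L1) : R :=
  fine ('N[lebesgue01]_1 [EFin \o (fun x => f x - g x)]).

End L1.

Section QuasiIsometry.
Context {R : realType} {X Y : Type}.

Definition quasi_isometric_embedding (dX : X -> X -> R) (dY : Y -> Y -> R)
    (f : X -> Y) : Prop :=
  exists L C : R, [/\ 1 <= L, 0 <= C & forall x y,
    L^-1 * dX x y - C <= dY (f x) (f y) <= L * dX x y + C].

Definition qi_embeds (dX : X -> X -> R) (dY : Y -> Y -> R) : Prop :=
  exists f : X -> Y, quasi_isometric_embedding dX dY f.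

End QuasiIsometry.

(* Main.v *)
Require Import Defs.
From HB Require Import structures.
From mathcomp Require Import all_boot all_order all_algebra.
From mathcomp Require Import all_classical all_reals all_analysis measurable_realfun.
From mathcomp Require Import zify ring lra.

Set Implicit Arguments.
Unset Strict Implicit.
Unset Printing Implicit Defensive.

Import Order.TTheory GRing.Theory Num.Theory.
Import numFieldNormedType.Exports.

Local Open Scope classical_set_scope.
Local Open Scope ring_scope.

(* Abelian case: the Lie bracket vanishes, so the identity of the Lie algebra integrates to an additive coordinate map phi : G -> R^n. It is Lipschitz, and since every point is the k-th power of a point near 1 as soon as k is comparable to |phi p|, the distance d(1, p) is comparable to |phi p| up to a constant; R^n embeds in L^1 by step functions.

Nonabelian case: there are a linear form om on the Lie algebra which kills all brackets with derived elements and elements x, y with om [x, y] <> 0. A second order primitive of om is a function F on G with F (p q) = F p + F q + beta (p, q) for a biadditive beta, and |F p| <= C (1 + d(1, p))^2. As F [z1^k, z2^k] = 2 k^2 beta (z1, z2), the commutators [z1^k, z2^k] have length at least c k for suitable z1, z2.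

A quasi-isometric embedding f into L^1 excludes this. Put b v (q, t) = f (q v) t - f q t. Averaging along the lower central series, with a limit along an ultrafilter, produces a positive functional xi on functions of (q, t), invariant under right translations of q, such that xi |b v| is d(1, v) up to the constants of f. For a fixed v, averages of the signs of b (v^n) norm the powers of v; averaged again, they give invariant functionals splitting xi into finitely many parts, on each of which the length of v^m is close to m |psi v| for an additive psi. On such a part, of two elements one can be modified by a power of the other so as to have small speed, and the iterated commutators of highest step absorb this modification. Working with polynomial sequences and descending along the lower central series gives xi |b [x^k, y^k]| = o(k) along suitably divisible k. *)

(** * Commutators and polynomial sequences *)

(** The obstacle in the nonabelian case is that [xi |b v|] is only a length function: the triangle
    inequality alone is compatible with linear growth of [[x ^+ k, y ^+ k]]. The gain comes from
    rescaling: a bound [c k] for the sequence dilated by [a], with [c] independent of [a], is a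
    bound [(c / a) k] along the multiples of [a]. A bracket of [w] letters raised to [(a k) ^ l]
    with [l < w] has a letter free to carry [a ^ l], at a cost independent of [k]. For [l = w] every
    letter already carries [k], and the constant factor is absorbed by replacing a letter [x] by
    [x ^+ M] times a power of another letter. The product has small speed only if the length of
    powers is governed by a homomorphism, hence the splitting of [xi]. All this holds modulo the
    next term of the lower central series, with errors that are polynomial sequences in that term;
    so the induction has to run over all polynomial sequences. The exponent at which an element is
    normed is known only up to multiples, which explains the restriction to divisible [k]. *)

Section GroupCalculus.
Variable G : groupType.
Local Open Scope group_scope.
Implicit Types (x y z a b c : G) (A B : set G).

Lemma commMg x y z : [~ x * y, z] = [~ x, z] ^ y * [~ y, z].
Proof. by rewrite /commg /conjg !invgM !mulgA !mulgK. Qed.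

Lemma commgM x y z : [~ x, y * z] = [~ x, z] * [~ x, y] ^ z.
Proof. by rewrite /commg /conjg !invgM !mulgA !mulgK. Qed.

Lemma conjg_mulR x y : x ^ y = x * [~ x, y].
Proof. by rewrite /commg mulVKg. Qed.

Lemma Hall_Witt x y z :
  [~ x, y^-1, z] ^ y * [~ y, z^-1, x] ^ z * [~ z, x^-1, y] ^ x = 1.
Proof.
rewrite /commg /conjg !invgM !invgK !mulgA.
by rewrite ?(mulgA, mulgK, mulgVK, mulgV, mulVg, mul1g, mulg1).
Qed.
End GroupCalculus.

Section LowerCentral.
Variable G : groupType.
Local Open Scope group_scope.
Implicit Types (x y z a b c : G) (A B : set G).

(* [lcs n] is the n-th term of the lower central series in the usual numbering, extended by [lcs 0 = lcs 1 = G]. *)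
Definition lcs (n : nat) : set G := lower_central n.-1.

Lemma subgroupX A x n : is_subgroup A -> A x -> A (x ^+ n).
Proof.
by case=> A1 AM _ Ax; elim: n => [|n ih]; rewrite ?expg0 // expgS; apply: AM.
Qed.

Lemma lcs_subgroup n : is_subgroup (lcs n).
Proof.
case: n => [|[|n]] //; split=> [H [[]]|x y Ax Ay H hH|x Ax H hH] //.
- by case: (hH) => -[_ HM _] _; apply: HM; [exact: Ax|exact: Ay].
- by case: (hH) => -[_ _ HV] _; apply: HV; exact: Ax.
Qed.

Lemma lcs1 n : lcs n 1. Proof. by case: (lcs_subgroup n). Qed.
Lemma lcsM n x y : lcs n x -> lcs n y -> lcs n (x * y).
Proof. by case: (lcs_subgroup n) => _ h _; apply: h. Qed.
Lemma lcsV n x : lcs n x -> lcs n x^-1.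
Proof. by case: (lcs_subgroup n) => _ _; apply. Qed.

Lemma lcs_ind n (H : set G) : is_subgroup H ->
  (forall a c, lcs n.+1 a -> H [~ a, c]) -> lcs n.+2 `<=` H.
Proof. by move=> sH h x; apply; split => // _ [a La [c _ <-]]; apply: h. Qed.

Lemma lcsR1 n a c : lcs n a -> lcs n.+1 [~ a, c].
Proof.
case: n => [|n] La //= H [sH]; apply.
by exists a => //; exists c.
Qed.

Lemma lcsJ n a c : lcs n a -> lcs n (a ^ c).
Proof.
case: n => [|[|n]] // La.
have sH : is_subgroup [set x | lcs n.+2 (x ^ c)].
  split=> [|x y /= hx hy|x /= hx].
  - by rewrite /= conj1g; exact: lcs1.
  - by rewrite conjMg; exact: lcsM.
  - by rewrite conjVg; exact: lcsV.
elim: n a La sH => [|n ih] a La sH; apply: (lcs_ind sH _ La) => x d Lx /=.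
  by rewrite conjRg; exact: lcsR1.
rewrite conjRg; apply: lcsR1; apply: ih => //.
split=> [|u v /= hu hv|u /= hu].
- by rewrite /= conj1g; exact: lcs1.
- by rewrite conjMg; exact: lcsM.
- by rewrite conjVg; exact: lcsV.
Qed.

Lemma lcsS n : lcs n.+1 `<=` lcs n.
Proof.
case: n => [|n] // ; apply: lcs_ind => [|a c La]; first exact: lcs_subgroup.
by rewrite commgEl; apply: lcsM; [exact: lcsV|exact: lcsJ].
Qed.

Lemma lcs_le m n : (m <= n)%N -> lcs n `<=` lcs m.
Proof.
move=> /subnK <-; elim: (n - m)%N => [|k ih] //= x /lcsS; exact: ih.
Qed.

(** Three subgroups argument: on a generator [[~ c, d]] of [lcs j.+2], the Hall-Witt identity
    expresses [[~ c, d, u]], up to conjugation, by two brackets that the induction on [j]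
    controls. *)
Lemma lcsR i j a b : lcs i a -> lcs j b -> lcs (i + j) [~ a, b].
Proof.
elim: j i a b => [|[|j] ih] i a b La Lb.
- rewrite addn0 commgEl; apply: lcsM; [exact: lcsV|exact: lcsJ].
- by rewrite addn1; exact: lcsR1.
have sH : is_subgroup [set x | forall a, lcs i a -> lcs (i + j.+2) [~ a, x]].
  split=> [x _|x y hx hy u Lu|x hx u Lu] /=.
  - by rewrite commg1; exact: lcs1.
  - by rewrite commgM; apply: lcsM; [exact: hy|apply: lcsJ; exact: hx].
  - suff -> : [~ u, x^-1] = ([~ u, x]^-1) ^ x^-1 by apply/lcsJ/lcsV/hx.
    by rewrite invgR /commg /conjg !invgK !mulgA mulgV mul1g.
apply: (lcs_ind sH _ Lb) => // c d Lc u Lu.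
have E : [~ u, [~ c, d]] = [~ [~ c, d], u]^-1 by rewrite invgR.
rewrite E; apply: lcsV.
have hw := Hall_Witt c d^-1 u.
rewrite invgK in hw.
have h1 : lcs (i + j.+2) ([~ d^-1, u^-1, c] ^ u).
  apply: lcsJ; rewrite addnS -addSn; apply: ih => //.
  rewrite -invgR; apply: lcsV.
  by rewrite -(invgK d); apply: lcsR1; exact: lcsV.
have h2 : lcs (i + j.+2) ([~ u, c^-1, d^-1] ^ c).
  apply: lcsJ; rewrite addnS; apply: lcsR1.
  by apply: ih => //; exact: lcsV.
suff : lcs (i + j.+2) ([~ c, d, u] ^ d^-1).
  by move=> /(@lcsJ _ _ d); rewrite -conjgM mulVg conjg1.
have -> : [~ c, d, u] ^ d^-1 =
   ([~ d^-1, u^-1, c] ^ u * [~ u, c^-1, d^-1] ^ c)^-1.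
  by move: hw; rewrite -mulgA => /mulg1_eq <-; rewrite invgK.
by apply: lcsV; apply: lcsM.
Qed.

End LowerCentral.

Lemma lcs_trivial (G : groupType) : nilpotent_group G ->
  exists j, forall x : G, lcs j.+1 x -> x = 1%g.
Proof. by move=> [k hk]; exists k => x; rewrite /lcs /= hk. Qed.

Section PolynomialSequences.
Variable G : groupType.
Local Open Scope group_scope.
Implicit Types (x y z a b c : G) (q r : nat -> G).

Definition dseq q (k : nat) : G := (q k)^-1 * q k.+1.

(* Polynomial sequences for the lower central filtration shifted by [n], in the sense of Leibman, up to [d] differences. *)
Fixpoint polyseq (d n : nat) q : Prop :=
  (forall k, lcs n (q k)) /\
  match d with 0 => True | d'.+1 => polyseq d' n.+1 (dseq q) end.

Lemma eq_polyseq d n q r : q =1 r -> polyseq d n q -> polyseq d n r.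
Proof. by move=> /funext ->. Qed.

Lemma polyseq_depth d n q : polyseq d.+1 n q -> polyseq d n q.
Proof.
elim: d n q => [|d ih] n q [h1 h2]; first by split.
by split=> //; apply: ih.
Qed.

Lemma polyseq_le d m n q : (m <= n)%N -> polyseq d n q -> polyseq d m q.
Proof.
elim: d m n q => [|d ih] m n q mn [h1 h2]; split=> //.
- by move=> k; apply: (lcs_le mn).
- by move=> k; apply: (lcs_le mn).
- by apply: ih h2.
Qed.

Lemma dseqM q r : dseq (fun k => q k * r k) =1
  (fun k => dseq q k * [~ dseq q k, r k] * dseq r k).
Proof.
move=> k; rewrite -conjg_mulR /dseq /conjg invgM !mulgA.
by rewrite ?(mulgK, mulgVK).
Qed.

Lemma dseqV q : dseq (fun k => (q k)^-1) =1
  (fun k => (dseq q k)^-1 * [~ (dseq q k)^-1, (q k)^-1]).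
Proof.
by move=> k; rewrite -conjg_mulR /dseq /conjg !invgM !invgK !mulgA mulgK.
Qed.

(** Every factor contains one of the differences [a], [b], so it lies one step deeper than
    [[~ q k, r k]]; this is what closes the induction of [polyseq_group]. *)
Lemma dseqR q r : dseq (fun k => [~ q k, r k]) =1
  (fun k => let a := dseq q k in let b := dseq r k in let c := [~ q k, r k] in
    (([~ q k, b] ^ a) ^ c) * [~ c, b * a] * ([~ a, b] * [~ a, r k] ^ b)).
Proof.
move=> k; rewrite /dseq /=; set x := q k; set y := r k.
set a := x^-1 * _; set b := y^-1 * _.
have -> : q k.+1 = x * a by rewrite /a mulVKg.
have -> : r k.+1 = y * b by rewrite /b mulVKg.
clearbody a b; rewrite commMg (commgM x) (commgM a) conjMg -conjgM; move: [~ x, y] (b * a) => c e.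
by move: (_ ^ a) (_ * _ ^ b) => X Z; rewrite commgEl (conjgE X) !mulgA mulgK.
Qed.

(** The theorem of Lazard and Leibman. The three closure properties are proved together, because the
    difference of a product, an inverse or a commutator involves the other operations with one
    difference fewer. *)
Lemma polyseq_group d :
  [/\ forall n q r, polyseq d n q -> polyseq d n r ->
        polyseq d n (fun k => q k * r k),
      forall n q, polyseq d n q -> polyseq d n (fun k => (q k)^-1) &
      forall m n q r, polyseq d m q -> polyseq d n r ->
        polyseq d (m + n) (fun k => [~ q k, r k])].
Proof.
elim: d => [|d [ihM ihV ihR]].
  split=> [n q r [h _] [h' _]|n q [h _]|m n q r [h _] [h' _]]; split=> // k.
  - exact: lcsM.
  - exact: lcsV.
  - exact: lcsR.
have ihJ m n q r : polyseq d m q -> polyseq d n r ->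
    polyseq d m (fun k => q k ^ r k).
  move=> hq hr; have hc := ihR _ _ _ _ hq hr.
  apply: (eq_polyseq (q := fun k => q k * [~ q k, r k])) => [k|].
    by rewrite -conjg_mulR.
  by apply: ihM => //; apply: polyseq_le hc; exact: leq_addr.
split.
- move=> n q r hq hr; have [hq1 hq2] := hq; have [hr1 hr2] := hr.
  split=> [k|]; first exact: lcsM.
  apply: (eq_polyseq (fsym (dseqM q r))); apply: (ihM) => //.
  apply: (ihM) => //; apply: polyseq_le (ihR _ _ _ _ hq2 (polyseq_depth hr)).
  exact: leq_addr.
- move=> n q hq; have [hq1 hq2] := hq; split=> [k|]; first exact: lcsV.
  apply: (eq_polyseq (fsym (dseqV q))); apply: (ihM); first exact: ihV.
  apply: polyseq_le (ihR _ _ _ _ (ihV _ _ hq2) (ihV _ _ (polyseq_depth hq))).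
  exact: leq_addr.
move=> m n q r hq hr; have [hq1 hq2] := hq; have [hr1 hr2] := hr.
split=> [k|]; first exact: lcsR.
have hq0 := polyseq_depth hq; have hr0 := polyseq_depth hr.
have hc := ihR _ _ _ _ hq0 hr0.
apply: (eq_polyseq (fsym (dseqR q r))) => /=; apply: (ihM).
  apply: (ihM).
    apply: (ihJ) hc; apply: (ihJ) hq2.
    by rewrite -addnS; exact: ihR.
  apply: (@polyseq_le _ _ (m + n + 1)); first by rewrite addn1.
  apply: (ihR) => //; apply: (ihM).
    exact: polyseq_le hr2.
  exact: polyseq_le hq2.
apply: (ihM).
  by apply: (@polyseq_le _ _ (m.+1 + n.+1)); [lia|exact: ihR].
by apply: (ihJ) hr2; rewrite -addSn; exact: ihR.
Qed.

(** The filtration is kept unshifted and the range is a separate condition, so that passing to a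
    deeper term only requires checking values, as in [polyseqs_sub]. *)
Definition polyseqs (j : nat) : set (nat -> G) :=
  [set q | (forall d, polyseq d 0 q) /\ forall k, lcs j (q k)].

Lemma polyseqsM j q r : polyseqs j q -> polyseqs j r ->
  polyseqs j (fun k => q k * r k).
Proof.
move=> [h1 h2] [h3 h4]; split=> [d|k]; last exact: lcsM.
by case: (polyseq_group d) => h _ _; apply: h.
Qed.

Lemma polyseqsV j q : polyseqs j q -> polyseqs j (fun k => (q k)^-1).
Proof.
move=> [h1 h2]; split=> [d|k]; last exact: lcsV.
by case: (polyseq_group d) => _ h _; apply: h.
Qed.

Lemma polyseqsR i j q r : polyseqs i q -> polyseqs j r ->
  polyseqs (i + j) (fun k => [~ q k, r k]).
Proof.
move=> [h1 h2] [h3 h4]; split=> [d|k]; last exact: lcsR.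
by case: (polyseq_group d) => _ _ h; apply: (h 0%N 0%N).
Qed.

Lemma polyseqs_sub i j q : (forall k, lcs j (q k)) -> polyseqs i q ->
  polyseqs j q.
Proof. by move=> h [h1 _]; split. Qed.

Lemma polyseq_one d n : polyseq d n (fun=> 1).
Proof.
elim: d n => [|d ih] n; (split=> [k|]; first exact: lcs1) => //.
by apply: (eq_polyseq _ (ih n.+1)) => k; rewrite /dseq mulVg.
Qed.

Lemma polyseqs_cst j x : lcs j x -> polyseqs j (fun=> x).
Proof.
move=> Lx; split=> // -[|d]; split=> //.
by apply: eq_polyseq (polyseq_one d 1) => k; rewrite /dseq mulVg.
Qed.

(** By Pascal's rule each difference lowers [i] by one, and after [i] of them the sequence is
    constant; [x] is deep enough for these steps because [i <= j]. *)
Lemma polyseqs_bin j i x : (i <= j)%N -> lcs j x ->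
  polyseqs j (fun k => x ^+ 'C(k, i)).
Proof.
move=> ij Lx; split=> [d|k]; last exact: (subgroupX 'C(k, i) (lcs_subgroup _ j) Lx).
suff : forall i n, (i + n <= j)%N -> polyseq d n (fun k => x ^+ 'C(k, i)).
  by apply; rewrite addn0.
move=> {i ij} i n; elim: d i n => [|d ih] i n hi.
  split=> // k; apply: (subgroupX 'C(k, i) (lcs_subgroup _ n)).
  by apply: (lcs_le _ Lx); apply: leq_trans hi; exact: leq_addl.
split=> [k|].
  apply: (subgroupX 'C(k, i) (lcs_subgroup _ n)).
  by apply: (lcs_le _ Lx); apply: leq_trans hi; exact: leq_addl.
case: i hi => [|i] hi.
  apply: eq_polyseq (polyseq_one d n.+1) => k.
  by rewrite /dseq !bin0 mulVg.
apply: eq_polyseq (ih i n.+1 _); last by rewrite addnS -addSn.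
by move=> k; rewrite /dseq binS expgnDr mulKg.
Qed.

Lemma polyseqs_exp x m : polyseqs 1 (fun k => x ^+ (m * k)).
Proof.
have := @polyseqs_bin 1 1 (x ^+ m) isT I; congr polyseqs.
by apply/funext => k; rewrite bin1 expgnA.
Qed.

End PolynomialSequences.

(** * Iterated commutators modulo the lower central series *)

Section Brackets.
Variable G : groupType.
Local Open Scope group_scope.
Implicit Types (x y z a b c : G) (s : seq G).

Definition eqlcs n x y := lcs n (x^-1 * y).

Lemma eqlcs_refl n x : eqlcs n x x.
Proof. by rewrite /eqlcs mulVg; exact: lcs1. Qed.

Lemma eqlcs_sym n x y : eqlcs n x y -> eqlcs n y x.
Proof. by move=> /lcsV; rewrite invgM invgK. Qed.

Lemma eqlcs_trans n y x z : eqlcs n x y -> eqlcs n y z -> eqlcs n x z.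
Proof. by move=> h /(lcsM h); rewrite /eqlcs mulgA mulgK. Qed.

Lemma eqlcsM n x y x' y' :
  eqlcs n x x' -> eqlcs n y y' -> eqlcs n (x * y) (x' * y').
Proof.
rewrite /eqlcs => h h'.
have -> : (x * y)^-1 * (x' * y') = (x^-1 * x') ^ y * (y^-1 * y').
  by rewrite /conjg invgM !mulgA mulgK.
by apply: lcsM => //; exact: lcsJ.
Qed.

Lemma eqlcsX n x y k : eqlcs n x y -> eqlcs n (x ^+ k) (y ^+ k).
Proof.
move=> h; elim: k => [|k ih]; first exact: eqlcs_refl.
by rewrite !expgS; exact: eqlcsM.
Qed.

Lemma eqlcs_mulr n x e : lcs n e -> eqlcs n x (x * e).
Proof. by rewrite /eqlcs mulKg. Qed.

Lemma eqlcs_comm i x c : lcs i x -> forall n, (n <= i.+1)%N ->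
  eqlcs n (x * c) (c * x).
Proof.
move=> Lx n ni; rewrite /eqlcs.
have -> : (x * c)^-1 * (c * x) = [~ c, x] by rewrite /commg /conjg invgM !mulgA.
by rewrite -invgR; apply/lcsV/(lcs_le ni); exact: lcsR1.
Qed.

(** This makes the bracket well defined on the associated graded group: changing [x] in degree
    [i.+1] or [c] in degree 2 changes the commutator in degree [i.+2] only. *)
Lemma eqlcsR i x y c d : eqlcs i.+1 x y -> lcs i x -> eqlcs 2 c d ->
  eqlcs i.+2 [~ x, c] [~ y, d].
Proof.
rewrite /eqlcs => xy Lx cd; rewrite -(mulVKg x y) -(mulVKg c d).
move: (x^-1 * y) (c^-1 * d) xy cd => e f Le Lf.
rewrite commMg conjg_mulR !commgM !conjg_mulR.
move: (Lx) => Lx1.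
have l2 (u v : G) j : lcs j u -> lcs j.+1 [~ u, v] by exact: lcsR1.
have Lxf : lcs i.+2 [~ x, f] by rewrite -addn2; exact: lcsR.
have h : forall u, lcs i.+1 u -> lcs i.+2 [~ u, f] by move=> u; exact: l2.
set X := [~ x, c]; set F := [~ x, f].
have LX : lcs i.+1 X by exact: l2.
have : eqlcs i.+2 (1 * (X * 1) * 1 * (1 * (1 * 1)))
  (F * (X * [~ X, f]) * [~ F * (X * [~ X, f]), e] *
   ([~ e, f] * ([~ e, c] * [~ [~ e, c], f]))).
  have one u : lcs i.+2 u -> eqlcs i.+2 1 u by rewrite /eqlcs invg1 mul1g.
  have LFX : lcs i.+1 (F * (X * [~ X, f])).
    apply: lcsM; first exact: lcsS.
    by apply: lcsM => //; apply: lcsS; exact: l2.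
  apply: eqlcsM; [apply: eqlcsM; [apply: eqlcsM|]|apply: eqlcsM].
  - by apply: one.
  - by apply: eqlcsM; [exact: eqlcs_refl|by apply: one; apply: l2].
  - by apply: one; apply: l2.
  - by apply: one; apply: l2.
  - apply: eqlcsM; first by apply: one; apply: l2.
    by apply: one; apply/lcsS/l2/l2.
by rewrite !mulg1 mul1g.
Qed.

Lemma eqlcs_commMg i x y c : lcs i x ->
  eqlcs i.+2 [~ x * y, c] ([~ x, c] * [~ y, c]).
Proof.
move=> Lx; rewrite commMg conjg_mulR; apply/eqlcsM/eqlcs_refl/eqlcs_sym.
by apply: eqlcs_mulr; apply/lcsR1/lcsR1.
Qed.

Lemma eqlcs_commXg i x c m : lcs i x ->
  eqlcs i.+2 [~ x ^+ m, c] ([~ x, c] ^+ m).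
Proof.
move=> Lx; elim: m => [|m ih]; first by rewrite comm1g; exact: eqlcs_refl.
rewrite !expgS; apply: eqlcs_trans (eqlcs_commMg _ _ Lx) _.
by apply: eqlcsM => //; exact: eqlcs_refl.
Qed.

Lemma eqlcs_commgX i x c m : lcs i x ->
  eqlcs i.+2 [~ x, c ^+ m] ([~ x, c] ^+ m).
Proof.
move=> Lx; elim: m => [|m ih]; first by rewrite commg1; exact: eqlcs_refl.
rewrite !expgSr commgM.
apply: eqlcs_trans (eqlcs_comm _ (lcsR1 _ Lx) (leqnn _)) _.
rewrite conjg_mulR; apply: eqlcs_trans (eqlcsM ih (eqlcs_refl _ _)).
apply: eqlcsM; last exact: eqlcs_refl.
by apply/eqlcs_sym/eqlcs_mulr/lcsR1/lcsR1.
Qed.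

Lemma eqlcs_commX i x c m n : lcs i x ->
  eqlcs i.+2 [~ x ^+ m, c ^+ n] ([~ x, c] ^+ (m * n)).
Proof.
move=> Lx; rewrite mulnC expgnA; apply: eqlcs_trans (eqlcs_commXg _ _ Lx) _.
by apply: eqlcsX; exact: eqlcs_commgX.
Qed.

Fixpoint brk x s := if s is y :: s' then brk [~ x, y] s' else x.

Lemma lcs_brk i x s : lcs i x -> lcs (i + size s) (brk x s).
Proof.
by elim: s i x => [|y s ih] i x Lx /=; rewrite ?addn0 // -addSnnS; apply/ih/lcsR1.
Qed.

Lemma eqlcs_brk i x y s : lcs i x -> eqlcs i.+1 x y ->
  eqlcs (i.+1 + size s) (brk x s) (brk y s).
Proof.
elim: s i x y => [|c s ih] i x y Lx xy /=; rewrite ?addn0 // -addSnnS.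
by apply: ih; [exact: lcsR1|apply: eqlcsR => //; exact: eqlcs_refl].
Qed.

(** Multilinearity modulo the next term. Read from right to left, it distributes a large exponent of
    a bracket among its letters, each of which then costs only linearly. *)
Lemma eqlcs_brkX i x e (s : seq (G * nat)) : lcs i x ->
  eqlcs (i.+1 + size s) (brk (x ^+ e) [seq p.1 ^+ p.2 | p <- s])
    (brk x (unzip1 s) ^+ (e * \prod_(p <- s) p.2)).
Proof.
elim: s i x e => [|[c n] s ih] i x e Lx /=.
  by rewrite big_nil muln1; exact: eqlcs_refl.
rewrite big_cons /= -addSnnS mulnA; apply: eqlcs_trans (ih _ _ _ (lcsR1 c Lx)).
have -> : size s = size [seq p.1 ^+ p.2 | p <- s] by rewrite size_map.
apply: eqlcs_brk; last exact: eqlcs_commX.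
by apply/lcsR1; apply: (subgroupX _ (lcs_subgroup _ _) Lx).
Qed.

End Brackets.

(** The coefficients satisfy the recurrence given by [k C(k, i) = (i + 1) C(k, i + 1) + i C(k, i)].
    They are natural numbers because they serve as exponents in a group. *)
Lemma exp_bin_sum l : exists c : nat -> nat, forall k,
  (k ^ l = \sum_(i < l.+1) c i * 'C(k, i))%N.
Proof.
elim: l => [|l [c ih]]; first by exists (fun=> 1%N) => k; rewrite big_ord1 bin0.
exists (fun i => i * c i.-1 + (if (i <= l)%N then i * c i else 0))%N => k.
rewrite expnS ih big_distrr /=.
have step i : (k * 'C(k, i) = i.+1 * 'C(k, i.+1) + i * 'C(k, i))%N.
  rewrite mul_bin_left; case: (leqP i k) => ik; last by rewrite bin_small // !muln0.
  by rewrite -mulnDl subnK.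
under eq_bigr => i _ do rewrite mulnCA step mulnDr.
rewrite big_split /=.
under [RHS]eq_bigr => i _ do rewrite mulnDl.
rewrite [RHS]big_split /=; congr addn.
  rewrite [RHS]big_ord_recl /= !mul0n add0n; apply: eq_bigr => i _.
  by rewrite mulnA [(c i * _)%N]mulnC.
rewrite [RHS]big_ord_recr /= ltnn mul0n addn0; apply: eq_bigr => i _.
by rewrite -ltnS ltn_ord mulnA [(c i * _)%N]mulnC.
Qed.

(** The falling factorial of order [i > 0] is an integral polynomial without constant term, so at
    [i! k] each of its monomials is divisible by [i!]. Negative coefficients are moved to the left
    to keep natural exponents. *)
Lemma bin_fact_exp_sum i : exists P Q : nat -> nat, forall k,
  ('C(i`! * k, i) + \sum_(l < i.+1) Q l * k ^ l = \sum_(l < i.+1) P l * k ^ l)%N.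
Proof.
case: i => [|i].
  exists (fun=> 1%N), (fun=> 0%N) => k; rewrite !big_ord1 /= bin0 expn0.
  by rewrite mul0n.
have [p [p0 sp hp]] : exists p : {poly int}, [/\ p`_0 = 0, (size p <= i.+2)%N &
    forall n : nat, (n ^_ i.+1)%:R = p.[n%:R]].
  pose p m : {poly int} := \prod_(r < m) ('X - r%:R%:P).
  have sz m : size (p m) = m.+1.
    by rewrite /p size_prod_XsubC /index_enum -enumT size_enum_ord.
  have ev m n : (n ^_ m)%:R = (p m).[n%:R] :> int.
    elim: m => [|m ih]; first by rewrite /p big_ord0 hornerC.
    rewrite /p big_ord_recr /= hornerM -/(p m) -ih ffactnSr natrM.
    rewrite hornerXsubC; case: (leqP m n) => mn; first by rewrite natrB.
    by rewrite ffact_small // !mul0r.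
  exists (p i.+1); split=> //; last by rewrite sz.
  by rewrite -horner_coef0 -(ev _ 0%N) ffact0n.
pose s l : int := p`_l * (i.+1`!)%:R ^+ l.-1.
have hb k : ('C(i.+1`! * k, i.+1))%:R = \sum_(l < i.+2) s l * k%:R ^+ l :> int.
  have f0 : (i.+1`!)%:R != 0 :> int by rewrite pnatr_eq0 -lt0n fact_gt0.
  apply: (mulfI f0); rewrite -natrM mulnC bin_ffact hp.
  rewrite (horner_coef_wide _ sp) mulr_sumr; apply: eq_bigr => l _.
  rewrite /s natrM exprMn; case: l => -[|l] hl /=; first by rewrite p0 !mul0r mulr0.
  by rewrite exprS; ring.
exists (fun l => if 0 <= s l then `|s l|%N else 0%N),
       (fun l => if 0 <= s l then 0%N else `|s l|%N) => k.
apply/eqP; rewrite -(eqr_nat int) natrD hb !natr_sum -big_split /=; apply/eqP.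
apply: eq_bigr => l _; rewrite !natrM natrX.
case: (boolP (0 <= s l)) => hs; first by rewrite mul0r addr0 (natz `|s l|) gez0_abs.
by rewrite mul0r (natz `|s l|) ltz0_abs ?ltNge // mulNr subrr.
Qed.

(** * Reduction of polynomial sequences to powers of single brackets *)

Section PolynomialReduction.
Variable G : groupType.
Local Open Scope group_scope.
Implicit Types (x y u : G) (q r : nat -> G) (vs : seq G).

Lemma eqlcs_expM j x y n : lcs j x -> lcs j y ->
  eqlcs j.+1 ((x * y) ^+ n) (x ^+ n * y ^+ n).
Proof.
move=> Lx Ly; elim: n => [|n ih]; first by rewrite mulg1; exact: eqlcs_refl.
rewrite !expgS; apply: eqlcs_trans (eqlcsM (eqlcs_refl _ _) ih) _.
rewrite -!mulgA; apply: eqlcsM; first exact: eqlcs_refl.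
rewrite !mulgA; apply: eqlcsM; last exact: eqlcs_refl.
exact: eqlcs_comm Ly _ _.
Qed.

Lemma eqlcs_prodM j n (E F : nat -> G) : (forall i, lcs j (F i)) ->
  eqlcs j.+1 ((\prod_(i < n) E i) * \prod_(i < n) F i)
    (\prod_(i < n) (E i * F i)).
Proof.
move=> LF; elim: n => [|n ih].
  by rewrite !big_ord0 mulg1; exact: eqlcs_refl.
rewrite !big_ord_recr /=.
apply: eqlcs_trans (eqlcsM ih (eqlcs_refl _ (E n * F n))).
rewrite -!mulgA; apply: eqlcsM; first exact: eqlcs_refl.
rewrite !mulgA; apply: eqlcsM; last exact: eqlcs_refl.
apply: eqlcs_sym; apply: eqlcs_comm (leqnn _).
elim: (n) => [|m ihm]; first by rewrite big_ord0; exact: lcs1.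
by rewrite big_ord_recr; apply: lcsM.
Qed.

Lemma eqlcs_brkM i x y vs : lcs i.+1 x -> lcs i.+1 y ->
  eqlcs (i.+2 + size vs) (brk (x * y) vs) (brk x vs * brk y vs).
Proof.
elim: vs i x y => [|c vs ih] i x y Lx Ly /=; first exact: eqlcs_refl.
rewrite -addSnnS; apply: eqlcs_trans (ih _ _ _ (lcsR1 c Lx) (lcsR1 c Ly)).
by apply: eqlcs_brk; [apply/lcsR1/lcsM|exact: eqlcs_commMg].
Qed.

Lemma eqlcs_brkV i x vs : lcs i.+1 x ->
  eqlcs (i.+2 + size vs) (brk x^-1 vs) (brk x vs)^-1.
Proof.
move=> Lx; have := @eqlcs_brkM i _ _ vs (lcsV Lx) Lx.
have -> : brk (x^-1 * x) vs = 1.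
  by rewrite mulVg; elim: vs => //= c vs ih; rewrite comm1g.
move=> h; rewrite /eqlcs -invgM; apply: lcsV.
have : eqlcs (i.+2 + size vs) (brk x vs * brk x^-1 vs) 1.
  apply: eqlcs_trans (eqlcs_sym h).
  apply: eqlcs_comm (leqnn _).
  exact: (lcs_brk vs Lx).
by move=> /eqlcs_sym; rewrite /eqlcs invg1 mul1g.
Qed.

Lemma dseq_lcs j q i k : (forall k, lcs j (q k)) -> lcs j (iter i (@dseq G) q k).
Proof.
move=> h; elim: i k => [|i ih] k //=.
by apply: lcsM => //; exact: lcsV.
Qed.

Lemma polyseq_iter d n q : polyseq d n q ->
  forall k, lcs (n + d) (iter d (@dseq G) q k).
Proof.
elim: d n q => [|d ih] n q [h1 h2] k; first by rewrite addn0; exact: h1.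
by rewrite iterSr addnS -addSn; exact: ih.
Qed.

(** Newton's forward difference formula; the order of the factors does not matter because [lcs j] is
    central modulo [lcs j.+1]. *)
Lemma polyseq_taylor j d q : (forall k, lcs j (q k)) ->
  (forall k, lcs j.+1 (iter d.+1 (@dseq G) q k)) ->
  forall k, eqlcs j.+1 (q k)
    (\prod_(i < d.+1) (iter i (@dseq G) q 0%N ^+ 'C(k, i))).
Proof.
elim: d q => [|d ih] q hq hd k.
  rewrite big_ord1 /= bin0 expg1; elim: k => [|k ihk]; first exact: eqlcs_refl.
  apply: eqlcs_trans ihk; apply: eqlcs_sym.
  by have := hd k; rewrite /= /dseq.
set r := dseq q.
have hr : forall k, lcs j (r k) by move=> m; exact: (dseq_lcs 1 _ hq).
have {ih} hT : forall k, eqlcs j.+1 (r k)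
    (\prod_(i < d.+1) (iter i.+1 (@dseq G) q 0%N ^+ 'C(k, i))).
  move=> m; have := ih r hr _ m; under eq_bigr => i _ do rewrite /r -iterSr.
  by apply => m'; rewrite /r -iterSr.
rewrite big_ord_recl /= bin0 expg1.
elim: k => [|k ihk].
  rewrite big1 ?mulg1; first exact: eqlcs_refl.
  by move=> i _; rewrite bin0n.
have -> : q k.+1 = q k * r k by rewrite /r /dseq mulVKg.
apply: eqlcs_trans (eqlcsM ihk (hT k)) _.
rewrite -mulgA; apply: eqlcsM; first exact: eqlcs_refl.
have LE i n : lcs j (iter i.+1 (@dseq G) q 0%N ^+ n).
  by apply: (subgroupX _ (lcs_subgroup _ _)); exact: (dseq_lcs i.+1 _ hq).
apply: eqlcs_trans (@eqlcs_prodM j d.+1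
  (fun i => iter i.+1 (@dseq G) q 0%N ^+ 'C(k, i.+1))
  (fun i => iter i.+1 (@dseq G) q 0%N ^+ 'C(k, i)) _) _ => [i|]; first exact: LE.
rewrite (eq_bigr (fun i : 'I_d.+1 => iter i.+1 (@dseq G) q 0%N ^+ 'C(k.+1, i.+1))).
  exact: eqlcs_refl.
by move=> i _; rewrite binS (expgnDr (iter i.+1 (@dseq G) q 0%N)).
Qed.

(** In the application [N] consists of the sequences of sublinear length. [NS] permits a dilation,
    which turns binomial exponents into the plain powers of [Nbrk]. *)
Variables (N : set (nat -> G)) (j : nat).
Hypothesis N1 : N (fun=> 1).
Hypothesis NM : forall q r, N q -> N r -> N (fun k => q k * r k).
Hypothesis NV : forall q, N q -> N (fun k => (q k)^-1).
Hypothesis NS : forall q n, (0 < n)%N -> N (fun k => q (n * k)%N) -> N q.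
Hypothesis NSucc : polyseqs j.+2 `<=` N.
Hypothesis Nbrk : forall x vs l, size vs = j -> (l <= j.+1)%N ->
  N (fun k => brk x vs ^+ (k ^ l)).

Lemma polyNprod n (F : nat -> nat -> G) : (forall i, (i < n)%N -> N (F i)) ->
  N (fun k => \prod_(i < n) F i k).
Proof.
elim: n => [|n ih] h.
  rewrite (_ : (fun _ => _) = fun=> 1) //.
  by apply/funext => k; rewrite big_ord0.
rewrite (_ : (fun _ => _) = fun k => (\prod_(i < n) F i k) * F n k); last first.
  by apply/funext => k; rewrite big_ord_recr.
by apply: NM; [apply: ih => i /ltnW; exact: h|exact: h].
Qed.

Lemma polyNpow q n : N q -> N (fun k => q k ^+ n).
Proof.
move=> Nq; elim: n => [|n ih] //.
rewrite (_ : (fun _ => _) = fun k => q k * q k ^+ n); first exact: NM.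
by apply/funext => k; rewrite expgS.
Qed.

Lemma polyNeq q r : polyseqs 1 q -> polyseqs 1 r ->
  (forall k, eqlcs j.+2 (q k) (r k)) -> N r -> N q.
Proof.
move=> hq hr h Nr.
rewrite (_ : q = fun k => r k * ((r k)^-1 * q k)); last first.
  by apply/funext => k; rewrite mulVKg.
apply: NM => //; apply: NSucc; apply: (@polyseqs_sub _ 1).
  by move=> k; exact: (eqlcs_sym (h k)).
by apply: polyseqsM => //; exact: polyseqsV.
Qed.

Lemma polyNbrk_bin x vs i : size vs = j -> (i <= j.+1)%N ->
  N (fun k => brk x vs ^+ 'C(k, i)).
Proof.
move=> sz ij; have [P [Q PQ]] := bin_fact_exp_sum i.
apply: (NS (n := i`!)); first exact: fact_gt0.
set z := brk x vs.
rewrite (_ : (fun k => _) = fun k =>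
    (\prod_(l < i.+1) (z ^+ (k ^ l)) ^+ P l) *
    (\prod_(l < i.+1) (z ^+ (k ^ l)) ^+ Q l)^-1); last first.
  apply/funext => k.
  have E (c : nat -> nat) : \prod_(l < i.+1) (z ^+ (k ^ l)) ^+ c l =
      z ^+ (\sum_(l < i.+1) c l * k ^ l).
    elim: (i.+1) => [|m ih]; first by rewrite !big_ord0.
    by rewrite !big_ord_recr /= ih expgnDr -expgnA mulnC.
  by rewrite !E -PQ expgnDr mulgK.
apply: NM; last apply: NV; apply: (polyNprod (F := fun l k => (z ^+ (k ^ l)) ^+ _ l))
  => l li; apply: polyNpow; apply: Nbrk => //; exact: leq_trans ij.
Qed.

(** Unwinds [u] into commutators one at a time, stacking the letters met so far on [vs]; every
    failure of multiplicativity lies in [lcs j.+2] and is covered by [NSucc]. *)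
Lemma polyNlcs_bin m u vs i : lcs m.+1 u -> (m + size vs = j)%N -> (i <= j.+1)%N ->
  N (fun k => brk u vs ^+ 'C(k, i)).
Proof.
elim: m u vs => [|m ih] u vs Lu sz ij; first exact: polyNbrk_bin.
have szj : j.+2 = (m.+3 + size vs)%N by rewrite !addSn -addSn sz.
have Lb v : lcs m.+2 v -> lcs j.+1 (brk v vs).
  by move=> Lv; rewrite -sz -addSn; exact: lcs_brk.
have PB (v : G) : lcs j.+1 v -> polyseqs 1 (fun k => v ^+ 'C(k, i)).
  move=> Lv; apply: (@polyseqs_sub _ j.+1); last exact: polyseqs_bin.
  by move=> k; apply: (subgroupX _ (lcs_subgroup _ _)).
have sH : is_subgroup [set v | lcs m.+2 v /\ N (fun k => brk v vs ^+ 'C(k, i))].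
  split=> [|x y [Lx Nx] [Ly Ny]|x [Lx Nx]].
  - split; first exact: lcs1.
    rewrite (_ : brk 1 vs = 1); last by elim: (vs) => //= c s; rewrite comm1g.
    by rewrite (_ : (fun _ => _) = fun=> 1) //; apply/funext => k; rewrite expg1n.
  - split; first exact: lcsM.
    apply: polyNeq (NM Nx Ny).
    + by apply: PB; apply: Lb; exact: lcsM.
    + by apply: polyseqsM; apply: PB; exact: Lb.
    move=> k; apply: eqlcs_trans (eqlcs_expM _ (Lb _ Lx) (Lb _ Ly)).
    by apply: eqlcsX; rewrite szj; exact: eqlcs_brkM.
  - split; first exact: lcsV.
    apply: polyNeq (NV Nx).
    + by apply: PB; apply: Lb; exact: lcsV.
    + by apply: polyseqsV; apply: PB; exact: Lb.
    move=> k; rewrite -expVgn.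
    by apply: eqlcsX; rewrite szj; exact: eqlcs_brkV.
suff : lcs m.+2 `<=` [set v | lcs m.+2 v /\ N (fun k => brk v vs ^+ 'C(k, i))].
  by move=> /(_ u Lu)[].
apply: lcs_ind sH _ => a c La; split; first exact: lcsR1.
by apply: (ih a (c :: vs)) => //=; rewrite addnS.
Qed.

(** Modulo [lcs j.+2] the sequence is a product of binomial powers of fixed elements of [lcs j.+1].
    The expansion stops at order [j.+1], since the next difference already lies in [lcs j.+2]. *)
Lemma polyseqs_reduction : polyseqs j.+1 `<=` N.
Proof.
move=> q hq; have [hp hv] := hq.
have hi k : lcs j.+2 (iter j.+2 (@dseq G) q k).
  by have := polyseq_iter (hp j.+2) k; rewrite add0n.
have hT := polyseq_taylor hv hi.
have LE i : lcs j.+1 (iter i (@dseq G) q 0%N) by exact: dseq_lcs.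
have PT : polyseqs 1 (fun k =>
    \prod_(i < j.+2) (iter i (@dseq G) q 0%N ^+ 'C(k, i))).
  have : forall m, (m <= j.+2)%N -> polyseqs j.+1 (fun k =>
      \prod_(i < m) (iter i (@dseq G) q 0%N ^+ 'C(k, i))).
    elim=> [|m ih] mj.
      rewrite (_ : (fun _ => _) = fun=> 1); first exact/polyseqs_cst/lcs1.
      by apply/funext => k; rewrite big_ord0.
    rewrite (_ : (fun _ => _) = fun k =>
      (\prod_(i < m) (iter i (@dseq G) q 0%N ^+ 'C(k, i))) *
      (iter m (@dseq G) q 0%N ^+ 'C(k, m))); last first.
      by apply/funext => k; rewrite big_ord_recr.
    by apply: polyseqsM; [apply/ih/ltnW|apply: polyseqs_bin].
  by move=> /(_ j.+2 (leqnn _)); apply: polyseqs_sub.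
have h1 : polyseqs 1 q by apply: (@polyseqs_sub _ j.+1).
apply: (polyNeq h1 PT hT).
apply: (polyNprod (F := fun i k => iter i (@dseq G) q 0%N ^+ 'C(k, i))) => i ij.
by apply: (@polyNlcs_bin j _ [::]) => //=; rewrite addn0.
Qed.

End PolynomialReduction.

(** * Invariant functionals and the length of commutators *)

Section BanachLimit.
Variable R : realType.

Lemma ultra_bounded_cvg (T : Type) (F : set_system T) (u : T -> R) (C : R) :
  UltraFilter F -> (\forall t \near F, `|u t| <= C) -> cvg (u @ F).
Proof.
move=> UF uC.
have FC : (u @ F) `[- C, C]%classic.
  apply: filterS uC => t; rewrite ler_norml => /andP[h1 h2] /=.
  by rewrite in_itv /= h1.
have [p [_ clp]] := @segment_compact _ (- C) C (u @ F) _ FC.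
apply/cvg_ex; exists (p : R) => A Ap.
have [//|FnA] := in_ultra_setVsetC (u @^-1` A) UF.
have [x [Ax Bx]] := clp (~` A) A FnA Ap.
by [].
Qed.

(** Stated for an arbitrary proper filter since the averages over a group run along finite families
    of elements, not only along the integers. *)
Lemma banach_lim (T : Type) (F : set_system T) : ProperFilter F ->
  exists L : (T -> R) -> R,
  let bnd u := exists C, \forall t \near F, `|u t| <= C in
  [/\ forall u v, bnd u -> bnd v -> L (fun t => u t + v t) = L u + L v,
      forall a u, bnd u -> L (fun t => a * u t) = a * L u &
      forall u c, bnd u -> (\forall t \near F, u t <= c) -> L u <= c].
Proof.
move=> FF; have [U [UU FU]] := ultraFilterLemma FF.
exists (fun u => lim (u @ U)) => bnd.
have bc u : bnd u -> cvg (u @ U).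
  by move=> [C uC]; apply: (@ultra_bounded_cvg _ _ _ C) => //; exact: FU.
split=> [u v bu bv|a u bu|u c bu uc].
- apply/cvg_lim => //; exact: (cvgD (bc _ bu) (bc _ bv)).
- by apply/cvg_lim => //; apply: cvgMr; exact: bc.
- by apply: limr_le; [exact: bc|exact: FU].
Qed.

End BanachLimit.

Section InvariantFunctionals.
Variables (R : realType) (G : groupType) (Om : Type).
Variable act : Om -> G -> Om.
Hypothesis actM : forall w p q, act (act w p) q = act w (p * q)%g.
Hypothesis act1 : forall w, act w 1%g = w.
Implicit Types (Phi Psi : Om -> R) (xi : (Om -> R) -> R) (H K : set G).

Definition rt (p : G) Phi : Om -> R := fun w => Phi (act w p).

Lemma rtM p q Phi : rt p (rt q Phi) = rt (p * q)%g Phi.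
Proof. by apply/funext => w; rewrite /rt actM. Qed.

Lemma rt1 Phi : rt 1%g Phi = Phi.
Proof. by apply/funext => w; rewrite /rt act1. Qed.

Lemma rtD p Phi Psi : rt p (Phi + Psi) = rt p Phi + rt p Psi.
Proof. by []. Qed.

Lemma rtZ p a Phi : rt p (a *: Phi) = a *: rt p Phi.
Proof. by []. Qed.

Lemma rt_sum p n (F : 'I_n -> Om -> R) :
  rt p (\sum_(i < n) F i) = \sum_(i < n) rt p (F i).
Proof. by apply/funext => w; rewrite /rt !fct_sumE. Qed.

(** [B] stands for the integrable functions; functionals are total and their laws are required on
    [B] only. Through [Bsg], multiplication by a sign supplies the functionals that attain the norm
    [xi |.|]. *)
Variable B : set (Om -> R).
Hypothesis B0 : B 0.
Hypothesis BD : forall Phi Psi, B Phi -> B Psi -> B (Phi + Psi).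
Hypothesis BZ : forall a Phi, B Phi -> B (a *: Phi).
Hypothesis Babs : forall Phi, B Phi -> B (fun w => `|Phi w|).
Hypothesis Bsg : forall Phi Psi, B Phi -> B Psi ->
  B (fun w => Num.sg (Phi w) * Psi w).
Hypothesis Brt : forall p Phi, B Phi -> B (rt p Phi).

Lemma invariant_domainN Phi : B Phi -> B (- Phi).
Proof. by move=> h; rewrite -scaleN1r; exact: BZ. Qed.

Lemma invariant_domainB Phi Psi : B Phi -> B Psi -> B (Phi - Psi).
Proof. by move=> h h'; apply: BD => //; exact: invariant_domainN. Qed.

Lemma invariant_domain_sum n (F : 'I_n -> Om -> R) :
  (forall i, B (F i)) -> B (\sum_(i < n) F i).
Proof.
elim: n F => [|n ih] F h; first by rewrite big_ord0.
by rewrite big_ord_recr; apply: BD => //; exact: ih.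
Qed.

Definition linear_on xi :=
  (forall Phi Psi, B Phi -> B Psi -> xi (Phi + Psi) = xi Phi + xi Psi) /\
  (forall a Phi, B Phi -> xi (a *: Phi) = a * xi Phi).

Definition invariant_under K xi :=
  forall k Phi, K k -> B Phi -> xi (rt k Phi) = xi Phi.

Lemma linear_on0 xi : linear_on xi -> xi 0 = 0.
Proof. by move=> [_ h]; rewrite -(scale0r (0 : Om -> R)) h // mul0r. Qed.

Lemma linear_onN xi Phi : linear_on xi -> B Phi -> xi (- Phi) = - xi Phi.
Proof. by move=> [_ h] b; rewrite -scaleN1r h // mulN1r. Qed.

Lemma linear_onB xi Phi Psi : linear_on xi -> B Phi -> B Psi ->
  xi (Phi - Psi) = xi Phi - xi Psi.
Proof.
move=> lxi b b'; rewrite -linear_onN //; case: lxi => h _.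
by rewrite h //; exact: invariant_domainN.
Qed.

Lemma linear_on_sum xi n (F : 'I_n -> Om -> R) : linear_on xi ->
  (forall i, B (F i)) -> xi (\sum_(i < n) F i) = \sum_(i < n) xi (F i).
Proof.
move=> lxi; elim: n F => [|n ih] F h.
  by rewrite !big_ord0; exact: linear_on0.
rewrite !big_ord_recr /= -ih //; case: lxi => hD _; apply: hD => //.
exact: invariant_domain_sum.
Qed.

Section Averaging.
Variables (H K : set G) (xi : (Om -> R) -> R).
Hypothesis lxi : linear_on xi.
Hypothesis gK : is_subgroup K.
Hypothesis hK : forall h k, H h -> K k -> H (h ^ k)%g.
Hypothesis cK : forall a b, K a -> K b -> H [~ a, b]%g.
Hypothesis iH : invariant_under H xi.
Hypothesis bK : forall Phi, B Phi -> exists C : R, forall k, K k ->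
  `|xi (rt k Phi)| <= C.

Let KM a b : K a -> K b -> K (a * b)%g. Proof. by case: gK => _ h _; apply: h. Qed.
Let KV a : K a -> K a^-1%g. Proof. by case: gK => _ _ h; apply: h. Qed.
Let K1 : K 1%g. Proof. by case: gK. Qed.

Let swap k x y Psi : B Psi -> K k -> K x -> K y ->
  xi (rt (k * x * y)%g Psi) = xi (rt (k * y * x)%g Psi).
Proof.
move=> b Kk Kx Ky.
have -> : (k * x * y = [~ x^-1, y^-1] ^ k^-1 * (k * y * x))%g.
  by rewrite /commg /conjg !invgK !mulgA !(mulgK, mulgVK).
have Hc : H ([~ x^-1, y^-1] ^ k^-1)%g by apply: (hK (cK (KV Kx) (KV Ky))); exact: KV.
by rewrite -(rtM _ (k * y * x)%g) (iH Hc) //; exact: Brt.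
Qed.

Definition cesaro n (a : G) Phi : Om -> R :=
  n%:R^-1 *: \sum_(i < n) rt (a ^+ i)%g Phi.

Fixpoint cesaros n (s : seq G) Phi : Om -> R :=
  if s is a :: s' then cesaro n a (cesaros n s' Phi) else Phi.

Let Bces n s Phi : B Phi -> B (cesaros n s Phi).
Proof.
move=> b; elim: s => //= a s ih; apply: BZ; apply: invariant_domain_sum => i.
exact: Brt.
Qed.

Let xi_cesaro n a k Phi : B Phi ->
  xi (rt k (cesaro n a Phi)) = n%:R^-1 * \sum_(i < n) xi (rt (k * a ^+ i)%g Phi).
Proof.
move=> b; rewrite /cesaro rtZ rt_sum.
have Bi (i : 'I_n) : B (rt k (rt (a ^+ i)%g Phi)) by do 2 apply: Brt.
case: (lxi) => _ ->; last exact: invariant_domain_sum.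
by rewrite linear_on_sum //; under eq_bigr => i _ do rewrite rtM.
Qed.

Let KX a i : K a -> K (a ^+ i)%g. Proof. exact: subgroupX. Qed.

Let cesaros_le n s Phi c : (0 < n)%N -> (forall a, a \in s -> K a) -> B Phi ->
  (forall k, K k -> xi (rt k Phi) <= c) ->
  forall k, K k -> xi (rt k (cesaros n s Phi)) <= c.
Proof.
move=> n0 sK b hc; elim: s sK => [|a s ih] sK k Kk //=; first exact: hc.
have Ka : K a by apply: sK; rewrite mem_head.
rewrite xi_cesaro; last exact: Bces.
rewrite mulrC ler_pdivrMr ?ltr0n //.
have -> : c * n%:R = \sum_(i < n) c by rewrite sumr_const card_ord mulr_natr.
apply: ler_sum => i _; apply: ih => [a' a's|]; last exact/KM/KX.
by apply: sK; rewrite inE a's orbT.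
Qed.

Let cesarosD n s Phi Psi : cesaros n s (Phi + Psi) = cesaros n s Phi + cesaros n s Psi.
Proof.
by elim: s => //= a s ->; rewrite /cesaro -scalerDr -big_split.
Qed.

Let cesarosZ n s a Phi : cesaros n s (a *: Phi) = a *: cesaros n s Phi.
Proof.
by elim: s => //= c s ->; rewrite /cesaro [RHS]scalerA mulrC -scalerA [X in _ = _ *: X]scaler_sumr.
Qed.

Let cesaros_comm n s a k Phi : (forall b, b \in s -> K b) -> B Phi ->
  K a -> K k ->
  xi (rt k (cesaros n s (rt a Phi))) = xi (rt (k * a)%g (cesaros n s Phi)).
Proof.
move=> sK b Ka; elim: s sK k => [|c s ih] sK k Kk /=; first by rewrite rtM.
have Kc : K c by apply: sK; rewrite mem_head.
rewrite !xi_cesaro; [|exact: Bces|by apply: Bces; exact: Brt].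
congr (_ * _); apply: eq_bigr => i _; rewrite ih; last 2 first.
- by move=> d ds; apply: sK; rewrite inE ds orbT.
- exact/KM/KX.
by apply: swap => //; [exact: Bces|exact: KX].
Qed.

(** In the direction [a] the mean telescopes to two boundary terms, whence [2 C / n]. Outer means
    preserve an upper bound, and the translation by [a] passes through the inner ones by
    [cesaros_comm]. *)
Let cesaros_inv n s a Phi C k : (0 < n)%N -> (forall b, b \in s -> K b) ->
  B Phi -> a \in s -> (forall k, K k -> `|xi (rt k Phi)| <= C) -> K k ->
  xi (rt k (cesaros n s (rt a Phi - Phi))) <= 2 * C / n%:R.
Proof.
move=> n0 sK b + hC; have Bd : B (rt a Phi - Phi).
  by apply: invariant_domainB => //; exact: Brt.
elim: s sK k => // c s ih sK k + Kk; rewrite inE => /orP[/eqP ac|as_]; last first.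
  have := @cesaros_le n [:: c] (cesaros n s (rt a Phi - Phi)) (2 * C / n%:R) n0.
  apply=> //; first by move=> d; rewrite inE => /eqP ->; apply: sK; rewrite mem_head.
  - exact: Bces.
  - by move=> k' Kk'; apply: ih => // d ds; apply: sK; rewrite inE ds orbT.
have Ka : K a by apply: sK; rewrite ac mem_head.
have sK' : forall d, d \in s -> K d by move=> d ds; apply: sK; rewrite inE ds orbT.
rewrite /= -ac xi_cesaro; last exact: Bces.
set Psi := cesaros n s Phi.
have BPsi : B Psi by exact: Bces.
have E i : xi (rt (k * a ^+ i)%g (cesaros n s (rt a Phi - Phi))) =
    xi (rt (k * a ^+ i.+1)%g Psi) - xi (rt (k * a ^+ i)%g Psi).
  rewrite cesarosD -[- Phi]scaleN1r cesarosZ scaleN1r.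
  have -> : rt (k * a ^+ i)%g (cesaros n s (rt a Phi) - Psi) =
    rt (k * a ^+ i)%g (cesaros n s (rt a Phi)) - rt (k * a ^+ i)%g Psi by [].
  rewrite linear_onB //; [|by apply: Brt; apply: Bces; exact: Brt|exact: Brt].
  by rewrite cesaros_comm // ?expgSr ?mulgA //; exact/KM/KX.
under eq_bigr => i _ do rewrite E.
rewrite mulrC ler_pM2r ?invr_gt0 ?ltr0n //.
have -> : \sum_(i < n) (xi (rt (k * a ^+ i.+1)%g Psi) - xi (rt (k * a ^+ i)%g Psi)) =
    xi (rt (k * a ^+ n)%g Psi) - xi (rt k Psi).
  by rewrite -(big_mkord xpredT (fun i => xi (rt (k * a ^+ i.+1)%g Psi) -
    xi (rt (k * a ^+ i)%g Psi))) telescope_sumr // expg0 mulg1.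
have bd j : K j -> `|xi (rt j Psi)| <= C.
  move=> Kj; rewrite ler_norml; apply/andP; split; last first.
    by apply: cesaros_le => // k' Kk'; exact: le_trans (ler_norm _) (hC _ Kk').
  rewrite lerNl -linear_onN //; last exact: Brt.
  have -> : - rt j Psi = rt j (cesaros n s (- Phi)).
    by rewrite -[- Phi]scaleN1r cesarosZ scaleN1r.
  apply: cesaros_le => //; first exact: invariant_domainN.
  move=> k' Kk'; have -> : rt k' (- Phi) = - rt k' Phi by [].
  rewrite linear_onN //; last exact: Brt.
  by apply: le_trans (ler_norm _) _; rewrite normrN; exact: hC.
have := bd _ (KM Kk (KX n Ka)); have := bd _ Kk; rewrite !ler_norml.
by move=> /andP[h1 h2] /andP[h3 h4]; lra.
Qed.

(** [K / H] is abelian, hence amenable: Cesaro means in different directions commute under [xi], so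
    a limit over growing families of directions and growing lengths is invariant under all of [K].
    The one-sided bound transports both positivity and norm estimates. *)
Lemma average_invariant : exists xi' : (Om -> R) -> R,
  [/\ linear_on xi', invariant_under K xi' &
      forall Phi c, B Phi -> (forall k, K k -> xi (rt k Phi) <= c) ->
        xi' Phi <= c].
Proof.
(* Directions are finite lists ordered by inclusion; together with lower bounds on the length they
   form the base of a proper filter. *)
pose good (s0 : seq G) (n0 : nat) : set (seq G * nat) := [set p : seq G * nat |
  [/\ forall a, a \in p.1 -> K a, {subset s0 <= p.1}, (n0 <= p.2)%N & (0 < p.2)%N]].
pose D : set (seq G * nat) := [set p : seq G * nat | forall a, a \in p.1 -> K a].
pose F := filter_from D (fun p => good p.1 p.2).
have FF : ProperFilter F.
  apply: filter_from_proper; last first.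
    move=> [s n] /= Ds; exists (s, n.+1); split=> //=.
  apply: filter_from_filter; first by exists ([::], 0%N).
  move=> [s n] [s' n'] Ds Ds'; exists (s ++ s', maxn n n').
    by move=> a /=; rewrite mem_cat => /orP[/Ds|/Ds'].
  move=> [t m] /= [h1 h2 h3 h4]; split; split=> //=.
  - by move=> a sa; apply: h2; rewrite mem_cat sa.
  - exact: leq_trans (leq_maxl _ _) h3.
  - by move=> a sa; apply: h2; rewrite mem_cat sa orbT.
  - exact: leq_trans (leq_maxr _ _) h3.
have [L [LD LZ Lle]] := @banach_lim R _ _ FF.
pose u Phi (p : seq G * nat) := xi (cesaros p.2 p.1 Phi).
have near_good (P : set (seq G * nat)) s n : D (s, n) ->
    (forall p, good s n p -> P p) -> \forall p \near F, P p.
  by move=> Ds h; exists (s, n) => //.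
have xle Phi c p : B Phi -> good [::] 0%N p ->
    (forall k, K k -> xi (rt k Phi) <= c) -> u Phi p <= c.
  move=> b [h1 _ _ h4] hc; have := cesaros_le h4 h1 b hc K1.
  by rewrite rt1.
have bu Phi : B Phi -> exists C : R, \forall p \near F, `|u Phi p| <= C.
  move=> b; have [C hC] := bK b; exists C.
  apply: (near_good _ [::] 0%N) => // p gp.
  rewrite ler_norml; apply/andP; split; last first.
    by apply: xle => // k Kk; exact: le_trans (ler_norm _) (hC _ Kk).
  have -> : u Phi p = - u (- Phi) p.
    rewrite /u -[- Phi]scaleN1r cesarosZ scaleN1r linear_onN ?opprK //.
    exact: Bces.
  rewrite lerN2; apply: xle => //; first exact: invariant_domainN.
  move=> k Kk; have -> : rt k (- Phi) = - rt k Phi by [].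
  rewrite linear_onN //; last exact: Brt.
  by apply: le_trans (ler_norm _) _; rewrite normrN; exact: hC.
pose xi' Phi := L (u Phi).
have lxi' : linear_on xi'.
  split=> [Phi Psi b b'|a Phi b].
    rewrite /xi' -LD; try exact: bu.
    congr L; apply/funext => p; rewrite /u cesarosD; case: (lxi) => -> //; exact: Bces.
  rewrite /xi' -LZ; last exact: bu.
  congr L; apply/funext => p; rewrite /u cesarosZ; case: (lxi) => _ -> //; exact: Bces.
have le' Phi c : B Phi -> (forall k, K k -> xi (rt k Phi) <= c) -> xi' Phi <= c.
  move=> b hc; apply: Lle; first exact: bu.
  by apply: (near_good _ [::] 0%N) => // p gp; exact: xle.
exists xi'; split=> //.
have inv_le k Phi : K k -> B Phi -> xi' (rt k Phi - Phi) <= 0.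
  move=> Kk b; have Bd : B (rt k Phi - Phi).
    by apply: invariant_domainB => //; exact: Brt.
  have [C hC] := bK b.
  have C0 : 0 <= C by apply: le_trans (hC _ K1); exact: normr_ge0.
  apply/ler_addgt0Pr => e e0; rewrite add0r; apply: Lle; first exact: bu.
  pose m := Num.truncn (2 * C / e); apply: (near_good _ [:: k] m.+1).
    by move=> a; rewrite inE => /eqP ->.
  move=> p [h1 h2 h3 h4].
  have := @cesaros_inv p.2 p.1 k Phi C 1%g h4 h1 b (h2 _ (mem_head _ _)) hC K1.
  rewrite rt1 => /le_trans; apply.
  rewrite ler_pdivrMr ?ltr0n // [e * _]mulrC -ler_pdivrMr //.
  have := truncnS_gt (2 * C / e); rewrite -/m => /ltW/le_trans; apply.
  by rewrite ler_nat.
move=> k Phi Kk b; apply/eqP; rewrite eq_le; apply/andP; split.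
  have := inv_le _ _ Kk b; rewrite linear_onB // ?subr_le0 //; exact: Brt.
have := inv_le _ _ (KV Kk) (Brt k b); rewrite rtM mulVg rt1 linear_onB // ?subr_le0 //.
exact: Brt.
Qed.

End Averaging.

Definition absf Phi : Om -> R := fun w => `|Phi w|.

Definition positive_on xi :=
  linear_on xi /\ forall Phi, B Phi -> (forall w, 0 <= Phi w) -> 0 <= xi Phi.

Lemma positive_on_le xi Phi Psi : positive_on xi -> B Phi -> B Psi ->
  (forall w, Phi w <= Psi w) -> xi Phi <= xi Psi.
Proof.
move=> [lxi h] b b' le; rewrite -subr_ge0 -linear_onB //.
by apply: h => [|w]; [exact: invariant_domainB|rewrite subr_ge0].
Qed.

Lemma positive_on_abs xi Phi : positive_on xi -> B Phi ->
  `|xi Phi| <= xi (absf Phi).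
Proof.
move=> pxi b; have [lxi _] := pxi; have b' := Babs b.
rewrite ler_norml lerNl -linear_onN //; apply/andP; split.
  apply: positive_on_le => // [|w]; first exact: invariant_domainN.
  by rewrite /absf -normrN; exact: ler_norm.
by apply: positive_on_le => // w; exact: ler_norm.
Qed.

Lemma positive_on_absD xi Phi Psi : positive_on xi -> B Phi -> B Psi ->
  xi (absf (Phi + Psi)) <= xi (absf Phi) + xi (absf Psi).
Proof.
move=> pxi b b'; have [[hD _] _] := pxi.
rewrite -hD; try exact: Babs; apply: positive_on_le => // [||w].
- by apply: Babs; exact: BD.
- by apply: BD; exact: Babs.
- exact: ler_normD.
Qed.

Lemma positive_on_absrt xi p Phi : invariant_under setT xi -> B Phi ->
  xi (absf (rt p Phi)) = xi (absf Phi).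
Proof. by move=> ixi b; rewrite -(ixi p (absf Phi)) //; exact: Babs. Qed.

(** In the application [b v] is formally the coboundary [rt v f - f] of the embedding; [f] itself is
    unbounded, and only the differences lie in [B]. *)
Variable b : G -> Om -> R.
Hypothesis Bb : forall v, B (b v).
Hypothesis bM : forall v w, b (v * w)%g = b v + rt v (b w).

Lemma cocycle1 : b 1%g = 0.
Proof.
have := bM 1%g 1%g; rewrite mulg1 rt1 => /eqP.
by rewrite -subr_eq subrr => /eqP <-.
Qed.

Lemma cocycleX v n : b (v ^+ n)%g = \sum_(i < n) rt (v ^+ i)%g (b v).
Proof.
elim: n => [|n ih]; first by rewrite expg0 cocycle1 big_ord0.
by rewrite expgSr bM ih big_ord_recr.
Qed.

Definition len xi v := xi (absf (b v)).

Section Length.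
Variable xi : (Om -> R) -> R.
Hypothesis pxi : positive_on xi.
Hypothesis ixi : invariant_under setT xi.

Lemma len_ge0 v : 0 <= len xi v.
Proof. by case: pxi => _; apply=> [|w]; [exact: Babs|exact: normr_ge0]. Qed.

Lemma len1 : len xi 1%g = 0.
Proof.
have [lxi _] := pxi; rewrite /len cocycle1 (_ : absf 0 = 0) ?linear_on0 //.
by apply/funext => w; rewrite /absf normr0.
Qed.

Lemma lenM v w : len xi (v * w)%g <= len xi v + len xi w.
Proof.
rewrite /len bM -(positive_on_absrt v ixi (Bb w)).
by apply: positive_on_absD => //; exact: Brt.
Qed.

Lemma lenV v : len xi v^-1%g = len xi v.
Proof.
rewrite /len; have -> : b v^-1%g = - rt v^-1%g (b v).
  by apply/eqP; rewrite -addr_eq0 -bM mulVg cocycle1.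
rewrite -[RHS](positive_on_absrt v^-1%g ixi (Bb v)); congr xi.
by apply/funext => w; rewrite /absf fctE normrN.
Qed.

Lemma lenX v n : len xi (v ^+ n)%g <= n%:R * len xi v.
Proof.
elim: n => [|n ih]; first by rewrite expg0 len1 mul0r.
by rewrite expgS mulrSr mulrDl mul1r addrC; apply: le_trans (lenM _ _) _; rewrite lerD2l.
Qed.

Lemma lenR v w : len xi [~ v, w]%g <= 2 * (len xi v + len xi w).
Proof.
have h1 := lenM v^-1%g (w^-1 * (v * w))%g.
have h2 := lenM w^-1%g (v * w)%g; have h3 := lenM v w.
rewrite /commg /conjg; move: h1 h2; rewrite !lenV => h1 h2; lra.
Qed.

Lemma len_brk w ws : len xi (brk w ws) <=
  2 ^+ size ws * (len xi w + \sum_(v <- ws) len xi v).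
Proof.
elim: ws w => [|c ws ih] w /=; first by rewrite big_nil addr0 expr0 mul1r.
apply: le_trans (ih _) _; rewrite big_cons exprS mulrAC -mulrA [leRHS]mulrC.
have h : 0 <= 2 ^+ size ws :> R by rewrite exprn_ge0.
have hs : 0 <= \sum_(v <- ws) len xi v by apply: sumr_ge0 => *; exact: len_ge0.
have := lenR w c => hR; rewrite -mulrA [X in _ <= X]mulrC -mulrA ler_wpM2l //.
lra.
Qed.

Lemma cocycle_hom v w : xi (b (v * w)%g) = xi (b v) + xi (b w).
Proof.
have [[hD _] _] := pxi; rewrite bM hD //; last exact: Brt.
by rewrite ixi.
Qed.

Lemma cocycle_homX v n : xi (b (v ^+ n)%g) = n%:R * xi (b v).
Proof.
have [lxi _] := pxi; elim: n => [|n ih].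
  by rewrite expg0 cocycle1 mul0r linear_on0.
by rewrite expgS cocycle_hom ih mulrSr mulrDl mul1r addrC.
Qed.

Lemma cocycle_hom_le v : `|xi (b v)| <= len xi v.
Proof. exact: positive_on_abs. Qed.

(* The sign functions of [b (v ^+ n)], averaged along [v], give in the limit a [v]-invariant functional norming all powers of [v]. *)
Lemma norming_functional v : exists zeta : (Om -> R) -> R,
  [/\ linear_on zeta, forall Phi, B Phi -> zeta Phi <= xi (absf Phi),
      forall Phi, B Phi -> zeta (rt v Phi) = zeta Phi &
      forall e, 0 < e -> exists2 A, (0 < A)%N &
        len xi (v ^+ A)%g <= (zeta (b v) + e) * A%:R].
Proof.
have [L [LD LZ Lle]] := @banach_lim R nat \oo _.
pose sgb n Phi : Om -> R := fun w => Num.sg (b (v ^+ n)%g w) * Phi w.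
have Bsgb n Phi : B Phi -> B (sgb n Phi) by exact: Bsg.
have [lxi _] := pxi; have [xD xZ] := lxi.
have sgb_abs n Phi : B Phi -> `|xi (sgb n Phi)| <= xi (absf Phi).
  move=> b'; apply: le_trans (positive_on_abs pxi (Bsgb _ _ b')) _.
  apply: positive_on_le => // [||w]; try exact: Babs; first exact/Babs/Bsgb.
  rewrite /absf /sgb normrM; apply: ler_piMl => //.
  by rewrite normr_sg; case: (_ != 0).
pose u Phi n := n%:R^-1 * \sum_(i < n) xi (sgb n (rt (v ^+ i)%g Phi)).
have ub Phi n : B Phi -> `|u Phi n| <= xi (absf Phi).
  move=> b'; rewrite /u; case: n => [|n].
    by rewrite big_ord0 mulr0 normr0; apply: le_trans (sgb_abs 0%N _ b').
  rewrite normrM normfV normr_nat mulrC ler_pdivrMr //.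
  apply: le_trans (ler_norm_sum _ _ _) _.
  have -> : xi (absf Phi) * n.+1%:R = \sum_(i < n.+1) xi (absf Phi).
    by rewrite sumr_const card_ord mulr_natr.
  apply: ler_sum => i _; apply: le_trans (sgb_abs _ _ (Brt _ b')) _.
  by rewrite positive_on_absrt.
have bu Phi : B Phi -> exists C : R, \forall n \near \oo, `|u Phi n| <= C.
  by move=> b'; exists (xi (absf Phi)); near=> n; exact: ub.
have sgbD n Phi Psi : sgb n (Phi + Psi) = sgb n Phi + sgb n Psi.
  by apply/funext => w; rewrite /sgb !fctE mulrDr.
have sgbZ n a Phi : sgb n (a *: Phi) = a *: sgb n Phi.
  apply/funext => w; rewrite /sgb -[(a *: Phi) w]/(a * Phi w).
  by rewrite -[RHS]/(a * (_ * _)); ring.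
have uD Phi Psi n : B Phi -> B Psi -> u (Phi + Psi) n = u Phi n + u Psi n.
  move=> b1 b2; rewrite /u -mulrDr -big_split /=; congr (_ * _).
  by apply: eq_bigr => i _; rewrite rtD sgbD xD //; apply/Bsgb/Brt.
have uZ a Phi n : B Phi -> u (a *: Phi) n = a * u Phi n.
  move=> b1; rewrite /u mulrCA; congr (_ * _); rewrite mulr_sumr.
  by apply: eq_bigr => i _; rewrite rtZ sgbZ xZ //; apply/Bsgb/Brt.
pose zeta Phi := L (u Phi).
have zD Phi Psi : B Phi -> B Psi -> zeta (Phi + Psi) = zeta Phi + zeta Psi.
  move=> b1 b2; rewrite /zeta -LD; try exact: bu.
  by congr L; apply/funext => n; exact: uD.
have zZ a Phi : B Phi -> zeta (a *: Phi) = a * zeta Phi.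
  move=> b1; rewrite /zeta -LZ; last exact: bu.
  by congr L; apply/funext => n; exact: uZ.
have lz : linear_on zeta by split.
exists zeta; split=> //.
- move=> Phi b1; apply: Lle; first exact: bu.
  by near=> n; exact: le_trans (ler_norm _) (ub _ _ b1).
- have inv_le p Phi : B Phi -> (p = 1 \/ p = -1) ->
      zeta (p *: (rt v Phi - Phi)) <= 0.
    move=> b1 hp; have Bd : B (rt v Phi - Phi).
      by apply: invariant_domainB => //; exact: Brt.
    apply/ler_addgt0Pr => e e0; rewrite add0r; apply: Lle.
      by apply: bu; exact: BZ.
    pose C := xi (absf Phi); near=> n.
    have n0 : (0 < n)%N by near: n; exists 1%N.
    (* Consecutive translates along [v] telescope, and each of the two remaining terms is at most
       [C]. *)
    have E : u (rt v Phi - Phi) n =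
        n%:R^-1 * (xi (sgb n (rt (v ^+ n)%g Phi)) - xi (sgb n Phi)).
      rewrite /u; congr (_ * _).
      transitivity (\sum_(0 <= i < n) (xi (sgb n (rt (v ^+ i.+1)%g Phi)) -
          xi (sgb n (rt (v ^+ i)%g Phi)))).
        rewrite big_mkord; apply: eq_bigr => i _.
        have -> : rt (v ^+ i)%g (rt v Phi - Phi) =
            rt (v ^+ i)%g (rt v Phi) - rt (v ^+ i)%g Phi by [].
        have -> : sgb n (rt (v ^+ i)%g (rt v Phi) - rt (v ^+ i)%g Phi) =
          sgb n (rt (v ^+ i)%g (rt v Phi)) - sgb n (rt (v ^+ i)%g Phi).
          by apply/funext => w; rewrite /sgb !fctE mulrBr.
        rewrite linear_onB //; try by apply/Bsgb/Brt.
          by rewrite rtM -expgSr.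
        by apply/Bsgb/Brt/Brt.
      by rewrite telescope_sumr // expg0 rt1.
    have := sgb_abs n _ (Brt (v ^+ n)%g b1); rewrite positive_on_absrt // => h1.
    have h2 := sgb_abs n _ b1.
    have h3 : 2 * C / n%:R <= e.
      rewrite ler_pdivrMr ?ltr0n // [e * _]mulrC -ler_pdivrMr //.
      by near: n; exact: nbhs_infty_ger.
    apply: le_trans h3; rewrite uZ // E mulrCA mulrC ler_pM2r ?invr_gt0 ?ltr0n //.
    move: h1 h2; rewrite -/C !ler_norml => /andP[h1 h1'] /andP[h2 h2'].
    by case: hp => ->; lra.
  move=> Phi b1; have Bd : B (rt v Phi - Phi).
    by apply: invariant_domainB => //; exact: Brt.
  have := inv_le 1 Phi b1 (or_introl erefl).
  have := inv_le (-1) Phi b1 (or_intror erefl).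
  rewrite !zZ // linear_onB //; last exact: Brt.
  by move=> h1 h2; apply/eqP; rewrite eq_le; apply/andP; split; lra.
move=> e e0; apply: contrapT => hA.
(* By [cocycleX] the orbit sum of [b v] is [b (v ^+ n)], whose pairing with its own sign is its
   length. If no [A] worked, all these averages would exceed their limit by [e]. *)
have : zeta (- b v) <= - (zeta (b v) + e).
  apply: Lle; first by apply: bu; exact: invariant_domainN.
  near=> n; have n0 : (0 < n)%N by near: n; exists 1%N.
  have nR : 0 < n%:R :> R by rewrite ltr0n.
  have -> : u (- b v) n = - (n%:R^-1 * len xi (v ^+ n)%g).
    rewrite -scaleN1r uZ // mulN1r; congr (- (_ * _)).
    rewrite -linear_on_sum //; last by move=> i; apply/Bsgb/Brt.
    congr xi; apply/funext => w; rewrite /absf normrEsg {2}cocycleX.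
    by rewrite !fct_sumE mulr_sumr.
  rewrite lerN2 mulrC ler_pdivlMr //; apply/ltW; rewrite ltNge.
  by apply/negP => h; apply: hA; exists n.
rewrite linear_onN //; lra.
Unshelve. all: by end_near.
Qed.

End Length.

Hypothesis nilG : nilpotent_group G.

(** * From invariance under one element to invariance under the group *)

Section Splitting.
Variable xi : (Om -> R) -> R.
Hypothesis pxi : positive_on xi.
Hypothesis ixi : invariant_under setT xi.
Variables (v : G) (t : R).

(* On [lcs j] with [j >= 2], [c |-> zeta (b c)] is a homomorphism which vanishes because commutators are distorted. *)
Definition norming j zeta := [/\ linear_on zeta,
  forall Phi, B Phi -> zeta Phi <= xi (absf Phi),
  (forall Phi, B Phi -> zeta (rt v Phi) = zeta Phi) /\
    invariant_under (lcs j) zeta,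
  zeta (b v) = t &
  (1 < j)%N -> forall c, lcs j c -> zeta (b c) = 0].

Let norming_abs j zeta Phi : norming j zeta -> B Phi ->
  `|zeta Phi| <= xi (absf Phi).
Proof.
move=> [lz zle _ _ _] b1; rewrite ler_norml lerNl -linear_onN // zle // andbT.
apply: le_trans (zle _ (invariant_domainN b1)) _.
rewrite (_ : absf (- Phi) = absf Phi) //.
by apply/funext => w; rewrite /absf fctE normrN.
Qed.

(** Averaging over [lcs j.+1] keeps the invariance under [v], because moving [v] past [k] costs a
    commutator in [lcs j.+2]. The vanishing of [zeta (b c)] there is what keeps the value at
    [b v]. *)
Lemma norming_step j zeta : norming j.+2 zeta -> exists zeta', norming j.+1 zeta'.
Proof.
move=> nz; have [lz zle [zv zi] zt zc] := nz.
have [zD zZ] := lz.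
have cK (a c : G) : lcs j.+1 a -> lcs j.+1 c -> lcs j.+2 [~ a, c]%g.
  by move=> La Lc; exact: lcsR1.
have bK Phi : B Phi -> exists C : R, forall k, lcs j.+1 k -> `|zeta (rt k Phi)| <= C.
  move=> b1; exists (xi (absf Phi)) => k _.
  by apply: le_trans (norming_abs nz (Brt _ b1)) _; rewrite positive_on_absrt.
have hK (h k : G) : lcs j.+2 h -> lcs j.+1 k -> lcs j.+2 (h ^ k)%g.
  by move=> Lh _; exact: lcsJ.
have [zeta' [lz' zi' zle']] :=
  average_invariant lz (lcs_subgroup _ _) hK cK zi bK.
have [zD' zZ'] := lz'.
(* Where the translates by [lcs j.+1] all have the same value, the average is forced. *)
have zcst Phi c : B Phi -> (forall k, lcs j.+1 k -> zeta (rt k Phi) = c) ->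
    zeta' Phi = c.
  move=> b1 hc; apply/eqP; rewrite eq_le zle' //=; last by move=> k /hc ->.
  rewrite -lerN2 -linear_onN //; apply: zle' => [|k Lk].
    exact: invariant_domainN.
  rewrite (_ : rt k (- Phi) = - rt k Phi) // linear_onN //; last exact: Brt.
  by rewrite hc.
have conjE (c k : G) : (k * c = (c ^ k^-1) * k)%g by rewrite -conjgCV.
have vk (k : G) : (k * v = v * ([~ v, k^-1] * k))%g.
  by rewrite /commg /conjg invgK !mulgA mulgV mul1g mulgVK.
have Lvk (k : G) : lcs j.+1 k -> lcs j.+2 [~ v, k^-1]%g.
  by move=> Lk; rewrite -invgR; apply/lcsV/lcsR1/lcsV.
(* Moving [k] past [c] replaces [c] by a conjugate, which stays in [lcs j.+2], where [zeta] is
   invariant and kills the cocycle. *)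
have chom1 c k : lcs j.+2 c -> lcs j.+1 k -> zeta (rt k (b c)) = 0.
  move=> Lc Lk; have := bM k c; rewrite conjE bM => E.
  have -> : rt k (b c) = b (c ^ k^-1)%g + rt (c ^ k^-1)%g (b k) - b k.
    by rewrite E addrC addKr.
  have Lc' : lcs j.+2 (c ^ k^-1)%g by exact: lcsJ.
  rewrite linear_onB //; last by apply: BD => //; exact: Brt.
  by rewrite zD //; last exact: Brt; rewrite zi // zc // add0r subrr.
exists zeta'; split=> //.
- move=> Phi b1; apply: zle' => // k _.
  by apply: le_trans (zle _ (Brt _ b1)) _; rewrite positive_on_absrt.
- split=> // Phi b1; apply/eqP; rewrite -subr_eq0 -linear_onB //; last exact: Brt.
  apply/eqP/zcst; first by apply: invariant_domainB => //; exact: Brt.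
  move=> k Lk; rewrite (_ : rt k (rt v Phi - Phi) = rt k (rt v Phi) - rt k Phi) //.
  have b2 := Brt k b1.
  rewrite linear_onB //; last by rewrite rtM; exact: Brt.
  rewrite rtM vk -(rtM v) -(rtM [~ v, k^-1]%g) zv; last by do 2 apply: Brt.
  by rewrite zi ?subrr //; exact: Lvk.
(* Comparing two expansions of [b (k * v)]: the terms in [b k] cancel and the commutator contributes
   zero. *)
- apply: zcst => // k Lk; have := bM k v; rewrite vk bM (bM [~ v, k^-1]%g) => E.
  have -> : rt k (b v) = b v + (rt v (b [~ v, k^-1]%g + rt [~ v, k^-1]%g (b k)) - b k).
    by rewrite addrA E addrC addKr.
  have b2 : B (rt [~ v, k^-1]%g (b k)) by exact: Brt.
  have b3 : B (b [~ v, k^-1]%g + rt [~ v, k^-1]%g (b k)) by exact: BD.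
  rewrite zD //; last by apply: invariant_domainB => //; exact: Brt.
  rewrite linear_onB //; last exact: Brt.
  rewrite zv // zD // zi //; last exact: Lvk.
  by rewrite zt (zc _ _ (Lvk k Lk)) //; ring.
(* For [j = 0] no vanishing is claimed; from here on the index is shifted by one and vanishing on
   [lcs j.+2] is shown. *)
case: j nz zi zc cK bK hK zi' zle' zcst Lvk chom1 => // j nz zi zc cK bK hK zi'
  zle' zcst Lvk chom1 _.
have chi_hom x y : lcs j.+2 x -> zeta' (b (x * y)%g) = zeta' (b x) + zeta' (b y).
  by move=> Lx; rewrite bM zD' //; [rewrite zi'|exact: Brt].
have chi0 c : lcs j.+3 c -> zeta' (b c) = 0.
  by move=> Lc; apply: zcst => // k Lk; exact: chom1.
have le_abs Phi : B Phi -> zeta' Phi <= xi (absf Phi).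
  move=> b1; apply: zle' => // k _.
  by apply: le_trans (zle _ (Brt _ b1)) _; rewrite positive_on_absrt.
have chiX x n : lcs j.+2 x -> zeta' (b (x ^+ n)%g) = n%:R * zeta' (b x).
  move=> Lx; elim: n => [|n ih]; first by rewrite expg0 cocycle1 mul0r linear_on0.
  by rewrite expgS chi_hom // ih mulrSr mulrDl mul1r addrC.
have chiV x : lcs j.+2 x -> zeta' (b x^-1%g) = - zeta' (b x).
  move=> Lx; apply/eqP; rewrite -addr_eq0 -chi_hom; last exact: lcsV.
  by rewrite mulVg cocycle1 linear_on0.
(* On [[~ u ^+ m, g ^+ m]] the homomorphism takes [m ^ 2] times its value on [[~ u, g]], while the
   length is at most linear in [m]. *)
have chiR_le u g : lcs j.+1 u -> zeta' (b [~ u, g]%g) <= 0.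
  move=> Lu; apply/ler_addgt0Pr => e e0; rewrite add0r.
  set C := len xi u + len xi g.
  have C0 : 0 <= C by apply: addr_ge0; exact: len_ge0.
  pose m := (Num.truncn (2 * C / e)).+1.
  have mR : 0 < m%:R :> R by rewrite ltr0n.
  have Lug : lcs j.+2 [~ u, g]%g by exact: lcsR1.
  have hm : zeta' (b [~ u ^+ m, g ^+ m]%g) = (m * m)%:R * zeta' (b [~ u, g]%g).
    have E := eqlcs_commX g m m Lu.
    rewrite -[([~ u ^+ m, g ^+ m])%g](mulVKg ([~ u, g] ^+ (m * m))%g) chi_hom.
      by rewrite (chi0 _ (eqlcs_sym E)) addr0 chiX.
    exact: (subgroupX _ (lcs_subgroup _ _) Lug).
  have : zeta' (b [~ u ^+ m, g ^+ m]%g) <= 2 * (m%:R * C).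
    apply: le_trans (le_abs _ (Bb _)) _.
    apply: le_trans (lenR pxi ixi _ _) _.
    by rewrite ler_pM2l // mulrDr lerD //; exact: lenX.
  rewrite hm natrM -mulrA [2 * _]mulrCA ler_pM2l // => h.
  rewrite -(ler_pM2l mR); apply: le_trans h _.
  rewrite -ler_pdivrMr //; exact/ltW/truncnS_gt.
move=> c Lc.
suff : lcs j.+2 `<=` [set x | lcs j.+2 x /\ zeta' (b x) = 0] by move=> /(_ c Lc)[].
apply: lcs_ind.
  split=> [|x y [Lx hx] [Ly hy]|x [Lx hx]].
  - by split; [exact: lcs1|rewrite cocycle1 linear_on0].
  - by split; [exact: lcsM|rewrite chi_hom // hx hy addr0].
  - by split; [exact: lcsV|rewrite chiV // hx oppr0].
move=> u g Lu; split; first exact: lcsR1.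
apply/eqP; rewrite eq_le chiR_le //=.
rewrite -oppr_le0 -chiV; last exact: lcsR1.
(* The inverse is a conjugate of a commutator of the same kind, so the one-sided bound applies to it
   as well. *)
have -> : ([~ u, g]^-1 = [~ u^-1, g] ^ u)%g.
  by rewrite /commg /conjg !invgM !invgK !mulgA ?(mulgK, mulgVK) // mulVg mul1g.
rewrite conjg_mulR chi_hom; last by apply/lcsR1/lcsV.
rewrite (chi0 [~ _, u]%g) ?addr0; last by apply/lcsR1/lcsR1/lcsV.
by apply: chiR_le; exact: lcsV.
Qed.

End Splitting.

Lemma invariant_norming xi v : positive_on xi -> invariant_under setT xi ->
  exists zeta : (Om -> R) -> R,
  [/\ linear_on zeta, forall Phi, B Phi -> zeta Phi <= xi (absf Phi),
      invariant_under setT zeta &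
      forall e, 0 < e -> exists2 A, (0 < A)%N &
        len xi (v ^+ A)%g <= (zeta (b v) + e) * A%:R].
Proof.
move=> pxi ixi; have [z [lz zle zv zA]] := norming_functional pxi ixi v.
have [j hj] := lcs_trivial nilG.
have : exists zeta, norming xi v (z (b v)) j.+1 zeta.
  exists z; split=> //.
    by split=> // k Phi /hj -> _; rewrite rt1.
  by move=> _ c /hj ->; rewrite cocycle1 linear_on0.
elim: j {hj} => [|j ih] [zeta nz].
  have [lz' zle' [_ zi'] zt _] := nz; exists zeta; split=> //.
  by rewrite zt.
by apply: ih; exact: norming_step nz.
Qed.

(** As [A |xi (b v)| <= len xi (v ^+ A)] always holds, this says that the stable length of [v]
    equals [|xi (b v)|]. *)
Definition linear_speed xi v := forall e, 0 < e -> exists2 A, (0 < A)%N &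
  len xi (v ^+ A)%g <= (`|xi (b v)| + e) * A%:R.

Definition mean_on xi := positive_on xi /\ invariant_under setT xi.

(** The excess of the length of [v ^+ A] over [A |xi (b v)|] is nonnegative on either part, and the
    excess on the sum dominates that on each part. *)
Lemma linear_speed_sub xi xi1 xi2 v : mean_on xi1 -> mean_on xi2 ->
  (forall Phi, B Phi -> xi Phi = xi1 Phi + xi2 Phi) ->
  linear_speed xi v -> linear_speed xi1 v.
Proof.
move=> [p1 i1] [p2 i2] E h e e0; have [A A0 hA] := h e e0; exists A => //.
have AR : 0 < A%:R :> R by rewrite ltr0n.
move: hA; rewrite /len E; last exact: Babs.
have h1 := positive_on_abs p1 (Bb (v ^+ A)%g).
have h2 := positive_on_abs p2 (Bb (v ^+ A)%g).
rewrite E //; move: h1 h2; rewrite !cocycle_homX // !normrM !normr_nat.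
move: (xi1 (absf _)) (xi2 (absf _)) (xi1 (b v)) (xi2 (b v)) => a c x y h1 h2 h3.
have : `|x + y| * A%:R <= A%:R * `|x| + A%:R * `|y|.
  by rewrite -mulrDr mulrC ler_pM2l //; exact: ler_normD.
by rewrite mulrDl in h3; rewrite mulrDl; lra.
Qed.

(** The parts are [(xi + z) / 2] and [(xi - z) / 2] for the norming functional [z], positive because
    [z <= xi |.|]. On average [b (v ^+ A)] is almost positive for the first and almost negative for
    the second, so in both its length is close to the modulus of its mean. *)
Lemma mean_split xi v : mean_on xi -> exists xi1 xi2,
  [/\ mean_on xi1, mean_on xi2,
      forall Phi, B Phi -> xi Phi = xi1 Phi + xi2 Phi,
      linear_speed xi1 v & linear_speed xi2 v].
Proof.
move=> [pxi ixi]; have [z [lz zle zi zA]] := invariant_norming v pxi ixi.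
have [zD zZ] := lz; have [lxi xpos] := pxi; have [xD xZ] := lxi.
pose p1 Phi := (xi Phi + z Phi) / 2; pose p2 Phi := (xi Phi - z Phi) / 2.
have E Phi : B Phi -> xi Phi = p1 Phi + p2 Phi by move=> _; rewrite /p1 /p2; field.
have absE Phi : B Phi -> (forall w, 0 <= Phi w) -> absf Phi = Phi.
  by move=> _ h; apply/funext => w; rewrite /absf ger0_norm.
have absNE Phi : absf (- Phi) = absf Phi.
  by apply/funext => w; rewrite /absf fctE normrN.
have m1 : mean_on p1.
  split; last by move=> k Phi Kk b1; rewrite /p1 ixi // zi.
  split; first split=> [Phi Psi b1 b2|a Phi b1].
  - by rewrite /p1 xD // zD //; field.
  - by rewrite /p1 xZ // zZ //; field.
  move=> Phi b1 h; have := zle _ (invariant_domainN b1).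
  by rewrite absNE absE // linear_onN // /p1 => h2; lra.
have m2 : mean_on p2.
  split; last by move=> k Phi Kk b1; rewrite /p2 ixi // zi.
  split; first split=> [Phi Psi b1 b2|a Phi b1].
  - by rewrite /p2 xD // zD //; field.
  - by rewrite /p2 xZ // zZ //; field.
  by move=> Phi b1 h; have := zle _ b1; rewrite absE // /p2 => h2; lra.
exists p1, p2; split=> //.
- move=> e e0; have [A A0 hA] := zA e e0; exists A => //.
  have AR : 0 < A%:R :> R by rewrite ltr0n.
  have [q2 i2] := m2; have := positive_on_abs q2 (Bb (v ^+ A)%g).
  rewrite cocycle_homX // => /(le_trans (_ : _ <= `|_|)).
  move: hA; rewrite /len E; last exact: Babs.
  move=> hA /(_ (- (A%:R * p2 (b v)))); rewrite -normrN ler_norm => /(_ isT) h2.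
  apply: le_trans (_ : _ <= (p1 (b v) + e) * A%:R) _; last first.
    by rewrite ler_pM2r // lerD2r ler_norm.
  have : z (b v) = p1 (b v) - p2 (b v) by rewrite /p1 /p2; field.
  by move=> hz; rewrite hz in hA; lra.
- move=> e e0; have [A A0 hA] := zA e e0; exists A => //.
  have AR : 0 < A%:R :> R by rewrite ltr0n.
  have [q1 i1] := m1; have := positive_on_abs q1 (Bb (v ^+ A)%g).
  rewrite cocycle_homX // => /(le_trans (_ : A%:R * p1 (b v) <= `|_|)).
  move: hA; rewrite /len E; last exact: Babs.
  move=> hA; rewrite ler_norm => /(_ isT) h2.
  apply: le_trans (_ : _ <= (- p2 (b v) + e) * A%:R) _; last first.
    by rewrite ler_pM2r // lerD2r -normrN ler_norm.
  have : z (b v) = p1 (b v) - p2 (b v) by rewrite /p1 /p2; field.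
  by move=> hz; rewrite hz in hA; lra.
Qed.

(** Each element doubles the number of cells, and linear speed of the earlier ones is inherited by
    [linear_speed_sub]. *)
Lemma mean_cells xi (s : seq G) : mean_on xi ->
  exists (n : nat) (p : nat -> (Om -> R) -> R),
  [/\ forall i, (i < n)%N -> mean_on (p i),
      forall Phi, B Phi -> xi Phi = \sum_(i < n) p i Phi &
      forall i v, (i < n)%N -> v \in s -> linear_speed (p i) v].
Proof.
move=> mxi; elim: s => [|v s [n [p [h1 h2 h3]]]].
  exists 1%N, (fun=> xi); split=> // Phi _; by rewrite big_ord1.
have /choice[f hf] : forall i, exists q : ((Om -> R) -> R) * ((Om -> R) -> R),
    (i < n)%N -> [/\ mean_on q.1, mean_on q.2,
      forall Phi, B Phi -> p i Phi = q.1 Phi + q.2 Phi,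
      linear_speed q.1 v & linear_speed q.2 v].
  move=> i; case: (boolP (i < n)%N) => [iN|/negP iN]; last by exists (xi, xi).
  by have [x1 [x2 H]] := mean_split v (h1 _ iN); exists (x1, x2).
exists (n + n)%N, (fun i => if (i < n)%N then (f i).1 else (f (i - n)%N).2).
have sub i : (i < n + n)%N -> ~~ (i < n)%N -> (i - n < n)%N.
  by rewrite -leqNgt => h1' h2'; rewrite ltn_subLR.
split=> [i iN|Phi b1|i u iN].
- case: ifPn => hi; first by have [] := hf _ hi.
  by have [] := hf _ (sub _ iN hi).
- rewrite h2 // big_split_ord /= -big_split /=; apply: eq_bigr => i _.
  by rewrite ltn_ord ltnNge leq_addr /= addKn; have [_ _ -> //] := hf _ (ltn_ord i).
rewrite inE => /orP[/eqP ->|us]; case: ifPn => hi.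
- by have [] := hf _ hi.
- by have [] := hf _ (sub _ iN hi).
- have [m1 m2 E _ _] := hf _ hi.
  exact: linear_speed_sub m1 m2 E (h3 _ _ hi us).
- have [m1 m2 E _ _] := hf _ (sub _ iN hi).
  apply: linear_speed_sub m2 m1 _ (h3 _ _ (sub _ iN hi) us) => Phi b1.
  by rewrite E // addrC.
Qed.

Lemma polyseqs_brk (w : nat -> G) (ws : seq (nat -> G)) :
  polyseqs 1 w -> (forall q, List.In q ws -> polyseqs 1 q) ->
  polyseqs 1 (fun k => brk (w k) [seq q k | q <- ws]).
Proof.
elim: ws w => [|q ws ih] w hw hws //=; apply: ih => [|r hr].
  apply: (@polyseqs_sub _ 2) => //; apply: (@polyseqsR _ 1 1) => //.
  by apply: hws; left.
by apply: hws; right.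
Qed.

Lemma polyseqs_expn j l (x : G) : (l <= j)%N -> lcs j x ->
  polyseqs j (fun k => x ^+ (k ^ l))%g.
Proof.
move=> lj Lx; have [c hc] := exp_bin_sum l.
have : forall m, (m <= l.+1)%N ->
    polyseqs j (fun k => x ^+ (\sum_(i < m) c i * 'C(k, i)))%g.
  elim=> [|m ih] ml.
    rewrite (_ : (fun _ => _) = fun=> 1%g); first exact/polyseqs_cst/lcs1.
    by apply/funext => k; rewrite big_ord0.
  rewrite (_ : (fun _ => _) = fun k => (x ^+ (\sum_(i < m) c i * 'C(k, i)) *
      (x ^+ c m) ^+ 'C(k, m))%g).
    apply: polyseqsM; first exact/ih/ltnW.
    apply: polyseqs_bin; first exact: leq_trans lj.
    exact: (subgroupX _ (lcs_subgroup _ _) Lx).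
  by apply/funext => k; rewrite big_ord_recr /= expgnDr expgnA.
move=> /(_ l.+1 (leqnn _)); rewrite (_ : (fun _ => _) = fun k => x ^+ (k ^ l))%g //.
by apply/funext => k; rewrite hc.
Qed.

(** Division of [M |al|] by [|be|]. The bound [c <= M] leaves finitely many candidates, so they can
    be listed before the functional is split; the two alternatives account for the signs. *)
Lemma round_multiple (al be : R) (M : nat) : `|al| <= `|be| ->
  exists2 c, (c <= M)%N & `|M%:R * al + c%:R * be| <= `|be| \/
    `|M%:R * al - c%:R * be| <= `|be|.
Proof.
move=> h; have [be0|be0] := eqVneq be 0.
  exists 0%N => //; left; move: h; rewrite be0 normr0 normr_le0 => /eqP ->.
  by rewrite !mulr0 addr0 normr0.
have nb : 0 < `|be| by rewrite normr_gt0.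
pose r := M%:R * (`|al| / `|be|); pose c := Num.truncn r.
have r0 : 0 <= r by rewrite mulr_ge0 // divr_ge0.
have /andP[c1 c2] := truncn_itv r0.
have rM : r <= M%:R by rewrite ler_piMr // ler_pdivrMr // mul1r.
have Er : r * `|be| = M%:R * `|al| by rewrite /r -mulrA mulfVK // gt_eqF.
have key : `|M%:R * `|al| - c%:R * `|be| | <= `|be|.
  rewrite -Er -mulrBl normrM normr_id ler_piMl // ler_norml.
  rewrite -/c in c1 c2; rewrite -addn1 natrD in c2; apply/andP; split; lra.
exists c; first by rewrite -(ler_nat R) (le_trans c1).
have [a0|a0] := leP 0 al; have [b0|b0] := leP 0 be.
- by right; move: key; rewrite (ger0_norm a0) (ger0_norm b0).
- left; move: key; rewrite (ger0_norm a0) (ltr0_norm b0).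
  by rewrite mulrN opprK.
- left; move: key; rewrite (ltr0_norm a0) (ger0_norm b0) mulrN -opprD normrN.
  by [].
- right; move: key; rewrite (ltr0_norm a0) (ltr0_norm b0) !mulrN opprK.
  by rewrite -normrN opprD !opprK.
Qed.

(** * Sequences of sublinear length *)

Section Negligible.
Variable xi : (Om -> R) -> R.
Hypothesis mxi : mean_on xi.

Let pxi : positive_on xi. Proof. by case: mxi. Qed.
Let ixi : invariant_under setT xi. Proof. by case: mxi. Qed.

(** Divisibility replaces largeness of [k] because speeds are known only along the multiples of one
    exponent; it is also compatible with products and dilations. *)
Definition negligible : set (nat -> G) := [set q | forall e, 0 < e ->
  exists2 A, (0 < A)%N & forall k, (0 < k)%N -> (A %| k)%N ->
    len xi (q k) <= e * k%:R].

Lemma negligible1 : negligible (fun=> 1%g).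
Proof. by move=> e e0; exists 1%N => // k _ _; rewrite len1 // mulr_ge0 // ltW. Qed.

Lemma negligibleM q r : negligible q -> negligible r ->
  negligible (fun k => q k * r k)%g.
Proof.
move=> hq hr e e0; have e2 : 0 < e / 2 by rewrite divr_gt0.
have [A A0 hA] := hq _ e2; have [A' A0' hA'] := hr _ e2.
exists (A * A')%N => [|k k0 kA]; first by rewrite muln_gt0 A0.
apply: le_trans (lenM pxi ixi _ _) _.
rewrite [e]splitr mulrDl lerD //; [apply: hA|apply: hA'] => //.
  by apply: dvdn_trans kA; exact: dvdn_mulr.
by apply: dvdn_trans kA; exact: dvdn_mull.
Qed.

Lemma negligibleV q : negligible q -> negligible (fun k => (q k)^-1)%g.
Proof.
by move=> hq e e0; have [A A0 hA] := hq e e0; exists A => // k k0 kA; rewrite lenV ?hA.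
Qed.

Lemma negligible_dilation q n : (0 < n)%N ->
  negligible (fun k => q (n * k)%N) -> negligible q.
Proof.
move=> n0 hq e e0; have [A A0 hA] := hq e e0.
exists (n * A)%N => [|k k0]; first by rewrite muln_gt0 n0.
move=> /dvdnP[m km]; have E : k = (n * (m * A))%N by rewrite km mulnCA.
rewrite E; apply: le_trans (hA _ _ _) _; last 1 first.
- by rewrite ler_pM2l // ler_nat leq_pmull.
- by move: k0; rewrite E !muln_gt0 n0.
- exact: dvdn_mull.
Qed.

(** The constant [c] does not depend on [a], so with respect to the index [a * k] the slope is
    [c / a], as small as desired. *)
Lemma negligible_scale q (c : R) : 0 <= c -> (forall a, (0 < a)%N ->
    exists2 A, (0 < A)%N & forall k, (0 < k)%N -> (A %| k)%N ->
      len xi (q (a * k)%N) <= c * k%:R) -> negligible q.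
Proof.
move=> c0 h e e0; pose a := (Num.truncn (c / e)).+1.
have [A A0 hA] := h a isT; exists (a * A)%N => [|k k0].
  by rewrite muln_gt0.
move=> /dvdnP[m km]; have E : k = (a * (m * A))%N by rewrite km mulnCA.
rewrite E; apply: le_trans (hA _ _ _) _.
- by move: k0; rewrite E !muln_gt0.
- exact: dvdn_mull.
- rewrite (natrM _ a) mulrA ler_wpM2r // mulrC -ler_pdivrMr //.
  exact/ltW/truncnS_gt.
Qed.

Lemma lenX_dvd (p : (Om -> R) -> R) (v : G) (c : R) A k : mean_on p ->
  (0 < A)%N -> len p (v ^+ A)%g <= c * A%:R -> (A %| k)%N ->
  len p (v ^+ k)%g <= c * k%:R.
Proof.
move=> [pp ip] A0 h /dvdnP[m ->]; rewrite mulnC expgnA natrM mulrA.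
apply: le_trans (lenX pp ip _ _) _.
by rewrite [leRHS]mulrC ler_wpM2l.
Qed.

(** A bracket of [j.+1] letters needs at most [j] of them to carry [k]; a further letter takes the
    constant factor produced by the dilation, whose cost is absorbed once [k] is divisible by it. *)
Lemma negligible_low_power j x (vs : seq G) l : size vs = j -> (l <= j)%N ->
  polyseqs j.+2 `<=` negligible ->
  negligible (fun k => brk x vs ^+ (k ^ l))%g.
Proof.
move=> sz lj hN; set z := brk x vs.
have Lz : lcs j.+1 z by rewrite -sz -add1n; exact: lcs_brk.
case: l lj => [_|l lj].
  move=> e e0; exists (Num.truncn (len xi z / e)).+1 => // k k0 kA.
  rewrite expn0 expg1 mulrC -ler_pdivrMr //.
  apply: le_trans (ltW (truncnS_gt _)) _.
  by rewrite ler_nat; exact: dvdn_leq.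
have [vs1 [v [vs2 [Evs sz1]]]] : exists vs1 v vs2,
    vs = vs1 ++ v :: vs2 /\ size vs1 = l.
  exists (take l vs), (nth 1%g vs l), (drop l.+1 vs); split.
    by rewrite -drop_nth ?cat_take_drop // sz.
  by rewrite size_take sz lj.
pose c := 2 ^+ j * (len xi x + \sum_(u <- vs) len xi u).
have sum0 (s : seq G) : 0 <= \sum_(u <- s) len xi u.
  by apply: sumr_ge0 => *; exact: len_ge0.
have c0 : 0 <= c by rewrite mulr_ge0 ?exprn_ge0 // addr_ge0 // len_ge0.
apply: (@negligible_scale _ (c + 1)) => [|a a0]; first by rewrite addr_ge0.
(* The first letter [x] and the [l] letters of [vs1] carry [k], the letter [v] carries [a ^ l.+1],
   and the others carry exponent 1. *)
pose s k := [seq (u, k) | u <- vs1] ++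
  (v, a ^ l.+1)%N :: [seq (u, 1)%N | u <- vs2].
pose h k := brk (x ^+ k)%g [seq p.1 ^+ p.2 | p <- s k]%g.
have hh k : eqlcs j.+2 (h k) (z ^+ ((a * k) ^ l.+1))%g.
  have := @eqlcs_brkX _ 1 x k (s k) I.
  have -> : (2 + size (s k) = j.+2)%N.
    by rewrite /s -sz Evs !size_cat /= !size_map.
  have -> : unzip1 (s k) = vs.
    rewrite /s Evs /unzip1 map_cat /= -!map_comp.
    by congr (_ ++ _ :: _); rewrite -[RHS]map_id; apply: eq_map.
  rewrite /s big_cat big_cons !big_map /= big1_eq muln1.
  rewrite big_const_seq count_predT iter_muln_1 sz1.
  by rewrite mulnA -expnS expnMn mulnC.
pose ws : seq (nat -> G) := [seq (fun k => u ^+ k)%g | u <- vs1] ++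
  (fun=> v ^+ (a ^ l.+1))%g :: [seq (fun=> u ^+ 1)%g | u <- vs2].
have hE : h = fun k => brk (x ^+ k)%g [seq q k | q <- ws].
  apply/funext => k; rewrite /h /s /ws; congr brk.
  by rewrite !map_cat /= -!map_comp.
have exp1 (u : G) : polyseqs 1 (fun k => u ^+ k)%g.
  by have := polyseqs_exp u 1; under eq_fun do rewrite mul1n.
have ph : polyseqs 1 h.
  rewrite hE; apply: polyseqs_brk => // q; rewrite /ws => /List.in_app_iff[].
    by move=> /List.in_map_iff[u [<- _]].
  move=> [<-|/List.in_map_iff[u [<- _]]]; exact: polyseqs_cst.
pose q k := ((h k)^-1 * z ^+ ((a * k) ^ l.+1))%g.
have Nq : negligible q.
  apply: hN; apply: (@polyseqs_sub _ 1); first exact: hh.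
  apply: polyseqsM; first exact: polyseqsV.
  rewrite (_ : (fun _ => _) = fun k => (z ^+ (a ^ l.+1)) ^+ (k ^ l.+1))%g.
    apply: (@polyseqs_sub _ j.+1) => //; apply: polyseqs_expn; first exact: ltnW.
    exact: (subgroupX _ (lcs_subgroup _ _) Lz).
  by apply/funext => k; rewrite expnMn expgnA.
have [A A0 hA] := Nq 1 ltr01; exists (A * a ^ l.+1)%N => [|k k0 kA].
  by rewrite muln_gt0 A0 expn_gt0 a0.
have ka : (a ^ l.+1 <= k)%N.
  by apply: dvdn_leq => //; apply: dvdn_trans kA; exact: dvdn_mull.
have -> : (z ^+ ((a * k) ^ l.+1) = h k * q k)%g by rewrite /q mulVKg.
apply: le_trans (lenM pxi ixi _ _) _; rewrite mulrDl; apply: lerD; last first.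
  by apply: hA => //; apply: dvdn_trans kA; exact: dvdn_mulr.
apply: le_trans (len_brk pxi ixi _ _) _.
have -> : size [seq p.1 ^+ p.2 | p <- s k]%g = j.
  by rewrite size_map /s -sz Evs !size_cat /= !size_map.
rewrite /c -mulrA ler_wpM2l ?exprn_ge0 // mulrDl lerD //.
  by rewrite mulrC; exact: lenX.
rewrite /s Evs map_cat !big_cat /= !big_cons -!map_comp !big_map !mulrDl /=.
apply: lerD; last apply: lerD.
- by rewrite mulr_suml; apply: ler_sum => u _; rewrite mulrC; exact: lenX.
- apply: le_trans (lenX pxi ixi _ _) _.
  by rewrite mulrC ler_wpM2l ?len_ge0 // ler_nat.
- rewrite mulr_suml; apply: ler_sum => u _; rewrite expg1.
  by rewrite ler_peMr ?len_ge0 // ler1n.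
Qed.

(** Here all [j.+2] letters carry [k], so the factor [M = a ^ j.+2] has no letter left. It is
    absorbed in the first two letters: replacing [x ^+ M] by [x ^+ M] times a power of [y] keeps the
    innermost commutator modulo [lcs 3] and can be chosen of small speed. *)
Lemma negligible_top_power j x (vs : seq G) : size vs = j.+1 ->
  polyseqs j.+3 `<=` negligible ->
  negligible (fun k => brk x vs ^+ (k ^ j.+2))%g.
Proof.
case: vs => // y ws [sz] hN; set z := brk x (y :: ws).
have Lz : lcs j.+2 z by rewrite /z -sz -addn2 addnC; apply: (@lcs_brk _ 1 x (y :: ws)).
pose S0 (p : (Om -> R) -> R) := \sum_(u <- ws) len p u.
pose c := 2 ^+ j.+1 * (2 * (len xi x + len xi y + 1) + S0 xi).
have sum0 (s : seq G) : 0 <= \sum_(u <- s) len xi u.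
  by apply: sumr_ge0 => *; exact: len_ge0.
have c0 : 0 <= c.
  have lx := len_ge0 pxi x; have ly := len_ge0 pxi y.
  by apply: mulr_ge0; [exact: exprn_ge0|apply: addr_ge0; [lra|exact: sum0]].
apply: (@negligible_scale _ (c + 1)) => [|a a0]; first by rewrite addr_ge0.
pose M := (a ^ j.+2)%N.
(* The choice between these elements depends on the cell, while the cells have to make all of them
   of linear speed; hence a finite list fixed beforehand. *)
pose cand := [seq x ^+ M * y ^+ e | e <- iota 0 M.+1]%g ++
  [seq x ^+ M * (y ^+ e)^-1 | e <- iota 0 M.+1]%g ++
  [seq y ^+ M * x ^+ e | e <- iota 0 M.+1]%g ++
  [seq y ^+ M * (x ^+ e)^-1 | e <- iota 0 M.+1]%g.
have [n [p [pm psum pspeed]]] := mean_cells cand mxi.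
(* There are [n] cells, and their errors [eta] must add up to at most 1. *)
pose eta : R := n.+1%:R^-1.
have eta0 : 0 < eta by rewrite invr_gt0.
have lensum u : len xi u = \sum_(i < n) len (p i) u by rewrite /len psum //; exact: Babs.
have len_le i u : (i < n)%N -> len (p i) u <= len xi u.
  move=> iN; rewrite lensum (bigD1 (Ordinal iN)) //= lerDl sumr_ge0 // => i' _.
  by apply: len_ge0; have [] := pm _ (ltn_ord i').
(* On each cell the bracket of the [k]-th powers of [x ^+ M] and [y] may be computed with a letter of small speed. *)
have cell i : (i < n)%N -> exists V U, eqlcs 3 [~ V, U]%g ([~ x, y] ^+ M)%g /\
    forall W, W \in [:: V; U] -> exists2 A, (0 < A)%N &
      forall k, (A %| k)%N ->
        len (p i) (W ^+ k)%g <= (len (p i) x + len (p i) y + eta) * k%:R.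
  move=> iN; have mp := pm _ iN; have [pp ip] := mp.
  have lx := len_ge0 pp x; have ly := len_ge0 pp y.
  have letter W : len (p i) W <= len (p i) x + len (p i) y ->
      exists2 A, (0 < A)%N & forall k, (A %| k)%N ->
        len (p i) (W ^+ k)%g <= (len (p i) x + len (p i) y + eta) * k%:R.
    move=> hW; exists 1%N => // k _; apply: le_trans (lenX pp ip _ _) _.
    by rewrite mulrC ler_wpM2r //; apply: le_trans hW _; rewrite lerDl ltW.
  have fast W : W \in cand -> `|p i (b W)| <= len (p i) x + len (p i) y ->
      exists2 A, (0 < A)%N & forall k, (A %| k)%N ->
        len (p i) (W ^+ k)%g <= (len (p i) x + len (p i) y + eta) * k%:R.
    move=> Wc hW; have [A A0 hA] := pspeed _ _ iN Wc eta eta0.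
    exists A => // k; apply: lenX_dvd => //; apply: le_trans hA _.
    by rewrite ler_wpM2r // lerD2r.
  have homV u : p i (b u^-1%g) = - p i (b u).
    have [lp _] := pp; apply/eqP; rewrite -addr_eq0 -cocycle_hom //.
    by rewrite mulVg cocycle1 linear_on0.
  have hle u : `|p i (b u)| <= len (p i) u by exact: cocycle_hom_le.
  have cX (u w : G) (e : nat) : commute u w -> commute (u ^+ e)%g w.
    by move=> cu; apply/commute_sym/commuteX/commute_sym.
  (* [w] is a power of [y], hence invisible to the commutator with [y]. *)
  have eqV w : commute w y -> eqlcs 3 [~ x ^+ M * w, y]%g ([~ x, y] ^+ M)%g.
    move=> cw; rewrite commMg (_ : [~ w, y]%g = 1%g) ?mulg1; last exact/eqP/commgP.
    rewrite conjg_mulR; apply: eqlcs_trans (@eqlcs_commXg _ 1 x y M I).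
    by apply: eqlcs_sym; apply: eqlcs_mulr; apply: lcsR1; apply: (@lcsR1 _ 1).
  have eqU w : commute w x -> eqlcs 3 [~ x, y ^+ M * w]%g ([~ x, y] ^+ M)%g.
    move=> cw; rewrite commgM (_ : [~ x, w]%g = 1%g) ?mul1g; last first.
      exact/eqP/commgP/commute_sym.
    rewrite conjg_mulR; apply: eqlcs_trans (@eqlcs_commgX _ 1 x y M I).
    by apply: eqlcs_sym; apply: eqlcs_mulr; apply: lcsR1; apply: (@lcsR1 _ 1).
  have mc (f : nat -> G) e : (e <= M)%N -> f e \in [seq f e | e <- iota 0 M.+1].
    by move=> eM; apply: map_f; rewrite mem_iota.
  have [h|/ltW h] := leP `|p i (b x)| `|p i (b y)|.
    have [e eM he] := round_multiple M h.
    have [w [cw Vc hV]] : exists w, [/\ commute w y, (x ^+ M * w)%g \in cand &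
        `|p i (b (x ^+ M * w)%g)| <= `|p i (b y)|].
      case: he => he; [exists (y ^+ e)%g|exists (y ^+ e)^-1%g]; split.
      - exact/cX.
      - by rewrite mem_cat (mc (fun e => x ^+ M * y ^+ e)%g).
      - by rewrite cocycle_hom // !cocycle_homX.
      - exact/commute_sym/commuteV/commute_sym/cX.
      - by rewrite !mem_cat (mc (fun e => x ^+ M * (y ^+ e)^-1)%g) // orbT.
      - by rewrite cocycle_hom // homV !cocycle_homX.
    exists (x ^+ M * w)%g, y; split; first exact: eqV.
    move=> W; rewrite !inE => /orP[/eqP ->|/eqP ->]; last by apply: letter; lra.
    by apply: fast => //; apply: le_trans hV _; have := hle y; lra.
  have [e eM he] := round_multiple M h.
  have [w [cw Vc hV]] : exists w, [/\ commute w x, (y ^+ M * w)%g \in cand &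
      `|p i (b (y ^+ M * w)%g)| <= `|p i (b x)|].
    case: he => he; [exists (x ^+ e)%g|exists (x ^+ e)^-1%g]; split.
    - exact/cX.
    - by rewrite !mem_cat (mc (fun e => y ^+ M * x ^+ e)%g) // !orbT.
    - by rewrite cocycle_hom // !cocycle_homX.
    - exact/commute_sym/commuteV/commute_sym/cX.
    - by rewrite !mem_cat (mc (fun e => y ^+ M * (x ^+ e)^-1)%g) // !orbT.
    - by rewrite cocycle_hom // homV !cocycle_homX.
  exists x, (y ^+ M * w)%g; split; first exact: eqU.
  move=> W; rewrite !inE => /orP[/eqP ->|/eqP ->]; first by apply: letter; lra.
  by apply: fast => //; apply: le_trans hV _; have := hle x; lra.
pose zz k := (z ^+ ((a * k) ^ j.+2))%g.
have exp1 (u : G) : polyseqs 1 (fun k => u ^+ k)%g.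
  by have := polyseqs_exp u 1; under eq_fun do rewrite mul1n.
(* Stated for every [i] so that [choice] applies; beyond [n] the value is arbitrary. *)
have bound i : exists A, (i < n)%N -> (0 < A)%N /\
    forall k, (0 < k)%N -> (A %| k)%N -> len (p i) (zz k) <=
      (2 ^+ j.+1 * (2 * (len (p i) x + len (p i) y + eta) + S0 (p i)) + eta) * k%:R.
  case: (boolP (i < n)%N) => [iN|_]; last by exists 0%N.
  have mp := pm _ iN; have [pp ip] := mp.
  have [V [U [eVU hW]]] := cell i iN.
  have [AV AV0 hV] := hW V (mem_head _ _).
  have [AU AU0 hU] := hW U (mem_last V [:: U]).
  have uz (m : nat) : unzip1 [seq (u, m) | u <- ws] = ws.
    by rewrite /unzip1 -map_comp map_id.
  pose E k := brk (V ^+ k)%g [seq q.1 ^+ q.2 | q <- (U, k) :: [seq (u, k) | u <- ws]]%g.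
  have hE k : eqlcs j.+3 (E k) (zz k).
    have := @eqlcs_brkX _ 1 V k ((U, k) :: [seq (u, k) | u <- ws]) I.
    rewrite /= !size_map sz -/(E k); move=> /eqlcs_trans; apply.
    rewrite big_cons big_map big_const_seq count_predT iter_muln_1 sz /=.
    rewrite uz; have -> : (k * (k * k ^ j) = k ^ j.+2)%N by rewrite !expnS.
    rewrite /zz expnMn (expgnA z); apply: eqlcsX.
    have h1 : eqlcs (3 + size ws) (brk [~ V, U]%g ws) (brk ([~ x, y] ^+ M)%g ws).
      by apply: eqlcs_brk => //; exact: (@lcsR1 _ 1).
    have h2 := @eqlcs_brkX _ 2 [~ x, y]%g M [seq (u, 1%N) | u <- ws] (@lcsR1 _ 1 x y I).
    rewrite sz in h1; apply: eqlcs_trans h1 _.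
    move: h2; rewrite size_map sz /unzip1 -!map_comp big_map big1_eq muln1.
    by rewrite (eq_map (g := id)) ?map_id // (eq_map (g := id)) ?map_id.
  have pE : polyseqs 1 E.
    rewrite (_ : E = fun k => brk (V ^+ k)%g [seq q k | q <- (fun k => U ^+ k)%g ::
        [seq (fun k => u ^+ k)%g | u <- ws]]); last first.
      by apply/funext => k; rewrite /E /= -!map_comp.
    apply: polyseqs_brk => // q [<- //|/List.in_map_iff[u [<- _]]].
    exact: exp1.
  pose q k := ((E k)^-1 * zz k)%g.
  have Nq : negligible q.
    apply: hN; apply: (@polyseqs_sub _ 1); first exact: hE.
    apply: polyseqsM; first exact: polyseqsV.
    rewrite (_ : zz = fun k => (z ^+ (a ^ j.+2)) ^+ (k ^ j.+2))%g.
      apply: (@polyseqs_sub _ j.+2) => //; apply: polyseqs_expn => //.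
      exact: (subgroupX _ (lcs_subgroup _ _) Lz).
    by apply/funext => k; rewrite /zz expnMn (expgnA z).
  have [A A0 hA] := Nq eta eta0.
  exists (A * (AV * AU))%N => _; split=> [|k k0 kA].
    by rewrite !muln_gt0 A0 AV0.
  have -> : zz k = (E k * q k)%g by rewrite /q mulVKg.
  apply: le_trans (lenM pp ip _ _) _; rewrite mulrDl; apply: lerD; last first.
    apply: le_trans (len_le _ _ iN) _; apply: hA => //.
    by apply: dvdn_trans kA; exact: dvdn_mulr.
  apply: le_trans (len_brk pp ip _ _) _.
  rewrite /= !size_map sz -mulrA ler_wpM2l ?exprn_ge0 // big_cons addrA mulrDl.
  apply: lerD.
    rewrite -mulrA mulr_natl mulr2n; apply: lerD; [apply: hV|apply: hU].
      by apply: dvdn_trans kA; apply: dvdn_mull; exact: dvdn_mulr.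
    by apply: dvdn_trans kA; apply: dvdn_mull; exact: dvdn_mull.
  rewrite -map_comp big_map mulr_suml; apply: ler_sum => u _ /=.
  by rewrite mulrC; exact: lenX.
have /choice[f hf] := bound.
exists (\prod_(i < n) f i)%N => [|k k0 kA].
  rewrite prodn_gt0 // => i; by have [] := hf i (ltn_ord i).
rewrite -/(zz k) lensum.
apply: (@le_trans _ _ (\sum_(i < n) (2 ^+ j.+1 *
    (2 * (len (p i) x + len (p i) y + eta) + S0 (p i)) + eta) * k%:R)).
  apply: ler_sum => i _; have [_ h] := hf i (ltn_ord i); apply: h => //.
  by apply: dvdn_trans kA; rewrite (bigD1 i) //=; exact: dvdn_mulr.
rewrite -mulr_suml ler_wpM2r // big_split /=.
have sum_eta : \sum_(i < n) eta <= 1.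
  by rewrite sumr_const card_ord -mulr_natl ler_pdivrMr // mul1r ler_nat.
rewrite lerD // -mulr_sumr ler_wpM2l ?exprn_ge0 // big_split /= lerD //; last first.
  by rewrite /S0 exchange_big /=; apply: ler_sum => u _; rewrite -lensum.
by rewrite -mulr_sumr ler_wpM2l // !big_split /= -!lensum lerD2l.
Qed.

(** Descending induction along the lower central series, started where all values are trivial; the
    reduction is applied one index higher, so brackets have at least two letters. *)
Lemma polyseqs_negligible j : polyseqs j.+2 `<=` negligible.
Proof.
have [s hs] := lcs_trivial nilG.
suff h d : forall j, (s <= j + d)%N -> polyseqs j.+2 `<=` negligible.
  exact: (h s j (leq_addl _ _)).
elim: d => [|d ih] {}j sj.
  move=> q [_ hv] e e0; exists 1%N => // k _ _.
  rewrite (hs (q k)) ?len1 ?mulr_ge0 // ?ltW //.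
  by apply: (lcs_le _ (hv k)); rewrite addn0 in sj; exact: leqW.
have hN : polyseqs j.+3 `<=` negligible by apply: ih; rewrite addSnnS.
apply: polyseqs_reduction => //.
- exact: negligible1.
- exact: negligibleM.
- exact: negligibleV.
- exact: negligible_dilation.
move=> x vs l sz; rewrite leq_eqVlt => /orP[/eqP ->|lj].
  exact: negligible_top_power.
by apply: (@negligible_low_power j.+1).
Qed.

Lemma commutator_sublinear x y e : 0 < e -> exists2 A, (0 < A)%N &
  forall k, (0 < k)%N -> (A %| k)%N ->
    len xi [~ x ^+ k, y ^+ k]%g <= e * k%:R.
Proof.
apply: (@polyseqs_negligible 0); apply: (@polyseqsR _ 1 1).
  by have := polyseqs_exp x 1; under eq_fun do rewrite mul1n.
by have := polyseqs_exp y 1; under eq_fun do rewrite mul1n.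
Qed.

End Negligible.

End InvariantFunctionals.

(** * Differential calculus on row vectors *)

Section RowNorm.
Variables (R : realType) (n : nat).
Implicit Types u : 'rV[R]_n.

Lemma normr_entry m p (A : 'M[R]_(m, p)) i j : `|A i j| <= `|A|.
Proof.
rewrite [leRHS]/Num.Def.normr /= mx_normrE.
by apply: le_trans; last exact: (le_bigmax _ _ (i, j)).
Qed.

Lemma normr_coord u j : `|u 0 j| <= `|u|.
Proof. exact: normr_entry. Qed.

Lemma normr_row_le u e : 0 <= e -> (forall j, `|u 0 j| <= e) -> `|u| <= e.
Proof.
move=> e0 h; rewrite [leLHS]/Num.Def.normr /= mx_normrE.
by apply: bigmax_le => // -[i j] _ /=; rewrite ord1.
Qed.

Lemma row_coordsE u : u = \sum_i u 0 i *: delta_mx 0 i.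
Proof. exact: row_sum_delta. Qed.

Lemma normr_delta (i : 'I_n) : `|delta_mx 0 i : 'rV[R]_n| <= 1.
Proof.
apply: (normr_row_le ler01) => j; rewrite mxE.
by case: (_ && _); rewrite ?mulr1n ?mulr0n ?normr1 ?normr0.
Qed.

End RowNorm.

Section RowMatrixProduct.
Variables (R : realType) (n : nat).
Implicit Types u : 'rV[R]_n.

Lemma normr_mulmx p u (A : 'M[R]_(n, p)) : `|u *m A| <= n%:R * `|A| * `|u|.
Proof.
have h0 : 0 <= n%:R * `|A| * `|u| by rewrite !mulr_ge0.
apply: (normr_row_le h0) => j.
rewrite mxE; apply: le_trans (ler_norm_sum _ _ _) _.
apply: (@le_trans _ _ (\sum_(i < n) `|A| * `|u|)).
  by apply: ler_sum => i _; rewrite normrM mulrC ler_pM // normr_entry.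
by rewrite sumr_const card_ord -mulrA mulr_natl.
Qed.

Lemma continuous_mulmxr p (A : 'M[R]_(n, p)) :
  continuous (fun u : 'rV[R]_n => u *m A).
Proof.
move=> u; apply/(@cvgrPdist_le R 'rV[R]_p _ (nbhs u)) => e e0.
have K0 : 0 < n%:R * `|A| + 1 by rewrite ltr_wpDl // mulr_ge0.
near=> v; rewrite -mulmxBl; apply: le_trans (normr_mulmx _ _) _.
apply: (@le_trans _ _ ((n%:R * `|A| + 1) * `|u - v|)).
  by rewrite ler_wpM2r // lerDl.
rewrite -ler_pdivlMl // mulrC.
near: v; apply: (@cvgr_dist_le _ _ _ _ _ id) => //.
by rewrite divr_gt0.
Unshelve. all: by end_near. Qed.

End RowMatrixProduct.

Section DirectionalMeanValue.
Variables (R : realType) (V : normedModType R).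
Implicit Types (x v : V).

Lemma is_derive_line (W : normedModType R) (f : V -> W) x v (t : R) :
  derivable f (x + t *: v) v ->
  is_derive t 1 (fun s : R => f (x + s *: v)) ('D_v f (x + t *: v)).
Proof.
have E : (fun h : R => h^-1 *: (f (h *: v + (x + t *: v)) - f (x + t *: v))) =
    (fun h : R => h^-1 *: (f (x + (h *: (1 : R^o) + t) *: v) - f (x + t *: v))).
  apply/funext => h; congr (_ *: (f _ - _)).
  by rewrite scalerDl addrCA [h *: (1 : R^o)]mulr1.
move=> d; split; first by rewrite /derivable -E.
by rewrite /derive -E.
Qed.

Lemma mean_value_dir (f : V -> R) x v :
  (forall t : R, t \in `[0, 1] -> derivable f (x + t *: v) v) ->
  exists2 t : R, t \in `[0, 1] & f (x + v) - f x = 'D_v f (x + t *: v).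
Proof.
move=> df.
have D (t : R) : t \in `[0, 1] ->
    is_derive t 1 (fun s : R => f (x + s *: v)) ('D_v f (x + t *: v)).
  by move=> /df; exact: is_derive_line.
have fc : {within `[0, 1], continuous (fun s : R => f (x + s *: v))}.
  by apply: derivable_within_continuous => t /D [].
have [t t01 E] := MVT_segment ler01 (fun t ht => D t (subset_itv_oo_cc ht)) fc.
by exists t => //; move: E; rewrite scale1r scale0r addr0 subr0 mulr1.
Qed.

(** The sup norm allows the scalar mean value theorem in each coordinate, each with its own
    intermediate point. *)
Lemma mean_value_le m (f : V -> 'rV[R]_m) x v c e :
  (forall t : R, t \in `[0, 1] ->
    derivable f (x + t *: v) v /\ `|'D_v f (x + t *: v) - c| <= e) ->
  `|f (x + v) - f x - c| <= e.
Proof.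
move=> h; have e0 : 0 <= e.
  have [|_ h0] := h 0; first by rewrite in_itv /= lexx ler01.
  by apply: le_trans h0; exact: normr_ge0.
apply: normr_row_le => // j.
have dj (t : R) : t \in `[0, 1] -> derivable (fun y => f y 0 j) (x + t *: v) v.
  by move=> /h[/derivable_mxP].
have [t t01 E] := mean_value_dir dj.
have [d hd] := h t t01; rewrite !mxE E; apply: le_trans hd.
apply: le_trans (normr_coord _ j); rewrite !mxE derive_mx // mxE.
by [].
Qed.

Lemma derivable_dirZ (W : normedModType R) (f : V -> W) x v (a : R) :
  derivable f x v -> is_derive x (a *: v) f (a *: 'D_v f x).
Proof.
move=> d; have [->|a0] := eqVneq a 0.
  by rewrite !scale0r; exact: is_derive0.
have /derivable1P/derivable1_diffP dg := d.
pose g := fun h : R => f (h *: v + x).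
have E : (fun h : R => h^-1 *: (f (h *: (a *: v) + x) - f x)) =
    (fun h : R => h^-1 *: (g (h *: a + 0) - g 0)).
  apply/funext => h; rewrite /g addr0 scale0r add0r scalerA.
  by [].
have dga : 'D_a g 0 = a *: 'D_v f x.
  rewrite deriveE // -[a in LHS]mulr1 [LHS]linearZ /= -deriveE //; congr (_ *: _).
  rewrite /derive; have -> // : (fun h : R => h^-1 *: ((g \o shift 0) (h *: 1) - g 0)) =
    (fun h : R => h^-1 *: ((f \o shift x) (h *: v) - f x)).
  by apply/funext => h; rewrite /g /= addr0 scale0r add0r [h *: _]mulr1.
split; last by rewrite /derive E -dga.
by have := @diff_derivable _ _ _ g 0 a dg; rewrite /derivable E.
Qed.

End DirectionalMeanValue.

Section CkCalculus.
Variable R : realType.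

Lemma Ck_continuous (V W : normedModType R) k (U : set V) (f : V -> W) x :
  Ck k U f -> U x -> {for x, continuous f}.
Proof. by case: k => [|k] [h _]; exact: h. Qed.

Lemma Ck_derivable (V W : normedModType R) k (U : set V) (f : V -> W) x :
  Ck k.+1 U f -> U x -> forall v, derivable f x v.
Proof. by move=> [_ h] Ux v; have [h' _] := h v; exact: h'. Qed.

Lemma CkD (V W : normedModType R) k (U : set V) (f : V -> W) v :
  Ck k.+1 U f -> Ck k U ('D_v f).
Proof. by move=> [_ /(_ v)[]]. Qed.

Lemma CkW (V W : normedModType R) k (U : set V) (f : V -> W) :
  Ck k.+1 U f -> Ck k U f.
Proof.
elim: k f => [|k ih] f h; first by split=> //; case: h.
split=> [|v]; first by case: h.
split=> [x Ux|]; last by apply: ih; exact: CkD.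
by case: h => _ /(_ v)[h _]; exact: h.
Qed.

Lemma Ck_sub (V W : normedModType R) k (U U' : set V) (f : V -> W) :
  U' `<=` U -> Ck k U f -> Ck k U' f.
Proof.
move=> UU'; elim: k f => [|k ih] f [h0 h1]; first by split=> // x /UU'; exact: h0.
split=> [x /UU'|v]; first exact: h0.
by have [h2 h3] := h1 v; split=> [x /UU'|]; [exact: h2|exact: ih].
Qed.

Section Differentiability.
Variables (m n : nat).
Implicit Types (U : set 'rV[R]_m) (f : 'rV[R]_m -> 'rV[R]_n).

Definition grad f x : 'M[R]_(m, n) := \matrix_i 'D_(delta_mx 0 i) f x.

(** Coordinates are changed one at a time, each increment being estimated by a partial derivative
    that is nearly constant close to [x]. *)
Lemma increment_grad U f x (e : R) : open U -> Ck 1 U f -> U x -> 0 < e ->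
  \forall h \near (0 : 'rV[R]_m), `|f (x + h) - f x - h *m grad f x| <= e * `|h|.
Proof.
move=> oU hf Ux e0.
(* The [m] coordinate steps share the error [e]; [m.+1] avoids dividing by zero when [m = 0]. *)
pose d := e / m.+1%:R.
have d0 : 0 < d by rewrite divr_gt0.
have : \forall y \near x, forall i : 'I_m,
    U y /\ `|'D_(delta_mx 0 i) f y - 'D_(delta_mx 0 i) f x| <= d.
  have hi (i : 'I_m) : \forall y \near x,
      U y /\ `|'D_(delta_mx 0 i) f y - 'D_(delta_mx 0 i) f x| <= d.
    have nU : \forall y \near x, U y by exact: open_nbhs_nbhs.
    have /cvgrPdistC_le /(_ d d0) nD := Ck_continuous (CkD (delta_mx 0 i) hf) Ux.
    exact: (filterI nU nD).
  exact: (filter_forall _ hi).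
move=> /nbhs_ballP[r /= r0 hr].
apply/nbhs_ballP; exists (r / m.+1%:R); first by rewrite /= divr_gt0.
move=> h; rewrite -ball_normE /= sub0r normrN => hh.
have hmr : m%:R * `|h| < r.
  apply: le_lt_trans (_ : m.+1%:R * `|h| < r); last first.
    by rewrite mulrC -ltr_pdivlMr.
  by rewrite ler_wpM2r // ler_nat.
have step (s : seq 'I_m) : (size s <= m)%N ->
    `|\sum_(i <- s) h 0 i *: delta_mx 0 i : 'rV[R]_m| <= (size s)%:R * `|h| /\
    `|f (x + \sum_(i <- s) h 0 i *: delta_mx 0 i) - f x -
      \sum_(i <- s) h 0 i *: 'D_(delta_mx 0 i) f x| <= (size s)%:R * (d * `|h|).
  elim: s => [_|i s ih sz] /=.
    by split; rewrite !big_nil ?addr0 ?subrr ?subr0 normr0 !mul0r.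
  have [ih1 ih2] := ih (ltnW sz); rewrite !big_cons.
  set S := \sum_(j <- s) _ in ih1 ih2 *; set T := \sum_(j <- s) _ in ih2 *.
  have hi : `|h 0 i *: delta_mx 0 i : 'rV[R]_m| <= `|h|.
    rewrite normrZ; apply: le_trans (normr_coord h i).
    by rewrite ler_piMr // normr_delta.
  split.
    apply: le_trans (ler_normD _ _) _.
    by rewrite -natr1 mulrDl mul1r addrC lerD.
  have mv : `|f (x + S + h 0 i *: delta_mx 0 i) - f (x + S) -
      h 0 i *: 'D_(delta_mx 0 i) f x| <= d * `|h|.
    apply: mean_value_le => t; rewrite in_itv /= => /andP[t0 t1].
    have /hr /(_ i)[Uy dy] : ball x r (x + S + t *: (h 0 i *: delta_mx 0 i)).
      rewrite -ball_normE /= -addrA opprD addrA subrr sub0r normrN.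
      apply: le_lt_trans hmr; apply: (@le_trans _ _ ((size s).+1%:R * `|h|)).
        rewrite -natr1 mulrDl mul1r; apply: le_trans (ler_normD _ _) _.
        apply: lerD => //; apply: le_trans hi.
        by rewrite [leLHS]normrZ (ger0_norm t0) ler_piMl.
      by rewrite ler_wpM2r // ler_nat.
    have D := derivable_dirZ (h 0 i) (Ck_derivable (v := delta_mx 0 i) hf Uy).
    split; first by case: D.
    rewrite derive_val -scalerBr normrZ mulrC ler_pM //.
    exact: normr_coord.
  rewrite [_ *: delta_mx 0 i + S]addrC addrA.
  have -> : f (x + S + h 0 i *: delta_mx 0 i) - f x -
      (h 0 i *: 'D_(delta_mx 0 i) f x + T) =
      (f (x + S + h 0 i *: delta_mx 0 i) - f (x + S) -
      h 0 i *: 'D_(delta_mx 0 i) f x) + (f (x + S) - f x - T).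
    by apply/rowP => j; rewrite !mxE; ring.
  apply: le_trans (ler_normD _ _) _.
  by rewrite -natr1 mulrDl mul1r addrC lerD.
have [_] := step (enum 'I_m) (eq_leq (size_enum_ord m)).
rewrite !big_enum size_enum_ord -row_sum_delta => H.
have -> : h *m grad f x = \sum_i h 0 i *: 'D_(delta_mx 0 i) f x.
  rewrite mulmx_sum_row; apply: eq_bigr => i _; congr (_ *: _).
  by rewrite rowK.
apply: le_trans H _; rewrite mulrA ler_wpM2r // /d mulrA ler_pdivrMr //.
by rewrite mulrC ler_wpM2l ?(ltW e0) // ler_nat.
Qed.

Lemma Ck1_is_diff U f x : open U -> Ck 1 U f -> U x ->
  differentiable f x /\ forall v, 'd f x v = v *m grad f x.
Proof.
move=> oU hf Ux; pose L := mulmxr (grad f x) : {linear 'rV[R]_m -> 'rV[R]_n}.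
have cL : continuous L by exact: continuous_mulmxr.
have E : f \o shift x = cst (f x) + (L : 'rV[R]_m -> 'rV[R]_n) +o_ (0 : 'rV[R]_m) id.
  apply/eqaddoP => e e0; have := increment_grad oU hf Ux e0.
  apply: filterS => h; rewrite /= /cst /= !fctE [h + x]addrC opprD addrA.
  by [].
have D := diff_unique cL E.
split; last by move=> v; rewrite D.
by apply/diff_locallyP; rewrite D.
Qed.

Lemma Ck1_derive U f x v : open U -> Ck 1 U f -> U x ->
  'D_v f x = v *m grad f x.
Proof.
by move=> oU hf Ux; have [d D] := Ck1_is_diff oU hf Ux; rewrite deriveE // D.
Qed.

Lemma Ck1_derive_sum U f x v : open U -> Ck 1 U f -> U x ->
  'D_v f x = \sum_i v 0 i *: 'D_(delta_mx 0 i) f x.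
Proof.
move=> oU hf Ux; rewrite (Ck1_derive _ oU hf Ux) mulmx_sum_row.
by apply: eq_bigr => i _; rewrite rowK.
Qed.

End Differentiability.
End CkCalculus.

Section SecondOrderExpansion.
Variable R : realType.

Lemma is_derive_shiftr (V W : normedModType R) (f : V -> W) x y v :
  derivable f (x + y) v ->
  is_derive x v (fun z => f (z + y)) ('D_v f (x + y)).
Proof.
have E : (fun h : R => h^-1 *: (f (h *: v + (x + y)) - f (x + y))) =
    (fun h : R => h^-1 *: (f (h *: v + x + y) - f (x + y))).
  by apply/funext => h; rewrite addrA.
move=> d; split; first by rewrite /derivable -E.
by rewrite /derive -E.
Qed.

Lemma derive_sumZ (V W : normedModType R) p (g : 'I_p -> V -> W) (a : 'I_p -> R) x v :
  (forall k, derivable (g k) x v) ->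
  'D_v (fun z => \sum_k a k *: g k z) x = \sum_k a k *: 'D_v (g k) x.
Proof.
move=> dg; rewrite (_ : (fun z => _) = \sum_k (a k \*: g k)).
  rewrite derive_sum => [|k]; last exact: derivableZ.
  by apply: eq_bigr => k _; rewrite deriveZ.
by apply/funext => z; rewrite fct_sumE.
Qed.

Lemma normr_sumZ p n (a : 'rV[R]_p) (X : 'I_p -> 'rV[R]_n) M :
  (forall k, `|X k| <= M) -> `|\sum_k a 0 k *: X k| <= p%:R * (`|a| * M).
Proof.
move=> h; apply: le_trans (ler_norm_sum _ _ _) _.
apply: (@le_trans _ _ (\sum_(k < p) `|a| * M)).
  by apply: ler_sum => k _; rewrite normrZ ler_pM // normr_coord.
by rewrite sumr_const card_ord mulr_natl.
Qed.

Lemma ler_sum_term (I : finType) (F : I -> R) i :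
  (forall j, 0 <= F j) -> F i <= \sum_j F j.
Proof. by move=> F0; rewrite (bigD1 i) //= lerDl sumr_ge0. Qed.

Section Expansion.
Variables (p n : nat) (U : set 'rV[R]_p).
Hypothesis oU : open U.
Implicit Types (f : 'rV[R]_p -> 'rV[R]_n) (x u v w : 'rV[R]_p).
Let e k : 'rV[R]_p := delta_mx 0 k.

Lemma Ck2_derive_sum f x v w : Ck 2 U f -> U x ->
  'D_v ('D_w f) x = \sum_k w 0 k *: 'D_v ('D_(e k) f) x.
Proof.
move=> hf Ux; rewrite -derive_sumZ.
  apply: near_eq_derive; have := open_nbhs_nbhs (conj oU Ux).
  by apply: filterS => y Uy; apply: (Ck1_derive_sum _ oU (CkW hf) Uy).
by move=> k; apply: (Ck_derivable (CkD (e k) hf) Ux).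
Qed.

Lemma Ck3_derive_sum f x u v w : Ck 3 U f -> U x ->
  'D_u ('D_v ('D_w f)) x = \sum_k w 0 k *: 'D_u ('D_v ('D_(e k) f)) x.
Proof.
move=> hf Ux; rewrite -derive_sumZ.
  apply: near_eq_derive; have := open_nbhs_nbhs (conj oU Ux).
  by apply: filterS => y Uy; apply: (Ck2_derive_sum _ _ (CkW hf) Uy).
by move=> k; apply: (Ck_derivable (CkD v (CkD (e k) hf)) Ux).
Qed.

(** Directions are expanded in the basis, so a bound for the finitely many basis derivatives near 0
    suffices. *)
Lemma third_derivative_bound f : Ck 3 U f -> U 0 ->
  exists r C, [/\ 0 < r, 0 <= C, forall z, `|z| < r -> U z &
    forall z u v w, `|z| < r ->
      `|'D_u ('D_v ('D_w f)) z| <= C * `|u| * `|v| * `|w|].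
Proof.
move=> hf U0; pose T i j k := `|'D_(e i) ('D_(e j) ('D_(e k) f)) 0| + 1.
have T0 i j k : 0 <= T i j k by rewrite addr_ge0.
pose M := \sum_i \sum_j \sum_k T i j k.
have : \forall z \near (0 : 'rV[R]_p), U z /\
    forall i j k, `|'D_(e i) ('D_(e j) ('D_(e k) f)) z| <= M.
  have h3 i j k : \forall z \near (0 : 'rV[R]_p),
      `|'D_(e i) ('D_(e j) ('D_(e k) f)) z| <= M.
    have c3 := Ck_continuous (CkD (e i) (CkD (e j) (CkD (e k) hf))) U0.
    have /cvgrPdistC_le /(_ 1 ltr01) := c3; apply: filterS => z hz.
    apply: (@le_trans _ _ (T i j k)).
      rewrite -lerBlDl; apply: le_trans hz; apply: le_trans (ler_norm _) _.
      exact: ler_dist_dist.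
    apply: (le_trans (ler_sum_term k (T0 i j))).
    apply: (le_trans (ler_sum_term j (fun j => sumr_ge0 _ (fun k _ => T0 i j k)))).
    apply: (ler_sum_term i (fun i => sumr_ge0 _ (fun j _ =>
      sumr_ge0 _ (fun k _ => T0 i j k)))).
  have nU : \forall z \near (0 : 'rV[R]_p), U z by exact: open_nbhs_nbhs.
  apply: (filterI nU).
  exact: (filter_forall _ (fun i => filter_forall _ (fun j => filter_forall _ (h3 i j)))).
move=> /nbhs_ballP[r /= r0 hr].
have M0 : 0 <= M by do 3![apply: sumr_ge0 => ? _]; exact: T0.
have inr z : `|z| < r -> ball (0 : 'rV[R]_p) r z.
  by rewrite -ball_normE /= sub0r normrN.
exists r, (p%:R * (p%:R * (p%:R * M))); split=> //.
- by rewrite !mulr_ge0.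
- by move=> z /inr/hr[].
move=> z u v w /inr/hr[Uz hM].
rewrite (Ck3_derive_sum _ _ _ hf Uz).
apply: le_trans (normr_sumZ _ (M := p%:R * (`|v| * (p%:R * (`|u| * M)))) _) _.
  move=> k; have hk := CkD (e k) hf; rewrite (Ck2_derive_sum _ _ hk Uz).
  apply: normr_sumZ => j; rewrite (Ck1_derive_sum _ oU (CkD (e j) hk) Uz).
  by apply: normr_sumZ => i.
by rewrite le_eqVlt; apply/orP; left; apply/eqP; ring.
Qed.

(** The mixed second difference is estimated by the mean value inequality along [x], then along [y],
    then from 0. The error carries the factor [|x| |y|], which later makes products close to the
    identity cancel exactly. *)
Lemma second_order_expansion f : Ck 3 U f -> U 0 ->
  exists r C, [/\ 0 < r, 0 <= C & forall x y, `|x| < r -> `|y| < r ->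
    `|f (x + y) - f x - f y + f 0 - 'D_y ('D_x f) 0| <=
      C * `|x| * `|y| * (`|x| + `|y|)].
Proof.
move=> hf U0; have [r [C [r0 C0 rU hC]]] := third_derivative_bound hf U0.
exists (r / 2), C; split=> // [|x y xr yr]; first by rewrite divr_gt0.
have sml (s t : R) : s \in `[0, 1] -> t \in `[0, 1] ->
    `|t *: x + s *: y| <= `|x| + `|y|.
  rewrite !in_itv /= => /andP[s0 s1] /andP[t0 t1].
  apply: le_trans (ler_normD _ _) _; rewrite !normrZ !ger0_norm //.
  by apply: lerD; rewrite ler_piMl.
have xyr : `|x| + `|y| < r by lra.
have one : (1 : R) \in `[0, 1] by rewrite in_itv /= lexx ler01.
have zero : (0 : R) \in `[0, 1] by rewrite in_itv /= lexx ler01.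
set E := C * _ * _ * _.
have h2 (s t : R) : s \in `[0, 1] -> t \in `[0, 1] ->
    `|'D_y ('D_x f) (t *: x + s *: y) - 'D_y ('D_x f) 0| <= E.
  move=> hs ht; have := @mean_value_le _ _ n ('D_y ('D_x f)) 0 (t *: x + s *: y) 0 E.
  rewrite subr0 add0r; apply=> q; rewrite in_itv /= => /andP[q0 q1].
  have hz : `|0 + q *: (t *: x + s *: y)| < r.
    rewrite add0r normrZ ger0_norm //; apply: le_lt_trans xyr.
    by apply: le_trans (sml s t hs ht); rewrite ler_piMl.
  split; first exact: (Ck_derivable (CkD y (CkD x hf)) (rU _ hz)).
  rewrite subr0; apply: le_trans (hC _ _ _ _ hz) _.
  apply: (@le_trans _ _ (C * (`|x| + `|y|) * `|y| * `|x|)).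
    by do 2![apply: ler_wpM2r => //]; apply: ler_wpM2l => //; exact: sml.
  by rewrite le_eqVlt; apply/orP; left; apply/eqP; rewrite /E; ring.
have h1 (t : R) : t \in `[0, 1] ->
    `|'D_x f (t *: x + y) - 'D_x f (t *: x) - 'D_y ('D_x f) 0| <= E.
  move=> ht; apply: (@mean_value_le _ _ n ('D_x f)) => s hs; split; last exact: h2.
  apply: (Ck_derivable (CkD x hf)); apply: rU.
  by apply: le_lt_trans xyr; exact: sml.
have d (t : R) : t \in `[0, 1] -> is_derive (t *: x) x
    (fun z => f (z + y) - f z) ('D_x f (t *: x + y) - 'D_x f (t *: x)).
  move=> ht.
  have d1 : derivable f (t *: x + y) x.
    apply: (Ck_derivable hf); apply: rU; rewrite -[y]scale1r.
    by apply: le_lt_trans xyr; exact: sml.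
  have d2 : derivable f (t *: x) x.
    apply: (Ck_derivable hf); apply: rU; rewrite -[_ *: x]addr0 -[0](scale0r y).
    by apply: le_lt_trans xyr; exact: sml.
  exact: (@is_deriveB _ _ _ (fun z => f (z + y)) f _ _ _ _ (is_derive_shiftr d1) (derivableP d2)).
have -> : f (x + y) - f x - f y + f 0 - 'D_y ('D_x f) 0 =
    (f (0 + x + y) - f (0 + x)) - (f (0 + y) - f 0) - 'D_y ('D_x f) 0.
  by rewrite !add0r opprB !addrA; congr (_ - _); rewrite addrAC.
apply: (@mean_value_le _ _ n (fun z => f (z + y) - f z) 0 x) => t ht.
rewrite add0r; have [d1 d2] := d t ht; split=> //.
by rewrite d2; exact: h1.
Qed.

End Expansion.
End SecondOrderExpansion.

(** * The group law in a chart at the identity *)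

Section CkAffine.
Variable R : realType.

(** A difference quotient of [F \o A] along [v] is one of [F] along [A0 v]; this passes through all
    orders and takes the place of a chain rule of order [k]. *)
Lemma Ck_comp_affine (V V' W : normedModType R) k (D : set V) (F : V -> W)
    (A A0 : V' -> V) : continuous A ->
  (forall (h : R) v z, A (h *: v + z) = h *: A0 v + A z) ->
  Ck k D F -> Ck k (A @^-1` D) (F \o A).
Proof.
move=> cA hA; have E (f : V -> W) v z :
    (fun h : R => h^-1 *: ((f \o A) (h *: v + z) - (f \o A) z)) =
    (fun h : R => h^-1 *: (f (h *: A0 v + A z) - f (A z))).
  by apply/funext => h /=; rewrite hA.
have c (f : V -> W) z : {for A z, continuous f} -> {for z, continuous (f \o A)}.
  by move=> cf; apply: continuous_comp => //; exact: cA.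
elim: k F => [|k ih] F [h0 h1].
  by split=> // x Dx; apply: c; exact: h0.
split=> [x Dx|v]; first by apply: c; exact: h0.
have [h2 h3] := h1 (A0 v); split=> [x Dx|].
  by rewrite /derivable E; exact: h2.
rewrite (_ : 'D_v (F \o A) = 'D_(A0 v) F \o A); first exact: ih.
by apply/funext => x; rewrite /derive E.
Qed.

Lemma continuous_addl (V : normedModType R) (a : V) : continuous (fun x => a + x).
Proof.
move=> x; have c : (fun=> a) @ x --> a by exact: cvg_cst.
have i : (id : V -> V) @ x --> x by exact: cvg_id.
exact: (cvgD c i).
Qed.

Lemma continuous_const (V W : normedModType R) (a : W) : continuous (fun _ : V => a).
Proof. by move=> x; exact: cvg_cst. Qed.

Lemma continuous_pairl (V W : normedModType R) (a : V) : continuous (fun x : W => (a, x)).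
Proof.
move=> x; have c : (fun _ : W => a) @ x --> a by exact: cvg_cst.
have i : (id : W -> W) @ x --> x by exact: cvg_id.
exact: (cvg_pair c i).
Qed.

Lemma Ck_subr (V W : normedModType R) k (D : set V) (F : V -> W) y :
  Ck k D F -> Ck k D (fun x => F x - y).
Proof.
case: k => [|k] [h0 h1].
  by split=> // x Dx; apply: cvgB; [exact: h0|exact: cvg_cst].
split=> [x Dx|v]; first by apply: cvgB; [exact: h0|exact: cvg_cst].
have E z : (fun h : R => h^-1 *: ((F (h *: v + z) - y) - (F z - y))) =
    (fun h : R => h^-1 *: (F (h *: v + z) - F z)).
  by apply/funext => h; rewrite opprB addrA subrK.
have [h2 h3] := h1 v; split=> [x Dx|]; first by rewrite /derivable E; exact: h2.
rewrite (_ : 'D_v _ = 'D_v F) //.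
by apply/funext => x; rewrite /derive E.
Qed.

End CkAffine.

Section ChartAtOne.
Variables (R : realType) (n : nat) (G : lieGroupType R n).
Implicit Types (g h p q : G) (x y u v : 'rV[R]_n).

Definition chart1 : chart G 'rV[R]_n := chart_at (1%g : G).
Definition crd g : 'rV[R]_n := cmap chart1 g - cmap chart1 1%g.
Definition pnt x : G := cinv chart1 (cmap chart1 1%g + x).
Definition chart_ball (r : R) : set G :=
  [set g | cdom chart1 g /\ `|crd g| < r].

Lemma atlas1 : atlas chart1.
Proof. by rewrite /chart1 /chart_at; case: cid => c []. Qed.

Lemma cdom1 : cdom chart1 1%g.
Proof. by rewrite /chart1 /chart_at; case: cid => c []. Qed.

Lemma chart1P : is_chart chart1.
Proof. exact: (atlas_is_chart chart1 atlas1). Qed.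

Lemma mulg_continuous : continuous (fun p : G * G => (p.1 * p.2)%g).
Proof. by case: (@mulg_smooth R n G). Qed.

Lemma invg_continuous : continuous (fun p : G => p^-1%g).
Proof. by case: (@invg_smooth R n G). Qed.

Lemma cvgMg (T : Type) (F : set_system T) {FF : Filter F} (a b : T -> G) p q :
  a @ F --> p -> b @ F --> q -> (fun t => a t * b t)%g @ F --> (p * q)%g.
Proof.
move=> ha hb; apply: (@cvg_comp _ _ _ (fun t => (a t, b t)) (fun p : G * G => (p.1 * p.2)%g)
  _ (nbhs (p, q))); first exact: cvg_pair.
exact: (@mulg_continuous (p, q)).
Qed.

Lemma cvgVg (T : Type) (F : set_system T) {FF : Filter F} (a : T -> G) p :
  a @ F --> p -> (fun t => (a t)^-1)%g @ F --> p^-1%g.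
Proof. by move=> ha; apply: cvg_comp ha _; exact: invg_continuous. Qed.

Lemma crd1 : crd 1%g = 0. Proof. exact: subrr. Qed.

Lemma pnt0 : pnt 0 = 1%g.
Proof.
by rewrite /pnt addr0; have [_ _ h _ _] := chart1P; rewrite h //; exact: cdom1.
Qed.

Lemma crdK g : cdom chart1 g -> pnt (crd g) = g.
Proof.
by move=> Dg; rewrite /pnt /crd addrC subrK; have [_ _ h _ _] := chart1P; exact: h.
Qed.

Lemma pntK x : cimg chart1 (cmap chart1 1%g + x) ->
  cdom chart1 (pnt x) /\ crd (pnt x) = x.
Proof.
move=> [p Dp E]; have [_ _ h _ _] := chart1P.
by rewrite /crd /pnt -E h // E addrAC subrr add0r.
Qed.

Lemma crd_continuous g : cdom chart1 g -> {for g, continuous crd}.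
Proof.
move=> Dg; have [_ _ _ h _] := chart1P.
by apply: cvgB; [exact: h|exact: cvg_cst].
Qed.

Lemma pnt_continuous x : cimg chart1 (cmap chart1 1%g + x) ->
  {for x, continuous pnt}.
Proof.
move=> hx; have [_ _ _ _ h] := chart1P.
apply: (@continuous_comp _ _ _ (fun x => cmap chart1 1%g + x) (cinv chart1)).
  exact: continuous_addl.
exact: h.
Qed.

Lemma near_cimg : \forall x \near (0 : 'rV[R]_n), cimg chart1 (cmap chart1 1%g + x).
Proof.
have [_ oI _ _ _] := chart1P.
have c0 : (fun x : 'rV[R]_n => cmap chart1 1%g + x) @ (0 : 'rV[R]_n) --> cmap chart1 1%g.
  by rewrite -[X in _ --> X]addr0; exact: continuous_addl.
apply: c0; apply: open_nbhs_nbhs; split=> //.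
by exists 1%g => //; exact: cdom1.
Qed.

Lemma near_cdom g : cdom chart1 g -> \forall p \near g, cdom chart1 p.
Proof.
have [oD _ _ _ _] := chart1P.
by move=> Dg; apply: open_nbhs_nbhs.
Qed.

Lemma near_norm_lt (T : topologicalType) (a : T -> 'rV[R]_n) (t : T) r :
  {for t, continuous a} -> `|a t| < r -> \forall s \near t, `|a s| < r.
Proof.
move=> ca hr; have r0 : 0 < r - `|a t| by rewrite subr_gt0.
have /cvgrPdistC_lt /(_ _ r0) := ca; apply: filterS => s hs.
rewrite -(subrK (a t) (a s)); apply: le_lt_trans (ler_normD _ _) _.
by rewrite -ltrBrDr.
Qed.

Lemma chart_ball_nbhs r : 0 < r -> \forall g \near (1%g : G), chart_ball r g.
Proof.
move=> r0; apply: filterI; first exact: near_cdom cdom1.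
apply: near_norm_lt; first exact: crd_continuous cdom1.
by rewrite crd1 normr0.
Qed.

(** Multiplication read in the chart, on row vectors of size [n + n] rather than pairs, so that the
    calculus on row vectors applies. *)
Let law_rep (z : 'rV[R]_(n + n)) : 'rV[R]_n :=
  crd (pnt (lsubmx z) * pnt (rsubmx z))%g.

Lemma law_rep_Ck k : exists U : set 'rV[R]_(n + n),
  [/\ open U, U 0, Ck k U law_rep &
    forall z, U z -> cdom chart1 (pnt (lsubmx z) * pnt (rsubmx z))%g].
Proof.
pose c2 := Chart (cdom chart1 `*` cdom chart1)
  (fun p : G * G => (cmap chart1 p.1, cmap chart1 p.2))
  (fun x : 'rV[R]_n * 'rV[R]_n => (cinv chart1 x.1, cinv chart1 x.2)).
have Ac2 : prod_atlas (@atlas R n G) (@atlas R n G) c2.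
  by exists chart1; [exact: atlas1|exists chart1; [exact: atlas1|]].
have [_ /(_ c2 chart1 Ac2 atlas1 k) hF] := @mulg_smooth R n G.
set D := coord_dom _ _ _ in hF.
pose x0 := cmap chart1 (1%g : G).
pose A (z : 'rV[R]_(n + n)) : 'rV[R]_n * 'rV[R]_n := (x0 + lsubmx z, x0 + rsubmx z).
pose A0 (z : 'rV[R]_(n + n)) : 'rV[R]_n * 'rV[R]_n := (lsubmx z, rsubmx z).
have cl : continuous (lsubmx : 'rV[R]_(n + n) -> 'rV[R]_n).
  by move=> z; apply: differentiable_continuous; exact: differentiable_lsubmx.
have cr : continuous (rsubmx : 'rV[R]_(n + n) -> 'rV[R]_n).
  by move=> z; apply: differentiable_continuous; exact: differentiable_rsubmx.
have cA : continuous A.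
  move=> z; have c (a : 'rV[R]_(n + n) -> 'rV[R]_n) : continuous a ->
      (fun z => x0 + a z) @ z --> x0 + a z.
    move=> ca; apply: (@continuous_comp _ _ _ a (fun y => x0 + y)); first exact: ca.
    exact: continuous_addl.
  exact: (cvg_pair (c _ cl) (c _ cr)).
have hA (h : R) (v z : 'rV[R]_(n + n)) : A (h *: v + z) = h *: A0 v + A z.
  by rewrite /A /A0; congr pair; rewrite linearD linearZ /= addrCA.
have := Ck_subr x0 (Ck_comp_affine cA hA hF).
set U := A @^-1` D => hU.
have nU : \forall z \near (0 : 'rV[R]_(n + n)), U z.
  have [l0 r0] : lsubmx (0 : 'rV[R]_(n + n)) = (0 : 'rV[R]_n) /\
    rsubmx (0 : 'rV[R]_(n + n)) = (0 : 'rV[R]_n) by rewrite !linear0.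
  have cl0 : (lsubmx : 'rV[R]_(n + n) -> 'rV[R]_n) @ (0 : 'rV[R]_(n + n)) --> (0 : 'rV[R]_n).
    by rewrite -[X in _ --> X]l0; exact: cl.
  have cr0 : (rsubmx : 'rV[R]_(n + n) -> 'rV[R]_n) @ (0 : 'rV[R]_(n + n)) --> (0 : 'rV[R]_n).
    by rewrite -[X in _ --> X]r0; exact: cr.
  have hl : \forall z \near (0 : 'rV[R]_(n + n)), cimg chart1 (x0 + lsubmx z).
    exact: (cl0 _ near_cimg).
  have hr : \forall z \near (0 : 'rV[R]_(n + n)), cimg chart1 (x0 + rsubmx z).
    exact: (cr0 _ near_cimg).
  have cp : {for 0, continuous pnt} by apply: pnt_continuous; exact: nbhs_singleton near_cimg.
  have pl : (fun z : 'rV[R]_(n + n) => pnt (lsubmx z)) @ (0 : 'rV[R]_(n + n)) --> (1%g : G).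
    rewrite -pnt0 -l0; apply: (@continuous_comp _ _ _ lsubmx pnt); first exact: cl.
    by rewrite l0.
  have pr : (fun z : 'rV[R]_(n + n) => pnt (rsubmx z)) @ (0 : 'rV[R]_(n + n)) --> (1%g : G).
    rewrite -pnt0 -r0; apply: (@continuous_comp _ _ _ rsubmx pnt); first exact: cr.
    by rewrite r0.
  have hm : \forall z \near (0 : 'rV[R]_(n + n)),
      cdom chart1 (pnt (lsubmx z) * pnt (rsubmx z))%g.
    by have := cvgMg pl pr; rewrite mulg1; apply; exact: near_cdom cdom1.
  near=> z; split; last by near: z; exact: hm.
  have [p Dp Ep] : cimg chart1 (x0 + lsubmx z) by near: z; exact: hl.
  have [q Dq Eq] : cimg chart1 (x0 + rsubmx z) by near: z; exact: hr.
  by exists (p, q) => //; rewrite /= Ep Eq.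
exists (interior U); split.
- exact: open_interior.
- exact: nU.
- by apply: Ck_sub hU; exact: interior_subset.
by move=> z /interior_subset[].
Unshelve. all: by end_near. Qed.
Let law_der (x y : 'rV[R]_n) : 'rV[R]_n :=
  'D_(row_mx 0 y) ('D_(row_mx x 0) law_rep) 0.

Lemma row_mxD0 (a : R) x x' :
  row_mx (a *: x + x') 0 = a *: row_mx x 0 + row_mx x' (0 : 'rV[R]_n).
Proof. by rewrite scale_row_mx add_row_mx scaler0 addr0. Qed.

Lemma row_mx0D (a : R) y y' :
  row_mx 0 (a *: y + y') = a *: row_mx (0 : 'rV[R]_n) y + row_mx 0 y'.
Proof. by rewrite scale_row_mx add_row_mx scaler0 addr0. Qed.

Lemma normr_row_mx0 x : `|row_mx x (0 : 'rV[R]_n)| <= `|x|.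
Proof.
apply: (normr_row_le (normr_ge0 _)) => j; case: (split_ordP j) => k ->.
  by rewrite row_mxEl normr_coord.
by rewrite row_mxEr mxE normr0.
Qed.

Lemma normr_row_0mx y : `|row_mx (0 : 'rV[R]_n) y| <= `|y|.
Proof.
apply: (normr_row_le (normr_ge0 _)) => j; case: (split_ordP j) => k ->.
  by rewrite row_mxEl mxE normr0.
by rewrite row_mxEr normr_coord.
Qed.

(* The bilinear term [b] antisymmetrizes to the Lie bracket. *)
Definition local_law (r C : R) (b : 'rV[R]_n -> 'rV[R]_n -> 'rV[R]_n) : Prop :=
  [/\ 0 < r, 0 <= C,
    (forall (a : R) x x' y, b (a *: x + x') y = a *: b x y + b x' y) /\
      (forall (a : R) x y y', b x (a *: y + y') = a *: b x y + b x y'),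
    forall x y, `|b x y| <= C * `|x| * `|y| &
    forall x y, `|x| < r -> `|y| < r -> [/\ cimg chart1 (cmap chart1 1%g + x),
      cdom chart1 (pnt x * pnt y)%g &
      `|crd (pnt x * pnt y)%g - x - y - b x y| <= C * `|x| * `|y| * (`|x| + `|y|)]].

(** Since [law_rep] restricts to the identity on both factors, its mixed second difference is the
    deviation of the product from [x + y], and [b] is the mixed second derivative at 0. *)
Lemma group_law_expansion : exists r C b, local_law r C b.
Proof.
have [U [oU U0 hU DU]] := law_rep_Ck 3.
have [r [C [r0 C0 hC]]] := second_order_expansion oU hU U0.
have hU2 := CkW hU.
have E x y : law_der x y = \sum_k (row_mx x 0) 0 k *:
    (row_mx 0 y *m grad ('D_(delta_mx 0 k) law_rep) 0).
  rewrite /law_der (Ck2_derive_sum oU _ _ hU2 U0); apply: eq_bigr => k _.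
  by rewrite (Ck1_derive _ oU (CkD _ hU2) U0).
pose M := \sum_k `|grad ('D_(delta_mx 0 k) law_rep) 0|.
have M0 : 0 <= M by apply: sumr_ge0.
have nI : \forall x \near (0 : 'rV[R]_n), cimg chart1 (cmap chart1 1%g + x).
  exact: near_cimg.
have /nbhs_ballP[r1 /= r10 h1] := nI.
have /nbhs_ballP[r2 /= r20 h2] := open_nbhs_nbhs (conj oU U0).
pose C1 := (n + n)%:R * ((n + n)%:R * M).
have C10 : 0 <= C1 by rewrite !mulr_ge0.
exists (Num.min r (Num.min r1 (r2 / 2))), (C + C1), law_der; split.
- by rewrite !lt_min r0 r10 divr_gt0.
- by rewrite addr_ge0.
- split=> [a x x' y|a x y y'].
    rewrite !E row_mxD0 scaler_sumr -big_split /=; apply: eq_bigr => k _.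
    by rewrite [in LHS]mxE [in LHS]mxE scalerDl scalerA.
  rewrite !E row_mx0D scaler_sumr -big_split /=; apply: eq_bigr => k _.
  by rewrite mulmxDl scalerDr -scalemxAl !scalerA mulrC.
- move=> x y; rewrite E.
  apply: (@le_trans _ _ (C1 * `|x| * `|y|)); last first.
    by do 2![apply: ler_wpM2r => //]; rewrite lerDr.
  apply: le_trans (normr_sumZ _ (M := (n + n)%:R * M * `|y|) _) _ => [k|].
    apply: le_trans (normr_mulmx _ _) _.
    apply: (@le_trans _ _ ((n + n)%:R * M * `|row_mx (0 : 'rV[R]_n) y|)).
      apply: ler_wpM2r => //; apply: ler_wpM2l => //.
      exact: (ler_sum_term k (F := fun k => `|grad ('D_(delta_mx 0 k) law_rep) 0|)).
    by apply: ler_wpM2l; [rewrite mulr_ge0|exact: normr_row_0mx].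
  apply: (@le_trans _ _ ((n + n)%:R * (`|x| * ((n + n)%:R * M * `|y|)))).
    by rewrite ler_wpM2l // ler_wpM2r ?normr_row_mx0 // !mulr_ge0.
  by rewrite le_eqVlt; apply/orP; left; apply/eqP; rewrite /C1; ring.
move=> x y; rewrite !lt_min => /andP[xr /andP[xr1 xr2]] /andP[yr /andP[yr1 yr2]].
have Ix : cimg chart1 (cmap chart1 1%g + x).
  by apply: h1; rewrite -ball_normE /= sub0r normrN.
have Iy : cimg chart1 (cmap chart1 1%g + y).
  by apply: h1; rewrite -ball_normE /= sub0r normrN.
have sumE : row_mx x 0 + row_mx 0 y = row_mx x y.
  by rewrite add_row_mx addr0 add0r.
have nx := normr_row_mx0 x; have ny := normr_row_0mx y.
have Uxy : U (row_mx x y).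
  apply: h2; rewrite -ball_normE /= sub0r normrN -sumE.
  apply: le_lt_trans (ler_normD _ _) _.
  by apply: le_lt_trans (lerD nx ny) _; lra.
split=> //; first by have := DU _ Uxy; rewrite row_mxKl row_mxKr.
have := hC (row_mx x 0) (row_mx 0 y) (le_lt_trans nx xr) (le_lt_trans ny yr).
have l0 : law_rep 0 = 0.
  by rewrite /law_rep !linear0 pnt0 mulg1 crd1.
have lx : law_rep (row_mx x 0) = x.
  by rewrite /law_rep row_mxKl row_mxKr pnt0 mulg1; have [] := pntK Ix.
have ly : law_rep (row_mx 0 y) = y.
  by rewrite /law_rep row_mxKl row_mxKr pnt0 mul1g; have [] := pntK Iy.
rewrite sumE l0 lx ly addr0 {1}/law_rep row_mxKl row_mxKr => H.
apply: le_trans H _.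
have le3 : C * `|row_mx x (0 : 'rV[R]_n)| * `|row_mx (0 : 'rV[R]_n) y| <= C * `|x| * `|y|.
  by rewrite ler_pM ?mulr_ge0 // ler_wpM2l.
apply: (@le_trans _ _ (C * `|x| * `|y| * (`|x| + `|y|))).
  by rewrite ler_pM ?mulr_ge0 ?addr_ge0 // lerD.
by apply: ler_wpM2r; [rewrite addr_ge0|do 2![apply: ler_wpM2r => //]; rewrite lerDl].
Qed.

End ChartAtOne.

Section LocalEstimates.
Variables (R : realType) (n : nat) (G : lieGroupType R n).
Variables (r C : R) (b : 'rV[R]_n -> 'rV[R]_n -> 'rV[R]_n).
Hypothesis law : @local_law R n G r C b.
Implicit Types (g h : G) (x y u v p q : 'rV[R]_n).
Local Notation pnt := (@pnt R n G).
Local Notation crd := (@crd R n G).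

Let r0 : 0 < r. Proof. by case: law. Qed.
Let C0 : 0 <= C. Proof. by case: law. Qed.
Let bD x x' y : b (x + x') y = b x y + b x' y.
Proof. by case: law => _ _ [h _] _ _; rewrite -[x]scale1r h !scale1r. Qed.
Let bDr x y y' : b x (y + y') = b x y + b x y'.
Proof. by case: law => _ _ [_ h] _ _; rewrite -[y]scale1r h !scale1r. Qed.
Let b0l y : b 0 y = 0.
Proof. by apply: (addrI (b 0 y)); rewrite -bD !addr0. Qed.
Let b0r x : b x 0 = 0.
Proof. by apply: (addrI (b x 0)); rewrite -bDr !addr0. Qed.
Let bZ (a : R) x y : b (a *: x) y = a *: b x y.
Proof. by case: law => _ _ [h _] _ _; have := h a x 0 y; rewrite b0l !addr0. Qed.
Let bZr (a : R) x y : b x (a *: y) = a *: b x y.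
Proof. by case: law => _ _ [_ h] _ _; have := h a x y 0; rewrite b0r !addr0. Qed.
Let b_le x y : `|b x y| <= C * `|x| * `|y|.
Proof. by case: law. Qed.

Definition bracket x y := b x y - b y x.

Lemma bracketDl x x' y : bracket (x + x') y = bracket x y + bracket x' y.
Proof. by rewrite /bracket bD bDr opprD addrACA. Qed.

Lemma bracketZl (a : R) x y : bracket (a *: x) y = a *: bracket x y.
Proof. by rewrite /bracket bZ bZr scalerBr. Qed.

Lemma bracketC x y : bracket x y = - bracket y x.
Proof. by rewrite /bracket opprB. Qed.

Lemma bracketDr x y y' : bracket x (y + y') = bracket x y + bracket x y'.
Proof. by rewrite bracketC bracketDl opprD -!bracketC. Qed.

Lemma bracketZr (a : R) x y : bracket x (a *: y) = a *: bracket x y.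
Proof. by rewrite bracketC bracketZl -scalerN -bracketC. Qed.

Lemma bracket_le x y : `|bracket x y| <= 2 * C * `|x| * `|y|.
Proof.
apply: le_trans (ler_normB _ _) _; have := b_le x y; have := b_le y x.
by set X := `|x|; set Y := `|y|; move=> h1 h2; rewrite -(mulrA 2); lra.
Qed.

Lemma pnt_dom x : `|x| < r -> cdom (chart1 G) (pnt x) /\ crd (pnt x) = x.
Proof. by move=> xr; apply: pntK; case: law => _ _ _ _ /(_ x x xr xr)[]. Qed.

Lemma pnt_cont x : `|x| < r -> {for x, continuous pnt}.
Proof. by move=> xr; apply: pnt_continuous; case: law => _ _ _ _ /(_ x x xr xr)[]. Qed.

Lemma pnt_cvg1 : pnt @ (0 : 'rV[R]_n) --> (1%g : G).
Proof. by rewrite -[X in _ --> X]pnt0; apply: pnt_cont; rewrite normr0. Qed.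

Lemma chart_ballK g : chart_ball r g -> pnt (crd g) = g.
Proof. by move=> [Dg _]; exact: crdK. Qed.

(** The word enters only through its continuity at the identity, phrased with filters so that
    [cvgMg] and [cvgVg] prove it directly. *)
Lemma near_chart_words (w : G -> G -> G) e : 0 < e ->
  (forall (T : Type) (F : set_system T) (a c : T -> G), Filter F ->
    a @ F --> (1%g : G) -> c @ F --> (1%g : G) ->
    (fun t => w (a t) (c t)) @ F --> (1%g : G)) ->
  exists2 d, 0 < d <= r & forall x y, `|x| < d -> `|y| < d ->
    chart_ball e (w (pnt x) (pnt y)).
Proof.
move=> e0 hw.
have c1 : (fun z : 'rV[R]_n * 'rV[R]_n => pnt z.1) @ ((0, 0) : 'rV[R]_n * 'rV[R]_n) -->
    (1%g : G).
  apply: (@cvg_comp _ _ _ fst pnt _ (nbhs (0 : 'rV[R]_n))); last exact: pnt_cvg1.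
  exact: cvg_fst.
have c2 : (fun z : 'rV[R]_n * 'rV[R]_n => pnt z.2) @ ((0, 0) : 'rV[R]_n * 'rV[R]_n) -->
    (1%g : G).
  apply: (@cvg_comp _ _ _ snd pnt _ (nbhs (0 : 'rV[R]_n))); last exact: pnt_cvg1.
  exact: cvg_snd.
have h := hw _ _ _ _ _ c1 c2.
have := h (nbhs_filter _) _ (chart_ball_nbhs G e0).
move=> /nbhs_ballP[d /= d0 hd].
exists (Num.min d r) => [|x y].
  by rewrite lt_min d0 r0 ge_min lexx orbT.
rewrite !lt_min => /andP[xd _] /andP[yd _]; apply: (hd (x, y)).
by split; rewrite -ball_normE /= sub0r normrN.
Qed.

Lemma law_le x y : `|x| < r -> `|y| < r ->
  `|crd (pnt x * pnt y)%g - x - y| <= C * (1 + 2 * r) * `|x| * `|y|.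
Proof.
move=> xr yr; case: law => _ _ _ _ /(_ x y xr yr)[_ _ h].
have -> : crd (pnt x * pnt y)%g - x - y =
    (crd (pnt x * pnt y)%g - x - y - b x y) + b x y by rewrite subrK.
apply: le_trans (ler_normD _ _) _.
apply: le_trans (lerD h (b_le x y)) _.
have : C * `|x| * `|y| * (`|x| + `|y|) <= C * `|x| * `|y| * (2 * r).
  by apply: ler_wpM2l; [rewrite !mulr_ge0|lra].
set c := C * `|x| * `|y| => hc.
have -> : C * (1 + 2 * r) * `|x| * `|y| = c + c * (2 * r) by rewrite /c; ring.
lra.
Qed.

(** The product estimate is applied to [pnt p * g = pnt q], which spares an expansion of the
    inverse. For [|p| < 1 / (2 K + 1)] the error is at most half of [|crd g|], hence the two
    comparisons. *)
Lemma quotient_estimate : exists d K, [/\ 0 < d, d <= r, 0 <= K &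
  forall p q, `|p| < d -> `|q| < d -> let g := ((pnt p)^-1 * pnt q)%g in
  [/\ chart_ball r g, `|crd g - (q - p)| <= K * `|p| * `|crd g|,
      `|crd g| <= 2 * `|q - p| & `|q - p| <= 2 * `|crd g|]].
Proof.
have [d /andP[d0 dr] hd] : exists2 d, 0 < d <= r & forall x y, `|x| < d -> `|y| < d ->
    chart_ball r ((pnt x)^-1 * pnt y)%g.
  apply: (near_chart_words (w := fun g h => (g^-1 * h)%g)) => // T F a c FF ha hc.
  have e1 : 1%g = (1^-1 * 1)%g :> G by rewrite invg1 mulg1.
  rewrite [X in _ --> X]e1.
  exact: cvgMg (cvgVg ha) hc.
pose K := C * (1 + 2 * r).
have K0 : 0 <= K by rewrite mulr_ge0 // addr_ge0 // mulr_ge0 // ltW.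
have K1 : 0 < 2 * K + 1 by lra.
exists (Num.min d (2 * K + 1)^-1), K; split=> //.
- by rewrite lt_min d0 invr_gt0.
- by rewrite ge_min dr.
move=> p q; rewrite !lt_min => /andP[pd pK] /andP[qd _] g.
have [Dg gr] := hd p q pd qd.
have E : crd (pnt p * pnt (crd g))%g = q.
  by rewrite crdK // /g mulVKg; have [_] := pnt_dom (lt_le_trans qd dr).
have := law_le (lt_le_trans pd dr) gr; rewrite E -/K => h.
have h1 : `|crd g - (q - p)| <= K * `|p| * `|crd g| by rewrite distrC.
have h2 : K * `|p| * `|crd g| <= 2^-1 * `|crd g|.
  apply: ler_wpM2r => //; have : `|p| * (2 * K + 1) < 1 by rewrite -ltr_pdivlMr // mul1r.
  by have := normr_ge0 p; nra.
have h3 : `|crd g| <= `|crd g - (q - p)| + `|q - p|.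
  by rewrite -[X in `|X| <= _](subrK (q - p) (crd g)); exact: ler_normD.
have h4 : `|q - p| <= `|crd g - (q - p)| + `|crd g|.
  have := ler_normD (q - p - crd g) (crd g).
  by rewrite subrK [`|q - p - _|]distrC.
by have := normr_ge0 (crd g); split=> //; lra.
Qed.

(** [[~ x, y]] is the quotient of [x y] by [y x], whose coordinates differ by the antisymmetrized
    second order term. *)
Lemma commutator_estimate : exists d K, [/\ 0 < d, d <= r, 0 <= K &
  forall x y, `|x| < d -> `|y| < d -> chart_ball r [~ pnt x, pnt y]%g /\
    `|crd [~ pnt x, pnt y]%g - bracket x y| <= K * `|x| * `|y| * (`|x| + `|y|)].
Proof.
have [d [K [d0 dr K0 hq]]] := quotient_estimate.
have [d1 /andP[d10 d1r] hd1] : exists2 d', 0 < d' <= r & forall x y,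
    `|x| < d' -> `|y| < d' -> chart_ball d (pnt x * pnt y)%g.
  apply: (near_chart_words (w := fun g h => (g * h)%g)) => // T F a c FF ha hc.
  have e1 : 1%g = (1 * 1)%g :> G by rewrite mulg1.
  by rewrite [X in _ --> X]e1; exact: cvgMg.
pose K1 := 1 + C * (1 + 2 * r) * r.
have K10 : 0 <= K1.
  by rewrite addr_ge0 // !mulr_ge0 ?addr_ge0 ?mulr_ge0 // ltW.
pose K2 := 2 * C * (1 + 2 * r).
have K20 : 0 <= K2 by rewrite !mulr_ge0 ?addr_ge0 ?mulr_ge0 // ltW.
pose K3 := 2 * C + 4 * C * r.
have K30 : 0 <= K3 by rewrite addr_ge0 // !mulr_ge0 // ltW.
exists (Num.min d1 r), (2 * C + 2 * K * K1 * K3).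
split=> //.
- by rewrite lt_min d10.
- by rewrite ge_min lexx orbT.
- by rewrite addr_ge0 // !mulr_ge0.
move=> x y; rewrite !lt_min => /andP[xd xr] /andP[yd yr].
set v := crd (pnt y * pnt x)%g; set w := crd (pnt x * pnt y)%g.
have [Dv hv] := hd1 y x yd xd; have [Dw hw] := hd1 x y xd yd.
have Ec : [~ pnt x, pnt y]%g = ((pnt v)^-1 * pnt w)%g.
  by rewrite !crdK // /commg /conjg invgM !mulgA.
have [gr g1 g2 _] := hq v w hv hw; rewrite -Ec in gr g1 g2.
split=> //; set c := crd _ in g1 g2 *.
case: law => _ _ _ _ hl.
have [_ _ lw] := hl x y xr yr; have [_ _ lv] := hl y x yr xr.
have nx := normr_ge0 x; have ny := normr_ge0 y.
have wv : `|w - v - bracket x y| <= 2 * C * `|x| * `|y| * (`|x| + `|y|).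
  have -> : w - v - bracket x y = (w - x - y - b x y) - (v - y - x - b y x).
    by apply/rowP => j; rewrite !mxE; ring.
  apply: le_trans (ler_normB _ _) _; apply: le_trans (lerD lw lv) _.
  by rewrite le_eqVlt; apply/orP; left; apply/eqP; ring.
have vle : `|v| <= K1 * (`|x| + `|y|).
  have h := law_le yr xr.
  have -> : v = (v - y - x) + (x + y) by apply/rowP => j; rewrite !mxE; ring.
  apply: le_trans (ler_normD _ _) _.
  apply: le_trans (lerD h (ler_normD _ _)) _.
  have : C * (1 + 2 * r) * `|y| * `|x| <= C * (1 + 2 * r) * r * (`|x| + `|y|).
    rewrite -!mulrA; do 2![apply: ler_wpM2l => //].
      by rewrite addr_ge0 // mulr_ge0 // ltW.
    by apply: ler_pM => //; [exact: ltW|lra].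
  by rewrite /K1 mulrDl mul1r; lra.
have wv2 : `|w - v| <= K3 * `|x| * `|y|.
  rewrite -(subrK (bracket x y) (w - v)); apply: le_trans (ler_normD _ _) _.
  apply: le_trans (lerD wv (bracket_le x y)) _.
  have : 2 * C * `|x| * `|y| * (`|x| + `|y|) <= 2 * C * `|x| * `|y| * (2 * r).
    by apply: ler_wpM2l; [rewrite !mulr_ge0|lra].
  have -> : K3 * `|x| * `|y| = 2 * C * `|x| * `|y| * (2 * r) + 2 * C * `|x| * `|y|.
    by rewrite /K3; ring.
  by lra.
have -> : c - bracket x y = (c - (w - v)) + (w - v - bracket x y).
  by rewrite addrA subrK.
apply: le_trans (ler_normD _ _) _.
have g3 : `|c - (w - v)| <= K * (K1 * (`|x| + `|y|)) * (2 * (K3 * `|x| * `|y|)).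
  apply: le_trans g1 _; apply: ler_pM => //; first by rewrite mulr_ge0.
    by rewrite ler_wpM2l.
  by apply: le_trans g2 _; rewrite ler_wpM2l.
apply: le_trans (lerD g3 wv) _.
by rewrite le_eqVlt; apply/orP; left; apply/eqP; ring.
Qed.

Definition nested (x : 'rV[R]_n) (s : seq 'rV[R]_n) := foldl bracket x s.

(* Evaluating a left-normed group commutator at [t *: x, t *: y1, ...] and letting [t] tend to [0] recovers the nested bracket. *)
Lemma nested_bracket_expansion (p : R -> G) k l (s : seq 'rV[R]_n) K t0 :
  0 < t0 -> 0 <= K -> (0 < k)%N -> (forall t, 0 < t < t0 ->
    cdom (chart1 G) (p t) /\ `|crd (p t) - t ^+ k *: l| <= K * t ^+ k.+1) ->
  exists K' t1, 0 < t1 /\ forall t, 0 < t < t1 ->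
    `|crd (brk (p t) [seq pnt (t *: y) | y <- s]) -
      t ^+ (k + size s) *: nested l s| <= K' * t ^+ (k + size s).+1.
Proof.
elim: s p k l K t0 => [|y s ih] p k l K t0 t00 K0 k0 hp.
  by exists K, t0; split=> // t /hp[_]; rewrite /= addn0.
have [d [D [d0 dr D0 hd]]] := commutator_estimate.
pose A := `|l| + K; have A0 : 0 <= A by rewrite addr_ge0.
have A1 : 0 < A + `|y| + 1 by rewrite ltr_wpDl // addr_ge0.
pose t1 := Num.min (Num.min t0 1) (d / (A + `|y| + 1)).
pose K1 := D * A * `|y| * (A + `|y|) + 2 * C * K * `|y|.
have t10 : 0 < t1 by rewrite !lt_min t00 ltr01 divr_gt0.
have K10 : 0 <= K1 by rewrite addr_ge0 // !mulr_ge0 // addr_ge0.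
have [|K' [t2 [t20 h]]] := ih (fun t => [~ p t, pnt (t *: y)]%g) k.+1
    (bracket l y) K1 t1 t10 K10 isT; last first.
  by exists K', t2; split=> // t /h; rewrite addSnnS.
move=> t /andP[tp]; rewrite !lt_min => /andP[/andP[tt0 tl1] td].
have [Dp hpt] : cdom (chart1 G) (p t) /\ `|crd (p t) - t ^+ k *: l| <= K * t ^+ k.+1.
  by apply: hp; rewrite tp.
have tk0 : 0 <= t ^+ k by rewrite exprn_ge0 // ltW.
have tkS : t ^+ k.+1 <= t ^+ k by rewrite exprS ler_piMl // ltW.
have tk1 : t ^+ k <= t.
  have h1 := exprn_ile1 k.-1 (ltW tp) (ltW tl1).
  by rewrite -(prednK k0) exprS ler_piMr // ltW.
set x := crd (p t) in hpt *.
have xA : `|x| <= A * t ^+ k.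
  rewrite -(subrK (t ^+ k *: l) x); apply: le_trans (ler_normD _ _) _.
  rewrite [X in _ + X]normrZ (ger0_norm tk0) /A mulrDl addrC mulrC lerD2l.
  by apply: le_trans hpt _; rewrite ler_wpM2l.
have tA : t * (A + `|y| + 1) < d by rewrite -ltr_pdivlMr.
have xd : `|x| < d.
  apply: le_lt_trans xA _; apply: le_lt_trans tA.
  apply: (@le_trans _ _ (A * t)); first by rewrite ler_wpM2l.
  by rewrite mulrC ler_wpM2l ?(ltW tp) // -addrA lerDl addr_ge0.
have ny : `|t *: y| = t * `|y| by rewrite normrZ gtr0_norm.
have yd : `|t *: y| < d.
  apply: le_lt_trans tA; rewrite ny ler_wpM2l ?(ltW tp) //.
  by rewrite addrAC lerDr addr_ge0.
have [[Dc _] hc] := hd x (t *: y) xd yd.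
rewrite (crdK Dp) in Dc hc; split=> //.
have -> : crd [~ p t, pnt (t *: y)]%g - t ^+ k.+1 *: bracket l y =
   (crd [~ p t, pnt (t *: y)]%g - bracket x (t *: y)) +
   bracket (x - t ^+ k *: l) (t *: y).
  rewrite -[- (_ *: l)]scaleNr bracketDl bracketZl (bracketZr t l y) scaleNr.
  by rewrite scalerA -exprSr addrA subrK.
apply: le_trans (ler_normD _ _) _; rewrite /K1 mulrDl.
apply: lerD.
  apply: le_trans hc _; rewrite ny.
  apply: (@le_trans _ _ (D * (A * t ^+ k) * (t * `|y|) * (A * t + t * `|y|))).
    apply: ler_pM.
    - by rewrite !mulr_ge0 // ltW.
    - by rewrite addr_ge0 // mulr_ge0 // ltW.
    - by apply: ler_wpM2r; [rewrite mulr_ge0 // ltW|rewrite ler_wpM2l].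
    rewrite lerD2r; apply: le_trans xA _; by rewrite ler_wpM2l.
  by rewrite le_eqVlt; apply/orP; left; apply/eqP; rewrite !exprS; ring.
apply: le_trans (bracket_le _ _) _; rewrite ny.
apply: (@le_trans _ _ (2 * C * (K * t ^+ k.+1) * (t * `|y|))).
  by apply: ler_wpM2r; [rewrite mulr_ge0 // ltW|rewrite ler_wpM2l // mulr_ge0].
by rewrite le_eqVlt; apply/orP; left; apply/eqP; rewrite !exprS; ring.
Qed.

Hypothesis nilG : nilpotent_group G.

(** The group commutator is trivial, so [t ^ (s + 1)] times the nested bracket is of order
    [t ^ (s + 2)] as [t] tends to 0. *)
Lemma nested_bracket_nilpotent : exists s, forall x ys, size ys = s -> nested x ys = 0.
Proof.
have [s hs] := lcs_trivial nilG; exists s => x ys sz.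
have hp t : 0 < t < r / (`|x| + 1) -> cdom (chart1 G) (pnt (t *: x)) /\
    `|crd (pnt (t *: x)) - t ^+ 1 *: x| <= 0 * t ^+ 2.
  move=> /andP[t0 t1]; have [] := @pnt_dom (t *: x).
    rewrite normrZ gtr0_norm //; move: t1; rewrite ltr_pdivlMr ?ltr_wpDl // => t1.
    by apply: le_lt_trans t1; rewrite ler_wpM2l ?(ltW t0) // lerDl.
  by move=> D ->; rewrite expr1 subrr normr0 mul0r.
have t10 : 0 < r / (`|x| + 1) by rewrite divr_gt0 // ltr_wpDl.
have [K [t1 [t1p h]]] := nested_bracket_expansion ys t10 (lexx 0) (isT : (0 < 1)%N) hp.
have h' t : 0 < t < t1 -> `|nested x ys| <= K * t.
  move=> ht; have := h t ht; have /andP[t0 _] := ht.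
  rewrite (hs (brk _ _)); last first.
    have := @lcs_brk G 1 (pnt (t *: x)) [seq pnt (t *: y) | y <- ys] I.
    by rewrite size_map sz add1n.
  rewrite crd1 sub0r normrN normrZ ger0_norm ?exprn_ge0 ?(ltW t0) //.
  by rewrite exprSr mulrCA ler_pM2l // exprn_gt0.
apply/eqP; rewrite -normr_eq0 eq_le normr_ge0 andbT.
apply/ler_addgt0Pr => e e0; rewrite add0r.
pose t := Num.min (t1 / 2) (e / (`|K| + 1)).
have K1 : 0 < `|K| + 1 by rewrite ltr_wpDl.
have t0 : 0 < t by rewrite lt_min !divr_gt0.
have tt1 : t < t1 by rewrite gt_min; apply/orP; left; lra.
apply: le_trans (h' t _) _; first by rewrite t0.
apply: (@le_trans _ _ ((`|K| + 1) * t)).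
  by apply: ler_wpM2r; [exact: ltW|apply: le_trans (ler_norm _) _; rewrite lerDl].
by rewrite -ler_pdivlMl // mulrC /t ge_min lexx orbT.
Qed.

End LocalEstimates.

(** * Primitives of local cocycles *)

Lemma cvg_norm_le (R : realType) (u : nat -> R) l B : u @ \oo --> l ->
  (exists N, forall k, (N <= k)%N -> `|u k| <= B) -> `|l| <= B.
Proof.
move=> ul [N hN]; apply/ler_addgt0Pr => e e0.
have /cvgrPdist_lt /(_ e e0) [M _ hM] := ul.
have h1 := hM (maxn N M) (leq_maxr _ _); have h2 := hN (maxn N M) (leq_maxl _ _).
rewrite -(subrK (u (maxn N M)) l); apply: le_trans (ler_normD _ _) _.
by rewrite addrC lerD // ltW.
Qed.

(** * Sewing an almost additive function of two points *)

Section Sewing.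
Variables (R : realType) (n : nat) (rho C : R) (D : 'rV[R]_n -> 'rV[R]_n -> R).
Implicit Types p q s m : 'rV[R]_n.

Definition defect (D : 'rV[R]_n -> 'rV[R]_n -> R) p q s := D p q + D q s - D p s.

Hypothesis C0 : 0 <= C.
Hypothesis D_defect : forall p q s e, `|p| < rho -> `|q| < rho -> `|s| < rho ->
  `|q - p| <= e -> `|s - q| <= e -> `|s - p| <= e -> `|defect D p q s| <= C * e ^+ 3.

Definition midpoint p q : 'rV[R]_n := 2^-1 *: (p + q).

Let mid_lt p q : `|p| < rho -> `|q| < rho -> `|midpoint p q| < rho.
Proof.
move=> hp hq; rewrite normrZ ger0_norm ?invr_ge0 // ltr_pdivrMl //.
by apply: le_lt_trans (ler_normD _ _) _; lra.
Qed.

Let half_le p (e : R) : `|p| <= e -> `|2^-1 *: p| <= e / 2.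
Proof. by move=> h; rewrite normrZ ger0_norm ?invr_ge0 // mulrC ler_pM2r. Qed.

Fixpoint dyadic k p q : R := if k is k'.+1
  then dyadic k' p (midpoint p q) + dyadic k' (midpoint p q) q else D p q.

(* The defect of a triangle after one subdivision is that of its four midpoint triangles, so it is halved. *)
Lemma dyadic_defect k p q s e : `|p| < rho -> `|q| < rho -> `|s| < rho ->
  `|q - p| <= e -> `|s - q| <= e -> `|s - p| <= e ->
  `|defect (dyadic k) p q s| <= C * e ^+ 3 / 2 ^+ k.
Proof.
elim: k p q s e => [|k ih] p q s e hp hq hs h1 h2 h3.
  by rewrite expr0 divr1; exact: D_defect.
pose m1 := midpoint p q; pose m2 := midpoint q s; pose m3 := midpoint p s.
have e1 (a c x : 'rV[R]_n) : midpoint a c - midpoint a x = 2^-1 *: (c - x).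
  by apply/rowP => j; rewrite !mxE; ring.
have e2 (a c x : 'rV[R]_n) : midpoint a c - midpoint x c = 2^-1 *: (a - x).
  by apply/rowP => j; rewrite !mxE; ring.
have e3 (a c : 'rV[R]_n) : midpoint a c - a = 2^-1 *: (c - a).
  by apply/rowP => j; rewrite !mxE; field.
have e4 (a c : 'rV[R]_n) : c - midpoint a c = 2^-1 *: (c - a).
  by apply/rowP => j; rewrite !mxE; field.
have e5 (a c : 'rV[R]_n) : midpoint c a = midpoint a c by rewrite /midpoint addrC.
have h21 : `|p - q| <= e by rewrite distrC.
have E : defect (dyadic k.+1) p q s = defect (dyadic k) p m1 m3 +
    defect (dyadic k) m3 m2 s + defect (dyadic k) m1 q m2 - defect (dyadic k) m1 m3 m2.
  by rewrite /defect /= -/m1 -/m2 -/m3; ring.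
have b t1 t2 t3 : `|t1| < rho -> `|t2| < rho -> `|t3| < rho ->
    `|t2 - t1| <= e / 2 -> `|t3 - t2| <= e / 2 -> `|t3 - t1| <= e / 2 ->
    `|defect (dyadic k) t1 t2 t3| <= C * (e / 2) ^+ 3 / 2 ^+ k.
  exact: ih.
have hm1 : `|m1| < rho by exact: mid_lt.
have hm2 : `|m2| < rho by exact: mid_lt.
have hm3 : `|m3| < rho by exact: mid_lt.
have b1 : `|defect (dyadic k) p m1 m3| <= C * (e / 2) ^+ 3 / 2 ^+ k.
  by apply: b => //; rewrite ?e3 ?e1; exact: half_le.
have b2 : `|defect (dyadic k) m3 m2 s| <= C * (e / 2) ^+ 3 / 2 ^+ k.
  by apply: b => //; rewrite ?e4 ?e2; exact: half_le.
have b3 : `|defect (dyadic k) m1 q m2| <= C * (e / 2) ^+ 3 / 2 ^+ k.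
  apply: b => //; rewrite ?e4 ?e3; try exact: half_le.
  by rewrite /m1 -(e5 p q) e1; exact: half_le.
have b4 : `|defect (dyadic k) m1 m3 m2| <= C * (e / 2) ^+ 3 / 2 ^+ k.
  apply: b => //; rewrite ?e1 ?e2; try exact: half_le.
  by rewrite /m1 -(e5 p q) e1; exact: half_le.
have -> : C * e ^+ 3 / 2 ^+ k.+1 = 4 * (C * (e / 2) ^+ 3 / 2 ^+ k).
  by rewrite (exprS _ k); field; rewrite expf_neq0.
rewrite E.
apply: le_trans (ler_normB _ _) _; apply: le_trans (lerD (ler_normD _ _) b4) _.
apply: le_trans (lerD (lerD (ler_normD _ _) b3) (lexx _)) _.
by move: b1 b2; set B := C * _ / _; lra.
Qed.

Lemma dyadic_step k p q : `|p| < rho -> `|q| < rho ->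
  `|dyadic k.+1 p q - dyadic k p q| <= C * `|q - p| ^+ 3 / 2 ^+ k.
Proof.
move=> hp hq; have -> : dyadic k.+1 p q - dyadic k p q =
  defect (dyadic k) p (midpoint p q) q by [].
have hm (x : 'rV[R]_n) : `|2^-1 *: x| <= `|x|.
  by apply: le_trans (half_le (lexx _)) _; have := normr_ge0 x; lra.
apply: dyadic_defect => //; first exact: mid_lt.
  by rewrite (_ : midpoint p q - p = 2^-1 *: (q - p)) //; apply/rowP => j; rewrite !mxE; field.
by rewrite (_ : q - midpoint p q = 2^-1 *: (q - p)) //; apply/rowP => j; rewrite !mxE; field.
Qed.

Lemma dyadic_far k j p q : `|p| < rho -> `|q| < rho ->
  `|dyadic (k + j) p q - dyadic k p q| <= 2 * C * `|q - p| ^+ 3 / 2 ^+ k.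
Proof.
move=> hp hq; pose B := C * `|q - p| ^+ 3.
have B0 : 0 <= B by rewrite mulr_ge0 // exprn_ge0.
suff h : `|dyadic (k + j) p q - dyadic k p q| <= (2 - 2 / 2 ^+ j) * B / 2 ^+ k.
  apply: le_trans h _; rewrite -[2 * C * _]mulrA -/B.
  apply: ler_wpM2r; first by rewrite invr_ge0 exprn_ge0.
  by apply: ler_wpM2r => //; rewrite gerBl divr_ge0 // exprn_ge0.
elim: j => [|j ih]; first by rewrite addn0 subrr normr0 expr0 divr1 subrr !mul0r.
rewrite -(subrK (dyadic (k + j) p q) (dyadic _ p q)) -addrA addnS.
apply: le_trans (ler_normD _ _) _; have := dyadic_step (k + j) hp hq.
rewrite -/B exprD => h; apply: le_trans (lerD h ih) _.
rewrite le_eqVlt; apply/orP; left; apply/eqP; rewrite exprS; field.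
by rewrite !expf_neq0.
Qed.

(** This plays the part of the integral of a closed 1-form along the segment from [p] to [q], of
    which [D] is an approximation on short segments. *)
Definition sewn p q : R := lim (dyadic k p q @[k --> \oo]).

Lemma half_pow_small (B e : R) : 0 < e -> exists k, B / 2 ^+ k < e.
Proof.
move=> e0; have B1 : 0 < `|B| + 1 by rewrite ltr_wpDl.
have d0 : 0 < e / (`|B| + 1) by rewrite divr_gt0.
have [k hk] : exists k, geometric 1 2^-1 k < e / (`|B| + 1).
  have h2 : `|2^-1 : R| < 1 by rewrite ger0_norm ?invr_ge0 // invf_lt1 // ltr1n.
  have /cvgrPdist_lt /(_ _ d0) := cvg_geometric 1 h2.
  move=> [N _ h]; exists N; have := h N (leqnn _).
  by rewrite /= sub0r normrN ger0_norm // /geometric /= mul1r exprn_ge0 // invr_ge0.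
exists k; rewrite /geometric /= mul1r exprVn ltr_pdivlMr // mulrC in hk.
apply: le_lt_trans hk; rewrite ler_pM2r ?invr_gt0 ?exprn_gt0 //.
by apply: le_trans (ler_norm _) _; rewrite lerDl.
Qed.

Lemma dyadic_cvg p q : `|p| < rho -> `|q| < rho ->
  dyadic k p q @[k --> \oo] --> sewn p q.
Proof.
move=> hp hq; apply: cauchy_cvg; apply: cauchy_exP => e e0.
have [k hk] := half_pow_small (2 * C * `|q - p| ^+ 3) e0.
exists (dyadic k p q); exists k => // j /= kj.
rewrite /= -ball_normE /= distrC -(subnKC kj).
by apply: le_lt_trans hk; exact: dyadic_far.
Qed.

Lemma sewn_near p q : `|p| < rho -> `|q| < rho ->
  `|sewn p q - D p q| <= 2 * C * `|q - p| ^+ 3.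
Proof.
move=> hp hq; have c : (dyadic k p q - D p q) @[k --> \oo] --> sewn p q - D p q.
  by apply: cvgB; [exact: dyadic_cvg|exact: cvg_cst].
apply: (cvg_norm_le c); exists 0%N => k _.
by have := dyadic_far 0 k hp hq; rewrite add0n expr0 divr1.
Qed.

Lemma sewn_add p q s : `|p| < rho -> `|q| < rho -> `|s| < rho ->
  sewn p q + sewn q s = sewn p s.
Proof.
move=> hp hq hs; apply/eqP; rewrite -subr_eq0 -normr_eq0 eq_le normr_ge0 andbT.
apply/ler_addgt0Pr => e e0; rewrite add0r.
have c : defect (dyadic k) p q s @[k --> \oo] --> sewn p q + sewn q s - sewn p s.
  by apply: cvgB; [apply: cvgD|]; exact: dyadic_cvg.
apply: (cvg_norm_le c).
pose m := `|q - p| + `|s - q| + `|s - p|.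
have [k hk] := half_pow_small (C * m ^+ 3) e0.
exists k => // j /= kj.
have n1 := normr_ge0 (q - p); have n2 := normr_ge0 (s - q); have n3 := normr_ge0 (s - p).
apply: le_trans (_ : C * m ^+ 3 / 2 ^+ j <= _).
  by apply: dyadic_defect => //; rewrite /m; lra.
apply: le_trans (ltW hk); apply: ler_wpM2l.
  by rewrite mulr_ge0 // exprn_ge0 // /m; lra.
by rewrite lef_pV2 ?posrE ?exprn_gt0 // ler_weXn2l // ler1n.
Qed.

End Sewing.

(** Halving a segment gives two halves, each with an eighth of the cubic bound, so the bound
    improves by a factor 4 each time. *)
Lemma cubic_cocycle_eq0 (R : realType) n (rho C : R) (e : 'rV[R]_n -> 'rV[R]_n -> R) p q :
  (forall p q, `|p| < rho -> `|q| < rho -> `|e p q| <= C * `|q - p| ^+ 3) ->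
  (forall p q s, `|p| < rho -> `|q| < rho -> `|s| < rho -> e p q + e q s = e p s) ->
  `|p| < rho -> `|q| < rho -> e p q = 0.
Proof.
move=> he ha.
suff h k : forall p q, `|p| < rho -> `|q| < rho ->
    `|e p q| <= `|C| * `|q - p| ^+ 3 / 4 ^+ k.
  move=> hp hq; apply/eqP; rewrite -normr_eq0 eq_le normr_ge0 andbT.
  apply/ler_addgt0Pr => d d0; rewrite add0r.
  have [k hk] := half_pow_small (`|C| * `|q - p| ^+ 3) d0.
  apply: le_trans (h k p q hp hq) _; apply: le_trans (ltW hk).
  apply: ler_wpM2l; first by rewrite mulr_ge0 // exprn_ge0.
  by rewrite lef_pV2 ?posrE ?exprn_gt0 // lerXn2r ?nnegrE // ler_nat.
elim: k => [|k ih] {}p {}q hp hq.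
  rewrite expr0 divr1; apply: le_trans (he _ _ hp hq) _.
  by rewrite ler_wpM2r ?exprn_ge0 // ler_norm.
have hm : `|midpoint p q| < rho.
  rewrite normrZ ger0_norm ?invr_ge0 // ltr_pdivrMl //.
  by apply: le_lt_trans (ler_normD _ _) _; lra.
rewrite -(ha _ _ _ hp hm hq); apply: le_trans (ler_normD _ _) _.
apply: le_trans (lerD (ih _ _ hp hm) (ih _ _ hm hq)) _.
have -> : midpoint p q - p = 2^-1 *: (q - p) by apply/rowP => j; rewrite !mxE; field.
have -> : q - midpoint p q = 2^-1 *: (q - p) by apply/rowP => j; rewrite !mxE; field.
rewrite normrZ ger0_norm ?invr_ge0 //.
rewrite le_eqVlt; apply/orP; left; apply/eqP; rewrite (exprS _ k); field.
by rewrite expf_neq0.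
Qed.

Section LocalPrimitive.
Variables (R : realType) (n : nat) (G : lieGroupType R n).
Variables (r C : R) (b : 'rV[R]_n -> 'rV[R]_n -> 'rV[R]_n).
Hypothesis law : @local_law R n G r C b.
Variable beta : G -> G -> R.
Hypothesis betaMl : forall g h x, beta (g * h)%g x = beta g x + beta h x.
Hypothesis betaMr : forall g x y, beta g (x * y)%g = beta g x + beta g y.
Variables (delta : 'rV[R]_n -> R) (eps K : R).
Hypothesis eps0 : 0 < eps.
Hypothesis K0 : 0 <= K.
Local Notation pnt := (@pnt R n G).
Local Notation crd := (@crd R n G).
Hypothesis delta_law : forall x y, `|x| < eps -> `|y| < eps ->
  `|delta (crd (pnt x * pnt y)%g) - delta x - delta y - beta (pnt x) (pnt y)| <=
    K * (`|x| + `|y|) ^+ 3.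

Let beta1l x : beta 1%g x = 0.
Proof. by apply: (addrI (beta 1%g x)); rewrite -betaMl mulg1 addr0. Qed.

Let r0 : 0 < r. Proof. by case: law. Qed.

(** The increment from [p] to [q] of a function with the required law, where [delta] approximates
    that function near the identity. *)
Let D p q := delta (crd ((pnt p)^-1 * pnt q)%g) + beta (pnt p) ((pnt p)^-1 * pnt q)%g.

Lemma local_primitive : exists rho K' (psi : G -> R), [/\ 0 < rho, 0 <= K',
  forall g h, chart_ball rho g -> chart_ball rho h ->
    psi (g * h)%g = psi g + psi h + beta g h &
  forall x, `|x| < rho -> `|psi (pnt x) - delta x| <= K' * `|x| ^+ 3].
Proof.
have [d [K1 [d0 dr K10 hq]]] := quotient_estimate law.
pose rho := Num.min d (eps / 4).
have rho0 : 0 < rho by rewrite lt_min d0 divr_gt0.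
have rd (p : 'rV[R]_n) : `|p| < rho -> `|p| < d by rewrite lt_min => /andP[].
have re (p : 'rV[R]_n) : `|p| < rho -> 4 * `|p| < eps by rewrite lt_min ltr_pdivlMr // mulrC => /andP[].
have quot p q s : ((pnt p)^-1 * pnt q * ((pnt q)^-1 * pnt s) = (pnt p)^-1 * pnt s)%g.
  by rewrite mulgA mulgK.
have ck p q : `|p| < rho -> `|q| < rho ->
    pnt (crd ((pnt p)^-1 * pnt q)%g) = ((pnt p)^-1 * pnt q)%g.
  by move=> /rd hp /rd hq'; have [/chart_ballK] := hq p q hp hq'.
(* Both quotients have coordinates of size at most [2 e], and 64 is the cube of 4. *)
have Ddef p q s e : `|p| < rho -> `|q| < rho -> `|s| < rho ->
    `|q - p| <= e -> `|s - q| <= e -> `|s - p| <= e ->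
    `|defect D p q s| <= (64 * K) * e ^+ 3.
  move=> hp hq' hs h1 h2 h3; pose u := crd ((pnt p)^-1 * pnt q)%g.
  pose v := crd ((pnt q)^-1 * pnt s)%g.
  have [_ _ u2 _] := hq p q (rd _ hp) (rd _ hq').
  have [_ _ v2 _] := hq q s (rd _ hq') (rd _ hs).
  have un : `|u| < eps.
    apply: le_lt_trans u2 _; have := ler_normB q p; have := re _ hp; have := re _ hq'; lra.
  have vn : `|v| < eps.
    apply: le_lt_trans v2 _; have := ler_normB s q; have := re _ hs; have := re _ hq'; lra.
  have := delta_law un vn; rewrite /u /v !ck // quot -/u -/v => h.
  have -> : defect D p q s = - (delta (crd ((pnt p)^-1 * pnt s)%g) - delta u - delta v -
      beta ((pnt p)^-1 * pnt q)%g ((pnt q)^-1 * pnt s)%g).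
    have hb : beta (pnt p) ((pnt p)^-1 * pnt s)%g = beta (pnt p) ((pnt p)^-1 * pnt q)%g +
        beta (pnt p) ((pnt q)^-1 * pnt s)%g by rewrite -betaMr quot.
    have hb2 : beta (pnt q) ((pnt q)^-1 * pnt s)%g = beta (pnt p) ((pnt q)^-1 * pnt s)%g +
        beta ((pnt p)^-1 * pnt q)%g ((pnt q)^-1 * pnt s)%g by rewrite -betaMl mulVKg.
    by rewrite /defect /D hb hb2 /u /v; ring.
  rewrite normrN; apply: le_trans h _.
  have -> : 64 * K * e ^+ 3 = K * (4 * e) ^+ 3 by ring.
  apply: ler_wpM2l => //; apply: lerXn2r; rewrite ?nnegrE ?addr_ge0 //.
    by apply: mulr_ge0 => //; apply: le_trans h1; exact: normr_ge0.
  by move: u2 v2; rewrite -/u -/v; lra.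
have K640 : 0 <= 64 * K by rewrite mulr_ge0.
have D0 x : `|x| < rho -> D 0 x = delta x.
  move=> xr; rewrite /D pnt0 invg1 mul1g beta1l addr0.
  by have [_ ->] := pnt_dom law (lt_le_trans (rd _ xr) dr).
have n0 : `|0 : 'rV[R]_n| < rho by rewrite normr0.
pose S := sewn D.
have Snear p q : `|p| < rho -> `|q| < rho -> `|S p q - D p q| <= 2 * (64 * K) * `|q - p| ^+ 3.
  exact: (sewn_near K640 Ddef).
have Sadd p q s : `|p| < rho -> `|q| < rho -> `|s| < rho -> S p q + S q s = S p s.
  exact: (sewn_add K640 Ddef).
have [rho' /andP[rho'0 rho'r] hrho'] : exists2 d', 0 < d' <= r & forall x y,
    `|x| < d' -> `|y| < d' -> chart_ball rho (pnt x * pnt y)%g.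
  apply: (near_chart_words law (w := fun g h => (g * h)%g)) => // T F a c FF ha hc.
  have e1 : 1%g = (1 * 1)%g :> G by rewrite mulg1.
  by rewrite [X in _ --> X]e1; exact: cvgMg.
pose tau := Num.min rho rho'.
have tau0 : 0 < tau by rewrite lt_min rho0.
have tr (x : 'rV[R]_n) : `|x| < tau -> `|x| < rho /\ `|x| < rho' by rewrite lt_min => /andP[].
have main (a x : 'rV[R]_n) : `|a| < tau -> `|x| < tau ->
    S 0 (crd (pnt a * pnt x)%g) = S 0 a + S 0 x + beta (pnt a) (pnt x).
  move=> /tr[ar ar'] /[dup] xt /tr[xr xr'].
  pose m p := crd (pnt a * pnt p)%g.
  have mP p : `|p| < tau -> `|m p| < rho /\ pnt (m p) = (pnt a * pnt p)%g.
    by move=> /tr[_ pr']; have [Dm mr] := hrho' a p ar' pr'; split=> //; exact: crdK.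
  have mq p q : `|p| < tau -> `|q| < tau ->
      ((pnt (m p))^-1 * pnt (m q) = (pnt p)^-1 * pnt q)%g.
    by move=> /mP[_ ->] /mP[_ ->]; rewrite invgM mulgA mulgVK.
  (* Compares the increment between the translates of [p] and [q] by [pnt a] with the one that the
     law predicts from [S p q]. *)
  pose e p q := S (m p) (m q) - beta (pnt a) ((pnt p)^-1 * pnt q)%g - S p q.
  have he p q : `|p| < tau -> `|q| < tau -> `|e p q| <= 130 * (64 * K) * `|q - p| ^+ 3.
    move=> pt qt; have [pr _] := tr _ pt; have [qr _] := tr _ qt.
    have [mp Emp] := mP _ pt; have [mqr Emq] := mP _ qt.
    have DE : D (m p) (m q) = D p q + beta (pnt a) ((pnt p)^-1 * pnt q)%g.
      by rewrite /D mq // Emp betaMl; ring.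
    have -> : e p q = (S (m p) (m q) - D (m p) (m q)) - (S p q - D p q).
      by rewrite /e DE; ring.
    apply: le_trans (ler_normB _ _) _.
    have h1 := Snear _ _ pr qr; have h2 := Snear _ _ mp mqr.
    have [_ _ _ l1] := hq (m p) (m q) (rd _ mp) (rd _ mqr).
    have [_ _ l2 _] := hq p q (rd _ pr) (rd _ qr).
    rewrite mq // in l1.
    have l3 : `|m q - m p| <= 4 * `|q - p| by lra.
    have l4 : `|m q - m p| ^+ 3 <= 64 * `|q - p| ^+ 3.
      have -> : 64 * `|q - p| ^+ 3 = (4 * `|q - p|) ^+ 3 by ring.
      by apply: lerXn2r; rewrite ?nnegrE ?mulr_ge0.
    have l5 : 2 * (64 * K) * `|m q - m p| ^+ 3 <= 2 * (64 * K) * (64 * `|q - p| ^+ 3).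
      by apply: ler_wpM2l => //; rewrite mulr_ge0.
    apply: le_trans (lerD (le_trans h2 l5) h1) _.
    by rewrite le_eqVlt; apply/orP; left; apply/eqP; ring.
  have ha p q s : `|p| < tau -> `|q| < tau -> `|s| < tau -> e p q + e q s = e p s.
    move=> pt qt st; have [pr _] := tr _ pt; have [qr _] := tr _ qt.
    have [sr _] := tr _ st; have [mp _] := mP _ pt; have [mqr _] := mP _ qt.
    have [ms _] := mP _ st; rewrite /e -(Sadd _ _ _ pr qr sr) -(Sadd _ _ _ mp mqr ms).
    have hb : beta (pnt a) ((pnt p)^-1 * pnt s)%g = beta (pnt a) ((pnt p)^-1 * pnt q)%g +
        beta (pnt a) ((pnt q)^-1 * pnt s)%g by rewrite -betaMr quot.
    by rewrite hb; ring.
  have t0 : `|0 : 'rV[R]_n| < tau by rewrite normr0.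
  have := cubic_cocycle_eq0 he ha t0 xt.
  have m0 : m 0 = a.
    by rewrite /m pnt0 mulg1; have [_ ->] := pnt_dom law (lt_le_trans (rd _ ar) dr).
  rewrite /e m0 pnt0 invg1 mul1g => /eqP; rewrite subr_eq0 => /eqP Ex.
  have [mx _] := mP _ xt; rewrite -(Sadd _ _ _ n0 ar mx) -Ex.
  by rewrite -addrA subrK.
exists tau, (2 * (64 * K)), (fun g => S 0 (crd g)); split=> //.
- by rewrite mulr_ge0.
- by move=> g h [Dg gt] [Dh ht]; have := main _ _ gt ht; rewrite !crdK.
move=> x /tr[xr _]; have := Snear _ _ n0 xr; rewrite D0 // subr0.
by have [_ ->] := pnt_dom law (lt_le_trans (rd _ xr) dr).
Qed.

End LocalPrimitive.

Section FinePaths.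
Variables (R : realType) (n : nat) (G : lieGroupType R n).

(** Closeness in [G] is measured by left quotients and neighbourhoods of the identity, so no metric
    on [G] is involved. *)
Lemma uniform_continuity_group (T : pseudoMetricType R) (A : set T) (f : T -> G) (V : set G) :
  compact A -> {within A, continuous f} -> nbhs (1%g : G) V ->
  exists2 d : R, 0 < d & forall x y, A x -> A y -> ball x d y -> V ((f x)^-1 * f y)%g.
Proof.
move=> cA /subspace_continuousP cf nV.
have near_t t : A t -> exists2 e : R, 0 < e & forall x y, A x -> A y ->
    ball t e x -> ball t e y -> V ((f x)^-1 * f y)%g.
  move=> At; have ct := cf t At.
  pose F := within A (nbhs t).
  have c1 : (fun z : T * T => f z.1) @ filter_prod F F --> f t.
    by apply: cvg_comp ct; exact: cvg_fst.
  have c2 : (fun z : T * T => f z.2) @ filter_prod F F --> f t.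
    by apply: cvg_comp ct; exact: cvg_snd.
  have := cvgMg (cvgVg c1) c2; rewrite mulVg => /(_ _ _ _ nV) [[P Q] /= [hP hQ] PQ].
  move: hP => /nbhs_ballP[e1 /= e10 h1]; move: hQ => /nbhs_ballP[e2 /= e20 h2].
  exists (Num.min e1 e2); first by rewrite lt_min e10.
  move=> x y Ax Ay bx bz; apply: (PQ (x, y)); split => /=.
    by apply: h1 => //; apply: le_ball bx; rewrite ge_min lexx.
  by apply: h2 => //; apply: le_ball bz; rewrite ge_min lexx orbT.
have := cA; rewrite compact_near_coveringP => nc.
have := nc R (0^'+) (fun d x => forall y, A x -> A y -> ball x d y -> V ((f x)^-1 * f y)%g) _ _.
case.
  move=> t At; have [e e0 he] := near_t t At.
  near=> x d => y Ax Ay bxy; apply: he => //.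
    apply: (@le_ball _ _ _ (e / 2)); first by lra.
    by near: x; apply: nbhsx_ballx; rewrite divr_gt0.
  apply: (@ball_split _ _ x); first by near: x; apply: nbhsx_ballx; rewrite divr_gt0.
  have dle : d <= e / 2 by near: d; apply: nbhs_right_le; rewrite divr_gt0.
  exact: (le_ball dle bxy).
move=> d /= d0 hd; exists (d / 2); first by rewrite divr_gt0.
move=> x y Ax Ay; apply: (hd (d / 2)) => //=; last by rewrite divr_gt0.
rewrite sub0r normrN gtr0_norm ?divr_gt0 //; move: (d0 : 0 < d); lra.
Unshelve. all: by end_near. Qed.

Variable V : set G.
Implicit Types (f : R -> G) (p q : G) (s t : R) (N M : nat).

Definition fine_path N f := (0 < N)%N /\ forall s t, s \in `[0, 1] -> t \in `[0, 1] ->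
  `|s - t| <= N%:R^-1 -> V ((f s)^-1 * f t)%g.

Lemma fine_refine f N M : fine_path N f -> (0 < M)%N -> fine_path (N * M) f.
Proof.
move=> [N0 hf] M0; split=> [|s t Is It h]; first by rewrite muln_gt0 N0.
apply: hf => //; apply: le_trans h _.
by rewrite lef_pV2 ?posrE ?ltr0n ?muln_gt0 ?N0 // ler_nat leq_pmulr.
Qed.

Lemma ex_fine f : nbhs (1%g : G) V -> {within `[0, 1], continuous f} -> exists N, fine_path N f.
Proof.
move=> nV cf; have [d d0 hd] := @uniform_continuity_group R `[0, 1] f V (@segment_compact R 0 1) cf nV.
have [N hN] : exists N, N.+1%:R^-1 < d.
  exists (Num.truncn d^-1); rewrite invf_plt ?posrE //.
  exact: truncnS_gt.
exists N.+1; split=> // s t Is It h; apply: hd => //.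
by rewrite /= /ball_ /=; apply: le_lt_trans hN.
Qed.

(** A path from 1 to [q], cut finely enough, writes [q] as a product of elements of [V]. *)
Lemma group_ind_nbhs (P : G -> Prop) : path_connected R G -> nbhs (1%g : G) V -> P 1%g ->
  (forall p u, P p -> V u -> P (p * u)%g) -> forall q, P q.
Proof.
move=> pc nV P1 PM q; have [f [cf f0 f1]] := pc 1%g q.
have [N [N0 hf]] := ex_fine nV cf.
have I k : (k <= N)%N -> (k%:R / N%:R : R) \in `[0, 1].
  by move=> h; rewrite in_itv /= divr_ge0 //= ler_pdivrMr ?ltr0n // mul1r ler_nat.
suff h k : (k <= N)%N -> P (f (k%:R / N%:R)).
  by have := h N (leqnn _); rewrite divff ?f1 // pnatr_eq0 -lt0n.
elim: k => [|k ih] kN; first by rewrite mul0r f0.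
rewrite -(mulVKg (f (k%:R / N%:R)) (f _)); apply: PM; first by apply: ih; exact: ltnW.
apply: hf; [by apply: I; exact: ltnW|exact: I|].
rewrite -mulrBl -natr1 opprD addrA subrr sub0r mulN1r normrN.
by rewrite ger0_norm // invr_ge0.
Qed.

Lemma within_mulg (T : topologicalType) (A : set T) (f g : T -> G) :
  {within A, continuous f} -> {within A, continuous g} ->
  {within A, continuous (fun x => f x * g x)%g}.
Proof.
move=> /subspace_continuousP cf /subspace_continuousP cg.
apply/subspace_continuousP => t At; exact: cvgMg (cf t At) (cg t At).
Qed.

Lemma within_invg (T : topologicalType) (A : set T) (f : T -> G) :
  {within A, continuous f} -> {within A, continuous (fun x => (f x)^-1)%g}.
Proof.
move=> /subspace_continuousP cf.
apply/subspace_continuousP => t At; exact: cvgVg (cf t At).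
Qed.

End FinePaths.

(** * Extension of a local primitive along paths *)

Section Monodromy.
Variables (R : realType) (n : nat) (G : lieGroupType R n).
Variables (beta : G -> G -> R) (psi : G -> R) (V : set G).
Hypothesis betaMl : forall g h x, beta (g * h)%g x = beta g x + beta h x.
Hypothesis betaMr : forall g x y, beta g (x * y)%g = beta g x + beta g y.
Hypothesis nV : nbhs (1%g : G) V.
Hypothesis psiM : forall g h, V g -> V h -> psi (g * h)%g = psi g + psi h + beta g h.
Hypothesis sc : simply_connected R G.
Implicit Types (f : R -> G) (p q : G) (s t : R) (N M : nat).

Local Notation fine_path := (fine_path V).

Let beta1l x : beta 1%g x = 0.
Proof. by apply: (addrI (beta 1%g x)); rewrite -betaMl mulg1 addr0. Qed.

Let V1 : V 1%g. Proof. exact: nbhs_singleton. Qed.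

Let psi1 : psi 1%g = 0.
Proof.
by apply: (addrI (psi 1%g)); have := psiM V1 V1; rewrite mulg1 beta1l !addr0 => <-.
Qed.

(** The increment from [p] to [q] forced by the law of the primitive; it is exactly additive across
    nearby points. *)
Definition step_sum p q := psi (p^-1 * q)%g + beta p (p^-1 * q)%g.

Lemma step_sum1 p : step_sum p p = 0.
Proof.
rewrite /step_sum mulVg psi1 add0r.
by apply: (addrI (beta p 1%g)); rewrite -betaMr mulg1 addr0.
Qed.

Lemma step_sumD p q q' : V (p^-1 * q)%g -> V (q^-1 * q')%g ->
  step_sum p q + step_sum q q' = step_sum p q'.
Proof.
move=> h1 h2; rewrite /step_sum.
have E : (p^-1 * q' = (p^-1 * q) * (q^-1 * q'))%g by rewrite mulgA mulgK.
have hb : beta p (p^-1 * q')%g = beta p (p^-1 * q)%g + beta p (q^-1 * q')%g.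
  by rewrite -betaMr -E.
have hb2 : beta q (q^-1 * q')%g = beta p (q^-1 * q')%g + beta (p^-1 * q)%g (q^-1 * q')%g.
  by rewrite -betaMl mulVKg.
have hp : psi (p^-1 * q')%g = psi (p^-1 * q)%g + psi (q^-1 * q')%g +
    beta (p^-1 * q)%g (q^-1 * q')%g by rewrite E psiM.
by rewrite hb hb2 hp; ring.
Qed.

Lemma step_sum_square p q p' q' : V (p^-1 * q)%g -> V (q^-1 * q')%g ->
  V (p^-1 * p')%g -> V (p'^-1 * q')%g ->
  step_sum p' q' - step_sum p q = step_sum q q' - step_sum p p'.
Proof.
move=> h1 h2 h3 h4; have := step_sumD h1 h2; have := step_sumD h3 h4; lra.
Qed.

Definition path_sum N f :=
  \sum_(0 <= i < N) step_sum (f (i%:R / N%:R)) (f (i.+1%:R / N%:R)).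

Lemma telescope_steps f N M a : fine_path N f -> (0 < M)%N -> (a.+1 <= N)%N ->
  \sum_(a * M <= k < a.+1 * M) step_sum (f (k%:R / (N * M)%:R)) (f (k.+1%:R / (N * M)%:R)) =
  step_sum (f (a%:R / N%:R)) (f (a.+1%:R / N%:R)).
Proof.
move=> [N0 hf] M0 aN; pose g k := f (k%:R / (N * M)%:R).
have NM0 : 0 < (N * M)%:R :> R by rewrite ltr0n muln_gt0 N0.
have I k : (k <= N * M)%N -> (k%:R / (N * M)%:R : R) \in `[0, 1].
  move=> h; rewrite in_itv /= divr_ge0 //= ler_pdivrMr // mul1r ler_nat //.
have hV i j : (i <= j)%N -> (j <= i + M)%N -> (j <= N * M)%N -> V ((g i)^-1 * g j)%g.
  move=> ij jM jN; apply: hf; try apply: I => //; first exact: leq_trans ij _.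
  rewrite -mulrBl normrM distrC.
  rewrite [X in _ * X]ger0_norm ?invr_ge0 ?ler0n // ler_pdivrMr // natrM mulrA mulVf ?mul1r.
    by rewrite ger0_norm ?subr_ge0 ?ler_nat // lerBlDl -natrD ler_nat.
  by rewrite pnatr_eq0 -lt0n.
have aM : (a.+1 * M <= N * M)%N by rewrite leq_mul2r aN orbT.
have S m : (m <= M)%N -> \sum_(a * M <= k < a * M + m) step_sum (g k) (g k.+1) =
    step_sum (g (a * M)%N) (g (a * M + m)%N).
  elim: m => [|m ih] hm; first by rewrite addn0 big_geq // step_sum1.
  rewrite addnS big_nat_recr ?leq_addr //= ih ?(ltnW hm) //.
  have hb : (a * M + m.+1 <= N * M)%N.
    by apply: leq_trans aM; rewrite mulSn addnC leq_add2r.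
  rewrite step_sumD //.
    by apply: hV; [exact: leq_addr|rewrite leq_add2l ltnW|rewrite (leq_trans _ hb) // addnS].
  by apply: hV => //; [rewrite -addn1 leq_add2l|rewrite -addnS].
have := S M (leqnn _); rewrite -/(g _) addnC -mulSn => ->.
have E k : g (k * M)%N = f (k%:R / N%:R).
  by rewrite /g !natrM -mulf_div divff ?mulr1 // pnatr_eq0 -lt0n.
by rewrite !E.
Qed.

Lemma path_sum_refine f N M : fine_path N f -> (0 < M)%N ->
  path_sum (N * M) f = path_sum N f.
Proof.
move=> hf M0; rewrite /path_sum.
suff h i : (i <= N)%N -> \sum_(0 <= k < i * M)
    step_sum (f (k%:R / (N * M)%:R)) (f (k.+1%:R / (N * M)%:R)) =
    \sum_(0 <= j < i) step_sum (f (j%:R / N%:R)) (f (j.+1%:R / N%:R)) by exact: h.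
elim: i => [|i ih] iN; first by rewrite mul0n !big_geq.
rewrite big_nat_recr //= -ih ?(ltnW iN) //.
rewrite -(telescope_steps hf M0 iN) -big_cat_nat //=.
by rewrite mulSn leq_addl.
Qed.

(* The two paths [f] and [f'] run along the sides of a ladder of small squares. *)
Lemma path_sum_ladder f f' N : fine_path N f -> fine_path N f' ->
  (forall t, t \in `[0, 1] -> V ((f t)^-1 * f' t)%g) ->
  path_sum N f' - path_sum N f = step_sum (f 1) (f' 1) - step_sum (f 0) (f' 0).
Proof.
move=> [N0 hf] [_ hf'] hff.
have N00 : 0 < N%:R :> R by rewrite ltr0n.
have I k : (k <= N)%N -> (k%:R / N%:R : R) \in `[0, 1].
  move=> h; rewrite in_itv /= divr_ge0 //= ler_pdivrMr // mul1r ler_nat //.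
rewrite /path_sum -sumrB.
pose T i := step_sum (f (i%:R / N%:R)) (f' (i%:R / N%:R)).
rewrite (eq_big_nat _ _ (F2 := fun i => T i.+1 - T i)).
  rewrite telescope_sumr // /T mul0r divff //.
  by rewrite pnatr_eq0 -lt0n.
move=> i /andP[_ iN]; rewrite /T.
have d : `|i%:R / N%:R - i.+1%:R / N%:R| <= N%:R^-1 :> R.
  by rewrite -mulrBl -natr1 opprD addrA subrr sub0r mulN1r normrN gtr0_norm ?invr_gt0.
apply: step_sum_square.
- by apply: hf => //; apply: I => //; exact: ltnW.
- by apply: hff; exact: I.
- by apply: hff; apply: I; exact: ltnW.
- by apply: hf' => //; apply: I => //; exact: ltnW.
Qed.

Lemma eq_path_sum N f f' : (0 < N)%N -> (forall t, t \in `[0, 1] -> f t = f' t) ->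
  path_sum N f = path_sum N f'.
Proof.
move=> N0 ff'; apply: eq_big_nat => i /andP[_ iN].
have I k : (k <= N)%N -> (k%:R / N%:R : R) \in `[0, 1].
  by move=> h; rewrite in_itv /= divr_ge0 //= ler_pdivrMr ?ltr0n // mul1r ler_nat.
by rewrite !ff' //; apply: I => //; exact: ltnW.
Qed.

(* If [H] contracts the loop [a b^-1], then [H (s, t) * b t] is a homotopy from [a] to [b]. *)
Lemma path_sum_independent (a b : R -> G) N :
  {within `[0, 1], continuous a} -> {within `[0, 1], continuous b} ->
  a 0 = 1%g -> b 0 = 1%g -> a 1 = b 1 -> fine_path N a -> fine_path N b ->
  path_sum N a = path_sum N b.
Proof.
move=> ca cb a0 b0 ab fa fb; have [N0 _] := fa.
have zI : (0 : R) \in `[0, 1] by rewrite in_itv /= lexx ler01.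
have oI : (1 : R) \in `[0, 1] by rewrite in_itv /= lexx ler01.
pose c t := (a t * (b t)^-1)%g.
have [_ /(_ c)] := sc; case.
- exact: within_mulg ca (within_invg cb).
- by rewrite /c a0 b0 ab !mulgV.
move=> H [cH H0 H1 Hs]; have c0 : c 0 = 1%g by rewrite /c a0 b0 mulgV.
pose K (z : R * R) := (H z * b z.2)%g.
have cK : {within `[0, 1] `*` `[0, 1], continuous K}.
  apply: within_mulg => //; apply/subspace_continuousP => -[s t] [Is It].
  have cbt : b @ within `[0, 1] (nbhs t) --> b t by move/subspace_continuousP : cb; apply.
  apply: (@cvg_comp _ _ _ snd b _ (within `[0, 1] (nbhs t))) cbt.
  move=> P hP; have hs : nbhs ((s, t) : R * R) [set z : R * R | `[0, 1]%classic z.2 -> P z.2].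
    exact: (@cvg_snd _ _ (nbhs s) (nbhs t) _ _ hP).
  by apply: (filterS _ hs) => z hz [_ /hz].
have cI2 : compact (`[0, 1] `*` `[0, 1] : set (R * R)).
  by apply: compact_setX; exact: segment_compact.
have [d d0 hd] := uniform_continuity_group cI2 cK nV.
have [m hm] : exists m, m.+1%:R^-1 < d.
  exists (Num.truncn d^-1); rewrite invf_plt ?posrE //.
  exact: truncnS_gt.
pose M := (N * m.+1)%N.
have M0 : (0 < M)%N by rewrite muln_gt0 N0.
have Md : M%:R^-1 < d.
  apply: le_lt_trans hm; rewrite lef_pV2 ?posrE ?ltr0n // ler_nat /M.
  exact: leq_pmull.
have I k : (k <= M)%N -> (k%:R / M%:R : R) \in `[0, 1].
  by move=> h; rewrite in_itv /= divr_ge0 //= ler_pdivrMr ?ltr0n // mul1r ler_nat.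
have fK s : s \in `[0, 1] -> fine_path M (fun t => K (s, t)).
  move=> Is; split=> // t t' It It' h; apply: hd => //; split => /=.
    exact: ballxx.
  by rewrite /ball /= /ball_ /=; exact: le_lt_trans Md.
have row k : (k <= M)%N -> path_sum M (fun t => K (k%:R / M%:R, t)) = path_sum M (fun t => K (0, t)).
  elim: k => [|k ih] kM; first by rewrite mul0r.
  rewrite -ih ?(ltnW kM) //; apply/eqP; rewrite -subr_eq0; apply/eqP.
  have Ik := I k (ltnW kM); have Ik1 := I k.+1 kM.
  rewrite (path_sum_ladder (fK _ Ik) (fK _ Ik1)).
    have [Hk0 Hk1] := Hs _ Ik; have [Hk10 Hk11] := Hs _ Ik1.
    by rewrite /K /= Hk0 Hk1 Hk10 Hk11 !step_sum1 subrr.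
  move=> t It; apply: hd => //; split => /=; last exact: ballxx.
  rewrite /ball /= /ball_ /=; apply: le_lt_trans Md.
  rewrite -mulrBl -natr1 opprD addrA subrr sub0r mulN1r normrN.
  by rewrite ger0_norm // invr_ge0.
have := row M (leqnn _); rewrite divff ?pnatr_eq0 -?lt0n // => E.
rewrite -(path_sum_refine fa (isT : (0 < m.+1)%N)) -(path_sum_refine fb (isT : (0 < m.+1)%N)).
rewrite -/M (@eq_path_sum M a (fun t => K (0, t))) //; last first.
  by move=> t It; rewrite /K /= H0 // /c mulgVK.
rewrite -E; apply: eq_path_sum => // t It.
by rewrite /K /= H1 // c0 mul1g.
Qed.

Lemma chart_ball_path (U : set G) : nbhs (1%g : G) U -> exists2 rho : R, 0 < rho &
  forall u, chart_ball rho u -> exists f, [/\ {within `[0, 1], continuous f},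
    f 0 = 1%g, f 1 = u & forall t, t \in `[0, 1] -> U (f t)].
Proof.
move=> nU; have [r [C [b law]]] := group_law_expansion G.
have [d /andP[d0 dr] hd] : exists2 d, 0 < d <= r & forall x : 'rV[R]_n,
    `|x| < d -> U (pnt G x).
  have [r0 _ _ _ _] := law.
  have /nbhs_ballP[e /= e0 he] := pnt_cvg1 law nU.
  exists (Num.min e r) => [|x]; first by rewrite lt_min e0 r0 ge_min lexx orbT.
  by rewrite lt_min => /andP[xe _]; apply: he; rewrite -ball_normE /= sub0r normrN.
exists d => // u [Du ud].
have small t : t \in `[0, 1] -> `|t *: crd u| < d.
  rewrite in_itv /= => /andP[t0 t1]; rewrite normrZ ger0_norm //.
  by apply: le_lt_trans ud; rewrite ler_piMl.
exists (fun t => pnt G (t *: crd u)); split.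
- apply/subspace_continuousP => t It; apply: cvg_within_filter.
  apply: (@continuous_comp _ _ _ (fun t : R => t *: crd u) (@pnt R n G)).
    by apply: cvgZr_tmp; exact: cvg_id.
  exact: (pnt_cont law (lt_le_trans (small t It) dr)).
- by rewrite scale0r pnt0.
- by rewrite scale1r crdK.
by move=> t /small; exact: hd.
Qed.

(** [F q] is the sum of increments along any fine path from 1 to [q], which depends only on [q] by
    simple connectedness. *)
Lemma monodromy : exists F : G -> R,
  (forall g h, F (g * h)%g = F g + F h + beta g h) /\
  exists2 rho : R, 0 < rho & forall u, chart_ball rho u -> F u = psi u.
Proof.
have zI : (0 : R) \in `[0, 1] by rewrite in_itv /= lexx ler01.
have [pc _] := sc.
have /choice[gam hgam] : forall q, exists z : (R -> G) * nat,
    [/\ {within `[0, 1], continuous z.1}, z.1 0 = 1%g, z.1 1 = q & fine_path z.2 z.1].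
  move=> q; have [f [cf f0 f1]] := pc 1%g q; have [N hN] := ex_fine nV cf.
  by exists (f, N).
pose F q := path_sum (gam q).2 (gam q).1.
have FE f q N : {within `[0, 1], continuous f} -> f 0 = 1%g -> f 1 = q -> fine_path N f ->
    path_sum N f = F q.
  move=> cf f0 f1 fN; have [cg g0 g1 fg] := hgam q.
  have N0 := proj1 fN; have M0 := proj1 fg; rewrite /F.
  rewrite -(path_sum_refine fN M0) -(path_sum_refine fg N0) [X in _ = path_sum X _]mulnC.
  apply: path_sum_independent => //; first by rewrite f1 g1.
    exact: fine_refine.
  by rewrite mulnC; exact: fine_refine.
have [rho rho0 hrho] := chart_ball_path nV.
(* Instead of a concatenation, the path to [p] is multiplied pointwise by a short path from 1 to
   [u]; the two paths then form a ladder with rungs in [V]. *)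
have Fstep p u : chart_ball rho u -> F (p * u)%g = F p + psi u + beta p u.
  move=> /hrho[f [cf f0 f1 fV]]; have [cg g0 g1 fg] := hgam p.
  have ch := within_mulg cg cf; have [M fM] := ex_fine nV ch.
  have N0 := proj1 fg; have M0 := proj1 fM.
  have fg' := fine_refine fg M0; have fM' := fine_refine fM N0.
  rewrite mulnC in fM'.
  rewrite -(FE _ _ _ ch _ _ fM') ?g0 ?f0 ?mulg1 ?g1 ?f1 // -(FE _ _ _ cg g0 g1 fg').
  have := path_sum_ladder fg' fM'.
  rewrite /= g0 g1 f0 f1 mulg1 step_sum1 subr0 /step_sum mulKg => h.
  rewrite -addrA -h => [|t It]; first by rewrite addrC subrK.
  by rewrite mulKg; exact: fV.
have F1 : F 1%g = 0.
  have c1 : {within `[0, 1], continuous (fun _ : R => 1%g : G)}.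
    by apply/subspace_continuousP => t _; exact: cvg_cst.
  rewrite -(FE (fun=> 1%g) 1%g 1%N c1) //; last first.
    by split=> // s t _ _ _; rewrite mulVg.
  by rewrite /path_sum big1 // => i _; exact: step_sum1.
have Fpsi u : chart_ball rho u -> F u = psi u.
  by move=> hu; have := Fstep 1%g u hu; rewrite mul1g F1 beta1l addr0 add0r.
exists F; split; last by exists rho.
(* The law with a small second factor extends to all factors because they are products of small
   ones. *)
move=> g; apply: (group_ind_nbhs pc (chart_ball_nbhs G rho0)) => [|p u ih hu].
  have b1 : beta g 1%g = 0 by apply: (addrI (beta g 1%g)); rewrite -betaMr mulg1 addr0.
  by rewrite mulg1 F1 b1 !addr0.
have -> : (g * (p * u) = (g * p) * u)%g by rewrite mulgA.
by rewrite (Fstep (g * p)%g u) // (Fstep p u) // ih (betaMl g p u) (betaMr g p u); ring.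
Qed.

End Monodromy.

Section Primitives.
Variables (R : realType) (n : nat) (G : lieGroupType R n).
Variables (r C : R) (b : 'rV[R]_n -> 'rV[R]_n -> 'rV[R]_n).
Hypothesis law : @local_law R n G r C b.
Hypothesis sc : simply_connected R G.
Implicit Types (x y : 'rV[R]_n) (g h : G).
Local Notation pnt := (@pnt R n G).
Local Notation crd := (@crd R n G).
Local Notation lie := (bracket b).

Let r0 : 0 < r. Proof. by case: law. Qed.
Let C0 : 0 <= C. Proof. by case: law. Qed.

Lemma pnt_chart_ball x e : `|x| < r -> `|x| < e -> chart_ball e (pnt x).
Proof. by move=> /(pnt_dom law)[D E] h; split; rewrite ?E. Qed.

Lemma global_primitive (beta : G -> G -> R) (delta : 'rV[R]_n -> R) eps K :
  (forall g h k, beta (g * h)%g k = beta g k + beta h k) ->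
  (forall g h k, beta g (h * k)%g = beta g h + beta g k) -> 0 < eps -> 0 <= K ->
  (forall x y, `|x| < eps -> `|y| < eps ->
    `|delta (crd (pnt x * pnt y)%g) - delta x - delta y - beta (pnt x) (pnt y)| <=
    K * (`|x| + `|y|) ^+ 3) ->
  exists F : G -> R, (forall g h, F (g * h)%g = F g + F h + beta g h) /\
  exists e K', [/\ 0 < e, 0 <= K' & forall x, `|x| < e ->
    `|F (pnt x) - delta x| <= K' * `|x| ^+ 3].
Proof.
move=> bl br eps0 K0 hd.
have [rho [K' [psi [rho0 K'0 psiM psid]]]] := local_primitive law bl br eps0 K0 hd.
have [F [FM [rho' rho'0 Fpsi]]] := monodromy bl br (chart_ball_nbhs G rho0) psiM sc.
exists F; split=> //; exists (Num.min r (Num.min rho rho')), K'; split=> //.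
  by rewrite !lt_min r0 rho0.
move=> x; rewrite !lt_min => /andP[xr /andP[xrho xrho']].
by rewrite Fpsi; [exact: psid|exact: pnt_chart_ball].
Qed.

Section Functional.
Variables (l : 'rV[R]_n -> R) (M : R).
Hypothesis lD : forall x y, l (x + y) = l x + l y.
Hypothesis lZ : forall (a : R) x, l (a *: x) = a * l x.
Hypothesis l_le : forall x, `|l x| <= M * `|x|.
Hypothesis M0 : 0 <= M.

(** The quadratic correction removes the symmetric part of [b], so that the defect of additivity
    becomes half the Lie bracket up to third order. *)
Definition second_order x := l x - 2^-1 * l (b x x).

Lemma second_order_law : exists2 K, 0 <= K & forall x y, `|x| < r -> `|y| < r ->
  `|second_order (crd (pnt x * pnt y)%g) - second_order x - second_order y -
    2^-1 * l (lie x y)| <= K * (`|x| + `|y|) ^+ 3.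
Proof.
pose C' := C * (1 + 2 * r).
have r0' := ltW r0.
have C'0 : 0 <= C' by rewrite mulr_ge0 // addr_ge0 // mulr_ge0.
exists (M * C + M * (C * C' * (2 + 2 * C' * r))).
  by rewrite !(addr_ge0, mulr_ge0).
move=> x y xr yr.
have [_ _ [hl hr] b_le /(_ x y xr yr)[_ _ hE]] := law.
have hw := law_le law xr yr.
set w := crd _ in hE hw *; pose s := `|x| + `|y|.
have [nx ny] := (normr_ge0 x, normr_ge0 y).
have s0 : 0 <= s by rewrite addr_ge0.
have s2 : s <= 2 * r by rewrite /s; lra.
have xy : `|x| * `|y| <= s ^+ 2 by rewrite /s; nra.
have bD u u' v : b (u + u') v = b u v + b u' v by rewrite -[u]scale1r hl !scale1r.
have bDr u v v' : b u (v + v') = b u v + b u v' by rewrite -[v]scale1r hr !scale1r.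
have lN u : l (- u) = - l u by rewrite -scaleN1r lZ mulN1r.
pose E := w - x - y - b x y; pose d := w - (x + y).
have dle : `|d| <= C' * s ^+ 2.
  by rewrite /d opprD addrA; apply: le_trans hw _; rewrite -mulrA ler_wpM2l.
have wle : `|w| <= s * (1 + 2 * C' * r).
  rewrite -(subrK (x + y) w) -/d; apply: le_trans (ler_normD _ _) _.
  apply: le_trans (lerD dle (ler_normD x y)) _; rewrite -/s.
  have : C' * s ^+ 2 <= C' * (s * (2 * r)).
    by apply: ler_wpM2l => //; rewrite expr2; exact: ler_wpM2l.
  by lra.
have bww : b w w = b d w + b (x + y) d + (b x x + b x y + (b y x + b y y)).
  have {1}-> : w = d + (x + y) by rewrite subrK.
  rewrite bD -addrA; congr (_ + _); rewrite -!bDr -bD -bDr; congr (b _ _).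
  by rewrite subrK.
have -> : second_order w - second_order x - second_order y - 2^-1 * l (lie x y) =
    l E - 2^-1 * (l (b d w) + l (b (x + y) d)).
  have lw : l w = l E + l x + l y + l (b x y).
    rewrite -!lD; congr l; rewrite /E.
    by apply/rowP => j; rewrite !mxE; ring.
  by rewrite /second_order lw bww /bracket !lD !lN; clearbody E d; field.
apply: le_trans (ler_normB _ _) _; rewrite mulrDl; apply: lerD.
  apply: le_trans (l_le _) _; rewrite -mulrA; apply: ler_wpM2l => //.
  apply: le_trans hE _; rewrite -/s [s ^+ 3]exprSr -[C * _ * _]mulrA -mulrA.
  by apply: ler_wpM2l => //; apply: ler_wpM2r.
have h1 : `|l (b d w)| <= M * (C * (C' * s ^+ 2) * (s * (1 + 2 * C' * r))).
  apply: le_trans (l_le _) _; apply: ler_wpM2l => //; apply: le_trans (b_le _ _) _.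
  by apply: ler_pM => //; [rewrite mulr_ge0|exact: ler_wpM2l].
have h2 : `|l (b (x + y) d)| <= M * (C * s * (C' * s ^+ 2)).
  apply: le_trans (l_le _) _; apply: ler_wpM2l => //; apply: le_trans (b_le _ _) _.
  apply: ler_pM => //; [by rewrite mulr_ge0|apply: ler_wpM2l => //].
  exact: ler_normD.
rewrite normrM ger0_norm ?invr_ge0 //.
have h3 := ler_normD (l (b d w)) (l (b (x + y) d)).
have -> : M * (C * C' * (2 + 2 * C' * r)) * s ^+ 3 =
   M * (C * (C' * s ^+ 2) * (s * (1 + 2 * C' * r))) + M * (C * s * (C' * s ^+ 2)).
  by ring.
have := normr_ge0 (l (b d w) + l (b (x + y) d)).
lra.
Qed.

Lemma second_order_near x : `|second_order x - l x| <= M * C * `|x| ^+ 2.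
Proof.
have [_ _ _ b_le _] := law.
rewrite /second_order addrAC subrr add0r normrN normrM ger0_norm ?invr_ge0 //.
have h : `|l (b x x)| <= M * C * `|x| ^+ 2.
  apply: le_trans (l_le _) _; rewrite -mulrA ler_wpM2l // expr2 mulrA.
  exact: b_le.
have := normr_ge0 (l (b x x)); lra.
Qed.

End Functional.

(** If [A] kills brackets, [second_order] is additive up to cubic terms, and its primitive for the
    zero cocycle is a homomorphism; each coordinate is treated separately. *)
Lemma exists_character p (A : 'M[R]_(n, p)) : (forall x y, lie x y *m A = 0) ->
  exists phi : G -> 'rV[R]_p, (forall g h, phi (g * h)%g = phi g + phi h) /\
  exists e K, [/\ 0 < e, 0 <= K & forall x, `|x| < e ->
    `|phi (pnt x) - x *m A| <= K * `|x| ^+ 2].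
Proof.
move=> hA.
have coord (j : 'I_p) : exists fe : (G -> R) * (R * R),
    (forall g h, fe.1 (g * h)%g = fe.1 g + fe.1 h) /\
    [/\ 0 < fe.2.1, 0 <= fe.2.2 & forall x, `|x| < fe.2.1 ->
      `|fe.1 (pnt x) - (x *m A) 0 j| <= fe.2.2 * `|x| ^+ 2].
  pose l x := (x *m A) 0 j; pose M := n%:R * `|A|.
  have lD x y : l (x + y) = l x + l y by rewrite /l mulmxDl mxE.
  have lZ (a : R) x : l (a *: x) = a * l x by rewrite /l -scalemxAl mxE.
  have l_le x : `|l x| <= M * `|x| by apply: le_trans (normr_coord _ _) (normr_mulmx _ _).
  have M0 : 0 <= M by rewrite mulr_ge0.
  have [K K0 hK] := second_order_law lD lZ l_le M0.
  have hK' x y : `|x| < r -> `|y| < r -> `|second_order l (crd (pnt x * pnt y)%g) -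
      second_order l x - second_order l y - 0| <= K * (`|x| + `|y|) ^+ 3.
    by move=> xr yr; have := hK x y xr yr; rewrite [X in _ * X]/l hA mxE mulr0.
  have [F [FM [e [K' [e0 K'0 hF]]]]] := @global_primitive (fun _ _ => 0) (second_order l) r K
    (fun _ _ _ => esym (addr0 0)) (fun _ _ _ => esym (addr0 0)) r0 K0 hK'.
  exists (F, (Num.min e 1, K' + M * C)); split=> [g h|]; first by rewrite /= FM addr0.
  split => /=; [by rewrite lt_min e0 ltr01|by rewrite addr_ge0 // mulr_ge0|].
  move=> x; rewrite lt_min => /andP[xe x1].
  have -> : F (pnt x) - l x = (F (pnt x) - second_order l x) + (second_order l x - l x).
    by rewrite addrA subrK.
  apply: le_trans (ler_normD _ _) _; rewrite mulrDl.
  apply: lerD; last exact: second_order_near.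
  apply: le_trans (hF x xe) _; apply: ler_wpM2l => //.
  by rewrite exprS ler_piMl ?exprn_ge0 // ltW.
have /choice[fe hfe] := coord.
exists (fun g => \row_j (fe j).1 g); split=> [g h|].
  by apply/rowP => j; rewrite !mxE; have [-> _] := hfe j.
pose e := \big[Num.min/1]_(j < p) (fe j).2.1.
pose K := \sum_(j < p) (fe j).2.2.
have K0 j : 0 <= (fe j).2.2 by have [_ []] := hfe j.
exists e, K; split.
- by apply: lt_bigmin => // j _; have [_ []] := hfe j.
- by apply: sumr_ge0.
move=> x xe; apply: normr_row_le => [|j].
  by rewrite mulr_ge0 ?exprn_ge0 // sumr_ge0.
rewrite [X in `|X|]mxE [X in `|X + _|]mxE [X in `|_ + X|]mxE.
have [_ [_ _ h]] := hfe j; apply: le_trans (h x _) _.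
  by apply: lt_le_trans xe _; exact: bigmin_le_cond.
by rewrite ler_wpM2r ?exprn_ge0 //; exact: (ler_sum_term j K0).
Qed.

(** There is then a homomorphism [phi] to a vector space that is the identity to first order. It
    kills commutators and separates small elements from 1, so small elements commute, and they
    generate. *)
Lemma bracket0_abelian : (forall x y, lie x y = 0) -> abelian_group G.
Proof.
move=> h0; have [|phi [phiM [e [K [e0 K0 hphi]]]]] := @exists_character _ (1%:M : 'M[R]_n).
  by move=> x y; rewrite h0 mul0mx.
have K1 : 0 < K + 1 by rewrite ltr_wpDl.
have phi1 : phi 1%g = 0 by apply: (addrI (phi 1%g)); rewrite -phiM mulg1 addr0.
have phiV g : phi g^-1%g = - phi g.
  by apply/eqP; rewrite -addr_eq0 -phiM mulVg phi1.
pose e' := Num.min e (K + 1)^-1.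
have e'0 : 0 < e' by rewrite lt_min e0 invr_gt0.
have [d /andP[d0 dr] hd] : exists2 d, 0 < d <= r & forall x y, `|x| < d -> `|y| < d ->
    chart_ball e' [~ pnt x, pnt y]%g.
  apply: (near_chart_words law (w := fun g h => [~ g, h]%g)) => // T F a c FF ha hc.
  have e1 : 1%g = [~ 1, 1]%g :> G by rewrite comm1g.
  rewrite [X in _ --> X]e1 /commg /conjg.
  exact: cvgMg (cvgVg ha) (cvgMg (cvgVg hc) (cvgMg ha hc)).
have small x y : `|x| < d -> `|y| < d -> commute (pnt x) (pnt y).
  move=> xd yd; have [Dc cc] := hd x y xd yd; set c := [~ _, _]%g in Dc cc.
  have pc : phi c = 0.
    rewrite /c /commg /conjg !phiM !phiV.
    by apply/rowP => j; rewrite !mxE; ring.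
  move: cc; rewrite lt_min => /andP[ce cK].
  have := hphi _ ce; rewrite (crdK Dc) pc mulmx1 sub0r normrN => h.
  (* As [phi c = 0], the norm of [crd c] is at most [K] times its square, impossible for a nonzero
     norm below [1 / (K + 1)]. *)
  have c0 : crd c = 0.
    apply/eqP; rewrite -normr_eq0; apply/negPn/negP => cn.
    have cp : 0 < `|crd c| by rewrite lt_neqAle eq_sym cn normr_ge0.
    move: h; rewrite expr2 mulrA -[leLHS]mul1r ler_pM2r // leNgt; apply/negP; rewrite negbK.
    move: cK; rewrite -[X in _ < X]mul1r ltr_pdivlMr // => cK.
    by apply: le_lt_trans cK; rewrite mulrC ler_wpM2l // lerDl.
  by apply/commgP; rewrite -/c -(crdK Dc) c0 pnt0.
have nb : nbhs (1%g : G) (chart_ball d) by exact: chart_ball_nbhs.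
have [pc _] := sc.
have comm1 u : chart_ball d u -> forall g, commute u g.
  move=> [Du ud]; apply: (group_ind_nbhs pc nb) => [|p v cup [Dv vd]].
    by rewrite /commute mulg1 mul1g.
  by apply: commuteM => //; rewrite -(crdK Du) -(crdK Dv); exact: small.
move=> g; apply: (group_ind_nbhs pc nb) => [|p v cgp hv].
  by rewrite mulg1 mul1g.
by apply: commuteM => //; apply: commute_sym; exact: comm1.
Qed.

(** With trivial commutators, [t ^ 2] times the bracket is of order [t ^ 3]. *)
Lemma abelian_bracket0 : abelian_group G -> forall x y, lie x y = 0.
Proof.
move=> ab x y; have [d [K [d0 dr K0 hd]]] := commutator_estimate law.
pose m := `|x| + `|y| + 1.
have m0 : 0 < m by rewrite ltr_wpDl // addr_ge0.
have h t : 0 < t < d / m -> `|lie x y| <= K * m ^+ 3 * t.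
  move=> /andP[t0]; rewrite ltr_pdivlMr // => td.
  have ltm (z : 'rV[R]_n) : `|z| <= m -> `|t *: z| < d.
    by move=> zm; apply: le_lt_trans td; rewrite normrZ gtr0_norm // ler_wpM2l // ltW.
  have [nx ny] := (normr_ge0 x, normr_ge0 y).
  have [xm ym] : `|x| <= m /\ `|y| <= m by rewrite /m; lra.
  have [_] := hd _ _ (ltm x xm) (ltm y ym).
  have -> : [~ pnt (t *: x), pnt (t *: y)]%g = 1%g.
    by apply/eqP/commgP; exact: ab.
  rewrite crd1 sub0r normrN (bracketZl law) (bracketZr law) !normrZ !(gtr0_norm t0) => h.
  rewrite -(ler_pM2l t0) -(ler_pM2l t0); apply: le_trans h _.
  have -> : t * (t * (K * m ^+ 3 * t)) = K * (t * m) * (t * m) * (t * m) by ring.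
  have tx : t * `|x| <= t * m by rewrite ler_wpM2l // ltW.
  have ty : t * `|y| <= t * m by rewrite ler_wpM2l // ltW.
  have tt0 := ltW t0.
  apply: ler_pM => //; first by rewrite !mulr_ge0.
  - by rewrite addr_ge0 // mulr_ge0.
  - by apply: ler_pM => //; [rewrite !mulr_ge0|rewrite mulr_ge0|rewrite ler_wpM2l].
  by rewrite -mulrDr ler_wpM2l // /m; lra.
apply/eqP; rewrite -normr_eq0 eq_le normr_ge0 andbT.
apply/ler_addgt0Pr => e e0; rewrite add0r.
pose A := K * m ^+ 3 + 1.
have A0 : 0 < A by rewrite ltr_wpDl // mulr_ge0 // exprn_ge0 // ltW.
have dm0 : 0 < d / m by rewrite divr_gt0.
pose t := Num.min (d / m / 2) (e / A).
have t0 : 0 < t by rewrite lt_min !divr_gt0.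
apply: le_trans (h t _) _.
  by rewrite t0 /= gt_min; apply/orP; left; lra.
apply: (@le_trans _ _ (A * t)); first by rewrite ler_wpM2r ?(ltW t0) // lerDl.
by rewrite -ler_pdivlMl // mulrC /t ge_min lexx orbT.
Qed.

End Primitives.

Section QuadraticFunctional.
Variables (R : realType) (n : nat) (lie : 'rV[R]_n -> 'rV[R]_n -> 'rV[R]_n).
Hypothesis lieDl : forall x x' y, lie (x + x') y = lie x y + lie x' y.
Hypothesis lieDr : forall x y y', lie x (y + y') = lie x y + lie x y'.
Hypothesis lieZl : forall (a : R) x y, lie (a *: x) y = a *: lie x y.
Hypothesis lieZr : forall (a : R) x y, lie x (a *: y) = a *: lie x y.
Let e i : 'rV[R]_n := delta_mx 0 i.

Let lie0l z : lie 0 z = 0.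
Proof. by have := lieZl 0 0 z; rewrite !scale0r. Qed.

Let lie0r z : lie z 0 = 0.
Proof. by have := lieZr 0 z 0; rewrite !scale0r. Qed.

Let lie_sum x y : lie x y = \sum_i \sum_j (x 0 i * y 0 j) *: lie (e i) (e j).
Proof.
rewrite {1}[x]row_coordsE (big_morph (lie^~ y) (fun u v => lieDl u v y) (lie0l y)).
apply: eq_bigr => i _; rewrite lieZl.
rewrite {1}[y]row_coordsE (big_morph (lie (e i)) (lieDr (e i)) (lie0r _)) scaler_sumr.
by apply: eq_bigr => j _; rewrite lieZr scalerA.
Qed.

Definition derived_mx : 'M[R]_n := (\sum_i \sum_j <<lie (e i) (e j)>>)%MS.
Let W3 : 'M[R]_n := (\sum_i \sum_j <<lie (row i derived_mx) (e j)>>)%MS.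

Lemma lie_derived x y : (lie x y <= derived_mx)%MS.
Proof.
rewrite lie_sum; apply: summx_sub => i _; apply: summx_sub => j _.
apply: scalemx_sub; apply: (sumsmx_sup i) => //; apply: (sumsmx_sup j) => //.
by rewrite genmxE.
Qed.

Let lie_W3 w y : (w <= derived_mx)%MS -> (lie w y <= W3)%MS.
Proof.
move=> /submxP[u ->]; rewrite mulmx_sum_row.
rewrite (big_morph (lie^~ y) (fun u v => lieDl u v y) (lie0l y)).
apply: summx_sub => i _; rewrite lieZl; apply: scalemx_sub.
rewrite [y]row_coordsE (big_morph (lie _) (lieDr _) (lie0r _)).
apply: summx_sub => j _; rewrite lieZr; apply: scalemx_sub.
by apply: (sumsmx_sup i) => //; apply: (sumsmx_sup j) => //; rewrite genmxE.
Qed.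

Let nested_mx ys : 'M[R]_n := \matrix_i foldl lie (e i) ys.

Let nested_mxE w ys : w *m nested_mx ys = foldl lie w ys.
Proof.
have fD u v : foldl lie (u + v) ys = foldl lie u ys + foldl lie v ys.
  by elim: ys u v => //= y ys ih u v; rewrite lieDl ih.
have fZ (a : R) u : foldl lie (a *: u) ys = a *: foldl lie u ys.
  by elim: ys u {fD} => //= y ys ih u; rewrite lieZl ih.
have f0 : foldl lie 0 ys = 0 by have := fZ 0 0; rewrite !scale0r.
rewrite mulmx_sum_row {2}[w]row_coordsE (big_morph (fun u => foldl lie u ys) fD f0).
by apply: eq_bigr => i _; rewrite fZ rowK.
Qed.

(* If the third term of the lower central series were equal to the second, all the later ones would be too. *)
Lemma exists_quadratic_functional : (exists s, forall x ys, size ys = s -> foldl lie x ys = 0) ->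
  (exists x y, lie x y != 0) ->
  exists om : 'cV[R]_n, (forall w z, (w <= derived_mx)%MS -> lie w z *m om = 0) /\
    exists x y, (lie x y *m om) 0 0 != 0.
Proof.
move=> [s hs] [x0 [y0 xy0]].
have [W23|nW23] := boolP (derived_mx <= W3)%MS; last first.
  have [i [j hij]] : exists i j, ~~ (lie (e i) (e j) <= W3)%MS.
    apply: contrapT => h; case/negP: nW23; apply/sumsmx_subP => i _.
    apply/sumsmx_subP => j _; rewrite genmxE; apply/negPn/negP => hij.
    by apply: h; exists i, j.
  have : lie (e i) (e j) *m cokermx W3 != 0 by rewrite -submxE.
  move=> /eqP/rowP/eqfunP; rewrite negb_forall => /existsP[k hk].
  (* A column of the cokernel matrix vanishes on [W3], and [k] is chosen so that it detects a
     bracket outside [W3]. *)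
  exists (col k (cokermx W3)); split=> [w z hw|].
    have := lie_W3 z hw; rewrite submxE => /eqP h.
    by rewrite colE mulmxA h mul0mx.
  exists (e i), (e j); rewrite colE mulmxA -colE [X in X != _]mxE.
  by move: hk; rewrite [X in _ != X]mxE.
exfalso; case/negP: xy0; apply/eqP.
(* Since the derived space lies in [W3], vanishing of brackets with one more letter implies
   vanishing with the present ones; starting from [s] letters, all are removed. *)
suff h k w ys : (k <= s)%N -> size ys = (s - k)%N -> (w <= derived_mx)%MS ->
    foldl lie w ys = 0.
  by apply: (h s _ [::]) => //; [rewrite subnn|exact: lie_derived].
elim: k w ys => [|k ih] w ys ks sz hw; first by apply: hs; rewrite sz subn0.
have <- := nested_mxE w ys.
apply/eqP; rewrite -submx0 -(mulmx_ker (nested_mx ys)); apply: submxMr.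
apply: submx_trans hw (submx_trans W23 _).
apply/sumsmx_subP => i _; apply/sumsmx_subP => j _; rewrite genmxE.
apply/sub_kermxP; rewrite nested_mxE; apply: (ih (row i derived_mx) (e j :: ys)).
- exact: ltnW.
- by rewrite /= sz subnSK.
- exact: row_sub.
Qed.

End QuadraticFunctional.

(** * The Riemannian distance *)

Section InnerProduct.
Variables (R : realType) (n : nat).
Implicit Types (A : 'M[R]_n) (u v : 'rV[R]_n).

Lemma innerE A u v : inner A u v = \sum_j \sum_i u 0 i * A i j * v 0 j.
Proof.
rewrite /inner mxE; apply: eq_bigr => j _.
by rewrite !mxE mulr_suml.
Qed.

Lemma inner_cvg (T : Type) (F : set_system T) (FF : Filter F) (A : T -> 'M[R]_n)
    (u v : T -> 'rV[R]_n) A0 u0 v0 :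
  A @ F --> A0 -> u @ F --> u0 -> v @ F --> v0 ->
  (fun t => inner (A t) (u t) (v t)) @ F --> inner A0 u0 v0.
Proof.
have entry m p (B : T -> 'M[R]_(m, p)) (B0 : 'M[R]_(m, p)) i j : B @ F --> B0 -> (fun t => B t i j) @ F --> B0 i j.
  move=> /cvgrPdist_lt hB; apply/cvgrPdist_lt => e e0.
  have := hB e e0; apply: filterS => t; apply: le_lt_trans.
  by have := normr_entry (B0 - B t) i j; rewrite !mxE.
move=> hA hu hv; rewrite innerE; under eq_fun do rewrite innerE.
apply: cvg_big => [|j _]; first exact: add_continuous.
apply: cvg_big => [|i _]; first exact: add_continuous.
by apply: cvgM; [apply: cvgM|]; exact: entry.
Qed.

Lemma inner_le A u : `|inner A u u| <= n%:R * n%:R * `|A| * `|u| ^+ 2.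
Proof.
rewrite innerE; apply: le_trans (ler_norm_sum _ _ _) _.
apply: (@le_trans _ _ (\sum_(j < n) \sum_(i < n) `|A| * `|u| ^+ 2)).
  apply: ler_sum => j _; apply: le_trans (ler_norm_sum _ _ _) _.
  apply: ler_sum => i _; rewrite !normrM expr2 mulrAC mulrC.
  by rewrite ler_pM ?mulr_ge0 // ?normr_entry // ler_pM // normr_coord.
set X := _ * _ ^+ 2; rewrite !sumr_const !card_ord -(mulr_natl (X *+ n)) -(mulr_natl X).
by rewrite /X !mulrA.
Qed.

(** The constant comes from the minimum of the form on the compact unit sphere; in dimension 0 the
    sphere is empty and any constant works. *)
Lemma inner_lower A : (forall u, u != 0 -> 0 < inner A u u) ->
  exists2 c, 0 < c & forall u, c * `|u| <= Num.sqrt (inner A u u).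
Proof.
move=> hA; have [[u0 u00]|all0] := pselect (exists u : 'rV[R]_n, u != 0); last first.
  exists 1 => // u; have [->|u0] := eqVneq u 0; first by rewrite normr0 mulr0 sqrtr_ge0.
  by case: all0; exists u.
pose S := [set u : 'rV[R]_n | `|u| = 1].
have normalize u : u != 0 -> S (`|u|^-1 *: u).
  by move=> un0; rewrite /S /= normrZ normfV normr_id mulVf // normr_eq0.
have S0 : S !=set0 by exists (`|u0|^-1 *: u0); exact: normalize.
have cS : compact S.
  apply: bounded_closed_compact.
    by exists 1; split=> // M M1 u; rewrite /S /= => ->; exact: ltW.
  have := (continuous_closedP (fun u : 'rV[R]_n => `|u|)).1 (@norm_continuous _ _).
  by move=> /(_ [set x | x = 1]); apply; exact: (@closed_eq R 1).
have cont : {within S, continuous (fun u => inner A u u)}.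
  apply: continuous_subspaceT => u.
  have i : (id : 'rV[R]_n -> 'rV[R]_n) @ u --> u by exact: cvg_id.
  exact: (inner_cvg _ (@continuous_const _ 'rV[R]_n 'M[R]_n A u) i i).
have [m mS hm] := EVT_min_rV S0 cS cont.
have m0 : m != 0.
  by move: mS; rewrite inE /S /= => m1; rewrite -normr_eq0 m1 oner_eq0.
exists (Num.sqrt (inner A m m)); first by rewrite sqrtr_gt0 hA.
move=> u; have [->|un0] := eqVneq u 0; first by rewrite normr0 mulr0 sqrtr_ge0.
have := hm (`|u|^-1 *: u); rewrite inE => /(_ (normalize u un0)).
have -> : inner A (`|u|^-1 *: u) (`|u|^-1 *: u) = (`|u| ^+ 2)^-1 * inner A u u.
  rewrite !innerE mulr_sumr; apply: eq_bigr => j _; rewrite mulr_sumr.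
  by apply: eq_bigr => i _; rewrite !mxE; field; rewrite normr_eq0.
rewrite mulrC ler_pdivlMr ?exprn_gt0 ?normr_gt0 // => h.
apply: le_trans (ler_wsqrtr h).
by rewrite (sqrtrM _ (ltW (hA m m0))) sqrtr_sqr ger0_norm.
Qed.

End InnerProduct.

(** * Curves and velocities under smooth maps and left translations *)

Section ChainRule.
Variables (R : realType) (n : nat) (G : lieGroupType R n).
Implicit Types (c d : chart G 'rV[R]_n) (f : G -> G) (gam : R -> G).
Local Notation smooth f := (smooth_map (@atlas R n G) (@atlas R n G) f).

Lemma coord_dom_nbhs c d f x : is_chart c -> is_chart d -> continuous f ->
  coord_dom c d f x -> nbhs x (coord_dom c d f).
Proof.
move=> [_ oc _ _ cc] [od _ _ _ _] cf [xc xd]; apply: filterI.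
  exact: open_nbhs_nbhs.
have h : (fun y => f (cinv c y)) @ x --> f (cinv c x).
  by apply: (@continuous_comp _ _ _ (cinv c) f); [exact: cc|exact: cf].
by apply: h; exact: open_nbhs_nbhs.
Qed.

Lemma coord_rep_C1 c d f : atlas c -> atlas d -> smooth f ->
  open (coord_dom c d f) /\ Ck 1 (coord_dom c d f) (coord_rep c d f).
Proof.
move=> ac ad [cf sf]; split; last exact: sf.
rewrite openE => x hx; apply: coord_dom_nbhs => //; exact: (atlas_is_chart _).
Qed.

Lemma chain_rule c d f gam t : atlas c -> atlas d -> smooth f ->
  {for t, continuous gam} -> cdom c (gam t) -> cdom d (f (gam t)) ->
  derivable (cmap c \o gam : R^o -> 'rV[R]_n) t 1 ->
  is_derive (t : R^o) 1 (cmap d \o (f \o gam) : R^o -> 'rV[R]_n)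
    ('d (coord_rep c d f) (cmap c (gam t)) ('D_1 (cmap c \o gam : R^o -> 'rV[R]_n) t)).
Proof.
move=> ac ad sf cg gc gd dg.
have [oD C1] := coord_rep_C1 ac ad sf.
have [oc _ cK ccm _] := atlas_is_chart _ ac.
have Dx : coord_dom c d f (cmap c (gam t)).
  by split; [exists (gam t)|rewrite /= cK].
have [dF _] := Ck1_is_diff oD C1 Dx.
pose eta := cmap c \o gam : R^o -> 'rV[R]_n.
have deta : differentiable eta (t : R^o) by apply/derivable1_diffP.
have dcomp : differentiable (coord_rep c d f \o eta) (t : R^o).
  by apply: differentiable_comp.
have E : \forall s \near (t : R^o), (coord_rep c d f \o eta) s = (cmap d \o (f \o gam)) s.
  have : \forall s \near (t : R^o), cdom c (gam s) by apply: cg; exact: open_nbhs_nbhs.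
  by apply: filterS => s hs; rewrite /coord_rep /eta /= cK.
apply: (near_eq_is_derive E).
have -> : 'd (coord_rep c d f) (cmap c (gam t)) ('D_1 eta t) =
    'D_1 (coord_rep c d f \o eta) (t : R^o).
  have dc := diff_comp deta dF.
  have e1 : 'D_1 eta (t : R^o) = 'd eta (t : R^o) 1 by exact: deriveE.
  have e2 : 'D_1 (coord_rep c d f \o eta) (t : R^o) = 'd (coord_rep c d f \o eta) (t : R^o) 1.
    exact: deriveE.
  rewrite e1 e2; exact: (esym (congr1 (fun k : R^o -> 'rV[R]_n => k 1) dc)).
by apply: derivableP; exact: diff_derivable.
Qed.

Lemma id_smooth : smooth (@id G).
Proof. exact: atlas_compatible. Qed.

Lemma mull_continuous (a : G) : continuous (fun x : G => (a * x)%g).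
Proof. by move=> x; apply: cvgMg; [exact: cvg_cst|exact: cvg_id]. Qed.

(** The first factor of the product is frozen in a chart around [a], which is composition with an
    affine map. *)
Lemma mull_smooth (a : G) : smooth (fun x : G => (a * x)%g).
Proof.
split=> [|c d ac ad k]; first exact: mull_continuous.
have [ca [aca caa]] := atlas_cover a.
pose c2 := Chart (cdom ca `*` cdom c)
  (fun p : G * G => (cmap ca p.1, cmap c p.2))
  (fun x : 'rV[R]_n * 'rV[R]_n => (cinv ca x.1, cinv c x.2)).
have Ac2 : prod_atlas (@atlas R n G) (@atlas R n G) c2.
  by exists ca => //; exists c.
have [_ /(_ c2 d Ac2 ad k) hF] := @mulg_smooth R n G.
have [_ _ cK _ _] := atlas_is_chart _ aca.
pose A (x : 'rV[R]_n) := (cmap ca a, x).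
have cA : continuous A.
  exact: continuous_pairl.
have hA (h : R) (v z : 'rV[R]_n) : A (h *: v + z) = h *: (0, v) + A z.
  by rewrite /A; congr pair; rewrite /= scaler0 add0r.
have := Ck_comp_affine cA hA hF.
have -> : coord_rep c2 d (fun p : G * G => (p.1 * p.2)%g) \o A =
    coord_rep c d (fun x : G => (a * x)%g).
  by apply/funext => x; rewrite /coord_rep /A /= cK.
apply: Ck_sub => x [[p cp px] hd]; split=> /=; last by rewrite /= cK.
by exists (a, p) => //=; rewrite /A px.
Qed.

End ChainRule.

Lemma cvg_scale (R : realType) (V W : normedModType R) (f : V -> W) (a : R) (x : V) (l : W) :
  f @ x --> l -> (fun s => a *: f s) @ x --> a *: l.
Proof.
move=> h; have c : (fun _ : V => a) @ x --> a by exact: cvg_cst.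
exact: (cvgZ c h).
Qed.

Definition vel (R : realType) n (M : manifoldType R n) (c : chart M 'rV[R]_n) (gam : R -> M)
  (t : R) : 'rV[R]_n := 'D_1 (cmap c \o gam : R^o -> 'rV[R]_n) (t : R^o).

Section CurvesTranslation.
Variables (R : realType) (n : nat) (G : lieGroupType R n) (g : riemannian_metric G).
Implicit Types (c d : chart G 'rV[R]_n) (f : G -> G) (gam : R -> G) (t : R).
Local Notation smooth f := (smooth_map (@atlas R n G) (@atlas R n G) f).

Lemma chart_atP (p : G) : atlas (chart_at p) /\ cdom (chart_at p) p.
Proof. by rewrite /chart_at; case: cid. Qed.

Lemma vel_chain c d f gam t : atlas c -> atlas d -> smooth f ->
  {for t, continuous gam} -> cdom c (gam t) -> cdom d (f (gam t)) ->
  derivable (cmap c \o gam : R^o -> 'rV[R]_n) (t : R^o) 1 ->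
  vel d (f \o gam) t = 'd (coord_rep c d f) (cmap c (gam t)) (vel c gam t).
Proof. by move=> ac ad sf cg gc gd dg; have [_] := chain_rule ac ad sf cg gc gd dg. Qed.

Lemma speed_vel gam t : speed g gam t = Num.sqrt (inner (metric_mx g (chart_at (gam t)) (gam t))
  (vel (chart_at (gam t)) gam t) (vel (chart_at (gam t)) gam t)).
Proof. by []. Qed.

(** The chart used by [speed] varies with the point without continuity; a fixed chart is what makes
    the speed continuous, hence integrable. *)
Lemma speed_chart gam t d : atlas d -> {for t, continuous gam} -> cdom d (gam t) ->
  derivable (cmap d \o gam : R^o -> 'rV[R]_n) (t : R^o) 1 ->
  speed g gam t = Num.sqrt (inner (metric_mx g d (gam t)) (vel d gam t) (vel d gam t)).
Proof.
move=> ad cg gd dg; have [ac gc] := chart_atP (gam t).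
have D := vel_chain ad ac (@id_smooth R n G) cg gd gc dg.
have /= M := @metric_change R n G g d (chart_at (gam t)) (gam t) (vel d gam t) (vel d gam t)
  ad ac gd gc.
by rewrite speed_vel -M -D.
Qed.

Lemma speed_translate (a : G) gam t : left_invariant g -> {for t, continuous gam} ->
  derivable (cmap (chart_at (gam t)) \o gam : R^o -> 'rV[R]_n) (t : R^o) 1 ->
  speed g (fun s => a * gam s)%g t = speed g gam t.
Proof.
move=> li cg dg; have [ac gc] := chart_atP (gam t).
have [ad gd] := chart_atP (a * gam t)%g.
have D := vel_chain ac ad (mull_smooth a) cg gc gd dg.
have /= M := li a _ _ _ (vel (chart_at (gam t)) gam t) (vel (chart_at (gam t)) gam t) ac ad gc gd.
by rewrite !speed_vel -M -D.
Qed.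

(** Near [t] the velocity in [d] is a combination of the coordinates of the velocity in the fixed
    chart [c], with continuous coefficients. *)
Lemma vel_continuous_comp c d f gam t : atlas c -> atlas d -> smooth f ->
  cdom c (gam t) -> cdom d (f (gam t)) -> {for t, continuous gam} ->
  (\forall s \near t, {for s, continuous gam} /\
    derivable (cmap c \o gam : R^o -> 'rV[R]_n) (s : R^o) 1) ->
  {for (t : R^o), continuous (fun s => vel c gam s)} ->
  {for (t : R^o), continuous (fun s : R^o => vel d (f \o gam) s)}.
Proof.
move=> ac ad sf gc gd cg ng cv.
have [oD C1] := coord_rep_C1 ac ad sf.
have [oc _ cK cc _] := atlas_is_chart _ ac; have [od _ _ _ _] := atlas_is_chart _ ad.
have nc : \forall s \near t, cdom c (gam s) by apply: cg; exact: open_nbhs_nbhs.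
have cf : continuous f by case: sf.
have nd : \forall s \near t, cdom d (f (gam s)).
  have h : (f \o gam) @ t --> f (gam t) by apply: continuous_comp; [exact: cg|exact: cf].
  by apply: h; exact: open_nbhs_nbhs.
pose D i := 'D_(delta_mx 0 i) (coord_rep c d f).
have E : \forall s \near (t : R^o), \sum_i (vel c gam s) 0 i *: D i (cmap c (gam s)) =
    vel d (f \o gam) s.
  near=> s; have [cgs dgs] : {for s, continuous gam} /\
      derivable (cmap c \o gam : R^o -> 'rV[R]_n) (s : R^o) 1 by near: s; exact: ng.
  have gcs : cdom c (gam s) by near: s; exact: nc.
  have gds : cdom d (f (gam s)) by near: s; exact: nd.
  rewrite (vel_chain ac ad sf cgs gcs gds dgs).
  have Ds : coord_dom c d f (cmap c (gam s)) by split; [exists (gam s)|rewrite /= cK].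
  have [dF _] := Ck1_is_diff oD C1 Ds.
  by rewrite -deriveE // (Ck1_derive_sum _ oD C1 Ds).
have Dt : coord_dom c d f (cmap c (gam t)) by split; [exists (gam t)|rewrite /= cK].
have Et := nbhs_singleton E.
suff h : (fun s : R^o => \sum_i (vel c gam s) 0 i *: D i (cmap c (gam s))) @ (t : R^o) -->
    vel d (f \o gam) t.
  apply: cvg_trans h; apply: near_eq_cvg.
  by apply: filterS E => s ->.
rewrite -Et; apply: cvg_big => [|i _]; first exact: add_continuous.
apply: cvgZ.
  have := cv; move=> /cvgrPdist_lt hB; apply/cvgrPdist_lt => e e0.
  have := hB e e0; apply: filterS => s; apply: le_lt_trans.
  by have := normr_entry (vel c gam t - vel c gam s) 0 i; rewrite !mxE.
have cDi : {for cmap c (gam t), continuous (D i)} := Ck_continuous (CkD (delta_mx 0 i) C1) Dt.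
apply: (@continuous_comp _ _ _ (fun s => cmap c (gam s)) (D i)) => //.
by apply: (@continuous_comp _ _ _ gam (cmap c)); [exact: cg|exact: cc].
Unshelve. all: by end_near. Qed.

Lemma Ck1_curve (U : set R^o) (eta : R^o -> 'rV[R]_n) :
  (forall t, U t -> {for t, continuous eta}) -> (forall t, U t -> derivable eta t 1) ->
  (forall t, U t -> {for t, continuous ('D_1 eta)}) -> open U -> Ck 1 U eta.
Proof.
move=> c d c' oU; split; first exact: c.
move=> v.
have E t : U t -> is_derive t v eta (v *: 'D_1 eta t).
  by move=> Ut; have := derivable_dirZ v (d t Ut); rewrite [v *: (1 : R^o)]mulr1.
split; first by move=> t /E[].
split; last by [].
move=> t Ut.
have h := cvg_scale (a := v) (c' t Ut).
have nE : \forall s \near t, v *: 'D_1 eta s = 'D_v eta s.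
  have := open_nbhs_nbhs (conj oU Ut); apply: filterS => s Us.
  by have [_ ->] := E s Us.
have nEt := nbhs_singleton nE.
suff : ('D_v eta) @ t --> 'D_v eta t by [].
rewrite -nEt; apply: cvg_trans h; apply: near_eq_cvg.
by apply: filterS nE => s ->.
Qed.

Lemma C1_curve_translate (a : G) gam : C1_curve gam -> C1_curve (fun s => a * gam s)%g.
Proof.
move=> [U [oU IU cU hU]]; exists U; split; [exact: oU|exact: IU| |].
  move=> t Ut; apply: (@continuous_comp _ _ _ gam (fun x => a * x)%g); first exact: cU.
  exact: mull_continuous.
move=> d ad; have [od _ _ cd _] := atlas_is_chart _ ad.
have cag t : U t -> {for t, continuous (fun s => a * gam s)%g}.
  move=> Ut; apply: (@continuous_comp _ _ _ gam (fun x => a * x)%g); first exact: cU.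
  exact: mull_continuous.
have key t : U t -> cdom d (a * gam t)%g -> exists c, [/\ atlas c, cdom c (gam t),
    (\forall s \near t, {for s, continuous gam} /\
      derivable (cmap c \o gam : R^o -> 'rV[R]_n) (s : R^o) 1) &
    {for (t : R^o), continuous (fun s => vel c gam s)}].
  move=> Ut gd; have [ac gc] := chart_atP (gam t); exists (chart_at (gam t)).
  have [oc _ _ _ _] := atlas_is_chart _ ac.
  have C1 := hU _ ac; split; [exact: ac|exact: gc| |].
    have n1 : \forall s \near t, U s by exact: open_nbhs_nbhs.
    have n2 : \forall s \near t, cdom (chart_at (gam t)) (gam s).
      by apply: (cU t Ut); exact: open_nbhs_nbhs.
    near=> s; have Us : U s by near: s; exact: n1.
    split; first exact: cU.
    by apply: (Ck_derivable C1); split=> //; near: s; exact: n2.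
  have X := CkD (1 : R^o) C1.
  have Y := Ck_continuous X (conj Ut gc).
  exact: Y.
apply: Ck1_curve => [t [Ut gd]|t [Ut gd]|t [Ut gd]|].
- by apply: (@continuous_comp _ _ _ (fun s => a * gam s)%g (cmap d)); [exact: cag|exact: cd].
- have [c [ac gc ng _]] := key t Ut gd; have [_ dg] := nbhs_singleton ng.
  by have [] := chain_rule ac ad (mull_smooth a) (cU t Ut) gc gd dg.
- have [c [ac gc ng cv]] := key t Ut gd.
  exact: (vel_continuous_comp ac ad (mull_smooth a) gc gd (cU t Ut) ng cv).
rewrite openE => t [Ut gd]; apply: filterI; first exact: open_nbhs_nbhs.
by apply: (cag t Ut); exact: open_nbhs_nbhs.
Unshelve. all: by end_near. Qed.

End CurvesTranslation.

Lemma near_eq_cvg_at (T U : topologicalType) (f h : T -> U) (t : T) (l : U) :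
  (\forall s \near t, f s = h s) -> f @ t --> l -> h @ t --> l.
Proof.
by move=> E fl; apply: cvg_trans fl; apply: near_eq_cvg; apply: filterS E => s ->.
Qed.

Section Length.
Variables (R : realType) (n : nat) (G : lieGroupType R n) (g : riemannian_metric G).
Hypothesis li : left_invariant g.
Implicit Types (p q a : G) (c d : chart G 'rV[R]_n) (gam : R -> G) (t : R).

Lemma C1_curve_regular gam : C1_curve gam -> exists U : set R^o,
  [/\ open U, `[0, 1] `<=` U, forall t, U t -> {for t, continuous gam},
    forall t c, U t -> atlas c -> cdom c (gam t) ->
      derivable (cmap c \o gam : R^o -> 'rV[R]_n) (t : R^o) 1 &
    forall t, U t -> {for t, continuous (speed g gam)}].
Proof.
move=> [U [oU IU cU hU]]; exists U; split; [exact: oU|exact: IU|exact: cU| |].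
  by move=> t c Ut ac gc; apply: (Ck_derivable (hU c ac)).
move=> t Ut; have [c [ac gc]] := atlas_cover (gam t).
have [oc oi cK ccm cci] := atlas_is_chart _ ac.
have n1 : \forall s \near t, U s by exact: open_nbhs_nbhs.
have n2 : \forall s \near t, cdom c (gam s) by apply: (cU t Ut); exact: open_nbhs_nbhs.
have E : \forall s \near t, Num.sqrt (inner (metric_mx g c (cinv c (cmap c (gam s))))
    (vel c gam s) (vel c gam s)) = speed g gam s.
  near=> s; have Us : U s by near: s; exact: n1.
  have gs : cdom c (gam s) by near: s; exact: n2.
  rewrite (cK _ gs).
  have dgs : derivable (cmap c \o gam : R^o -> 'rV[R]_n) (s : R^o) 1.
    by apply: (Ck_derivable (hU c ac)).
  exact: (esym (speed_chart g ac (cU s Us) gs dgs)).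
have Et := nbhs_singleton E.
suff : speed g gam @ t --> speed g gam t by [].
rewrite -Et.
have h : (fun s => Num.sqrt (inner (metric_mx g c (cinv c (cmap c (gam s))))
    (vel c gam s) (vel c gam s))) @ t -->
    Num.sqrt (inner (metric_mx g c (cinv c (cmap c (gam t)))) (vel c gam t) (vel c gam t)).
  apply: (@continuous_comp _ _ _ (fun s => inner (metric_mx g c (cinv c (cmap c (gam s))))
    (vel c gam s) (vel c gam s)) Num.sqrt); last exact: sqrt_continuous.
  have X := CkD (1 : R^o) (hU c ac); have cv := Ck_continuous X (conj Ut gc).
  apply: inner_cvg; [|exact: cv|exact: cv].
  have ci : cimg c (cmap c (gam t)) by exists (gam t).
  have cm := Ck_continuous (metric_smooth g ac 0) ci.
  apply: (@continuous_comp _ _ _ (fun s => cmap c (gam s)) (fun x => metric_mx g c (cinv c x)));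
    last exact: cm.
  by apply: (@continuous_comp _ _ _ gam (cmap c)); [exact: cU|exact: ccm].
exact: (near_eq_cvg_at E h).
Unshelve. all: by end_near. Qed.

Lemma speed_ge0 gam t : 0 <= speed g gam t.
Proof. exact: sqrtr_ge0. Qed.

Lemma curve_length_ge0 gam : 0 <= curve_length g gam.
Proof. by apply: Rintegral_ge0 => t _; exact: speed_ge0. Qed.

Lemma curve_length_translate a gam : C1_curve gam ->
  curve_length g (fun s => a * gam s)%g = curve_length g gam.
Proof.
move=> /C1_curve_regular[U [oU IU cU dU _]]; apply: eq_Rintegral => t; rewrite inE => It.
have [ac gc] := chart_atP (gam t).
by apply: speed_translate => //; [exact: cU (IU _ It)|exact: dU (IU _ It) ac gc].
Qed.

Lemma path_translate a p s q : piecewise_C1_from_to p s q ->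
  piecewise_C1_from_to (a * p)%g [seq (fun t => a * gam t)%g | gam <- s] (a * q)%g /\
  \sum_(gam <- [seq (fun t => a * gam t)%g | gam <- s]) curve_length g gam =
  \sum_(gam <- s) curve_length g gam.
Proof.
elim: s p => [|gam s ih] p /=; first by move=> ->; rewrite !big_nil.
move=> [c1 g0 /ih[ih1 ih2]]; rewrite !big_cons ih2 curve_length_translate //.
by split=> //; split=> //; [exact: C1_curve_translate|rewrite g0].
Qed.

Lemma path_cat p s q s' q' : piecewise_C1_from_to p s q ->
  piecewise_C1_from_to q s' q' -> piecewise_C1_from_to p (s ++ s') q'.
Proof.
elim: s p => [|gam s ih] p /=; first by move=> ->.
by move=> [c1 g0 h] h'; split=> //; exact: ih h h'.
Qed.

Definition lengths p q : set R := [set \sum_(gamma <- s) curve_length g gamma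
  | s in [set s | piecewise_C1_from_to p s q]].

Lemma lengths_lb p q : has_lbound (lengths p q).
Proof.
exists 0 => _ [s _ <-]; apply: sumr_ge0 => gam _; exact: curve_length_ge0.
Qed.

Lemma dist_left a p q :
  riemannian_dist g (a * p)%g (a * q)%g = riemannian_dist g p q.
Proof.
have sub b p' q' : lengths p' q' `<=` lengths (b * p')%g (b * q')%g.
  by move=> _ [s hs <-]; have [h <-] := path_translate b hs; eexists; first exact: h.
rewrite /riemannian_dist -/(lengths p q) -/(lengths _ _); congr inf.
apply/seteqP; split; last exact: sub.
by have := sub a^-1%g (a * p)%g (a * q)%g; rewrite !mulKg.
Qed.

Lemma dist_ge0 p q : 0 <= riemannian_dist g p q.
Proof.
rewrite /riemannian_dist -/(lengths p q).
have [->|/set0P h] := eqVneq (lengths p q) set0; first by rewrite inf0.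
apply: lb_le_inf => // _ [s _ <-]; apply: sumr_ge0 => gam _; exact: curve_length_ge0.
Qed.

(** A derivative at [p] in left-translated coordinates, bounded by [M]; by left invariance of the
    metric such a bound has the same meaning at every [p]. *)
Definition tame (f : G -> R) p M := exists (l : 'rV[R]_n -> R) (K e : R),
  [/\ forall x y, l (x + y) = l x + l y, forall (a : R) x, l (a *: x) = a * l x,
      forall x, `|l x| <= M * `|x|, 0 < e &
      forall x, `|x| < e -> `|f (p * pnt G x)%g - f p - l x| <= K * `|x| ^+ 2].

(** A chain rule from a pointwise expansion with quadratic remainder, which is the form of
    differentiability known for functions obtained by sewing. *)
Lemma is_derive_expand (eta : R^o -> 'rV[R]_n) (w : 'rV[R]_n) (f : R -> R) t
    (l : 'rV[R]_n -> R) (M K : R) : 0 <= M ->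
  (forall x y, l (x + y) = l x + l y) -> (forall (a : R) x, l (a *: x) = a * l x) ->
  (forall x, `|l x| <= M * `|x|) -> eta t = 0 -> is_derive (t : R^o) 1 eta w ->
  (\forall s \near t, `|f s - f t - l (eta s)| <= K * `|eta s| ^+ 2) ->
  is_derive (t : R) 1 f (l w).
Proof.
move=> M0 lD lZ l_le eta0 [deta Dw] hf.
have lN x : l (- x) = - l x by rewrite -scaleN1r lZ mulN1r.
have cw : (fun h : R => h^-1 *: eta (h + t)) @ 0^' --> w.
  have := deta; rewrite /derivable => /cvg_ex[/= w' hw'].
  have E : (fun h : R => h^-1 *: (eta (h *: (1 : R^o) + t) - eta t)) =
      (fun h : R => h^-1 *: eta (h + t)).
    by apply/funext => h; rewrite eta0 subr0 [h *: (1 : R^o)]mulr1.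
  have ww' : w = w' by rewrite -Dw /derive; apply: cvg_lim hw'.
  by rewrite ww'; move: hw'; rewrite /= -E.
suff h : (fun h : R => h^-1 *: (f (h *: (1 : R) + t) - f t)) @ 0^' --> l w.
  by split; [apply/cvg_ex; exists (l w)|apply: cvg_lim h].
apply/cvgrPdist_le => eps eps0.
pose A := M + 1; pose B := `|K| * (`|w| + 1) ^+ 2 + 1.
have A0 : 0 < A by rewrite ltr_wpDl.
have B0 : 0 < B by rewrite ltr_wpDl // mulr_ge0 // exprn_ge0 // addr_ge0.
pose d := Num.min 1 (eps / 2 / A); have d0 : 0 < d by rewrite lt_min ltr01 !divr_gt0.
have n1 : \forall h \near (0 : R)^', `|w - h^-1 *: eta (h + t)| <= d.
  by move/cvgrPdist_le : cw => /(_ d d0).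
have n2 : \forall h \near (0 : R)^', `|f (h + t) - f t - l (eta (h + t))| <= K * `|eta (h + t)| ^+ 2.
  apply: cvg_within.
  have c : (fun h : R => h + t) @ (0 : R) --> t.
    by rewrite -[X in _ --> X]add0r; apply: cvgD; [exact: cvg_id|exact: cvg_cst].
  exact: (c _ hf).
near=> h.
have h0 : h != 0 by near: h; exact: nbhs_dnbhs_neq.
have hb : `|h| <= eps / 2 / B.
  near: h; apply: dnbhs0_le; by rewrite !divr_gt0.
have a1 : `|w - h^-1 *: eta (h + t)| <= d by near: h; exact: n1.
have a2 : `|f (h + t) - f t - l (eta (h + t))| <= K * `|eta (h + t)| ^+ 2 by near: h; exact: n2.
rewrite [h *: (1 : R)]mulr1 /=; set z := eta (h + t) in a1 a2 *.
have -> : l w - h^-1 *: (f (h + t) - f t) =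
    l (w - h^-1 *: z) - h^-1 * (f (h + t) - f t - l z).
  by rewrite lD lN lZ [h^-1 *: _]mulrBr; ring.
apply: le_trans (ler_normB _ _) _; rewrite (splitr eps); apply: lerD.
  apply: le_trans (l_le _) _; apply: (@le_trans _ _ (A * d)).
    by apply: ler_pM => //; rewrite lerDl.
  by rewrite -ler_pdivlMl // mulrC /d ge_min lexx orbT.
have hp : 0 < `|h| by rewrite normr_gt0.
have zle : `|z| <= `|h| * (`|w| + 1).
  have -> : z = h *: (h^-1 *: z) by rewrite scalerA mulfV // scale1r.
  rewrite normrZ; apply: ler_wpM2l => //.
  rewrite -(subrK w (h^-1 *: z)); apply: le_trans (ler_normD _ _) _.
  rewrite addrC lerD2l distrC; apply: le_trans a1 _; by rewrite /d ge_min lexx.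
rewrite normrM normfV.
apply: (@le_trans _ _ (`|h|^-1 * (`|K| * (`|h| * (`|w| + 1)) ^+ 2))).
  apply: ler_wpM2l; first by rewrite invr_ge0.
  apply: le_trans a2 _; apply: (@le_trans _ _ (`|K| * `|z| ^+ 2)).
    by apply: ler_wpM2r; [exact: exprn_ge0|exact: ler_norm].
  by apply: ler_wpM2l => //; apply: lerXn2r; rewrite ?nnegrE // mulr_ge0 // addr_ge0.
have -> : `|h|^-1 * (`|K| * (`|h| * (`|w| + 1)) ^+ 2) = `|h| * (`|K| * (`|w| + 1) ^+ 2).
  by field; rewrite gt_eqF.
apply: (@le_trans _ _ (`|h| * B)); first by rewrite ler_wpM2l // lerDl.
by rewrite -ler_pdivlMr.
Unshelve. all: by end_near. Qed.

(** The curve is translated by the inverse of [gam t]; [w] is its velocity at the identity, so the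
    metric at 1 alone compares the derivative with the speed. *)
Lemma derive_along_curve gam t (f : G -> R) (M : R) : 0 <= M -> {for t, continuous gam} ->
  (forall c, atlas c -> cdom c (gam t) ->
    derivable (cmap c \o gam : R^o -> 'rV[R]_n) (t : R^o) 1) ->
  tame f (gam t) M -> exists w : 'rV[R]_n, exists2 D,
    is_derive (t : R) 1 (f \o gam) D & `|D| <= M * `|w| /\
    speed g gam t = Num.sqrt (inner (metric_mx g (chart1 G) 1%g) w w).
Proof.
move=> M0 cg dg [l [K [e [lD lZ l_le e0 hf]]]].
have [ac gc] := chart_atP (gam t); set c := chart_at _ in ac gc.
have g1 : ((gam t)^-1 * gam t = 1)%g by rewrite mulVg.
have d1 : cdom (chart1 G) ((gam t)^-1 * gam t)%g by rewrite g1; exact: cdom1.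
have a1 := atlas1 G.
pose a := (gam t)^-1%g.
pose gam' := ((fun x : G => a * x)%g \o gam).
have [dD _] := chain_rule ac a1 (mull_smooth a) cg gc d1 (dg c ac gc).
have D := vel_chain ac a1 (mull_smooth a) cg gc d1 (dg c ac gc).
pose eta := (fun s : R^o => crd (gam' s)) : R^o -> 'rV[R]_n.
have deta : is_derive (t : R^o) 1 eta (vel (chart1 G) gam' t).
  have E : (fun h : R => h^-1 *: (eta (h *: (1 : R^o) + t) - eta t)) =
      (fun h : R => h^-1 *: ((cmap (chart1 G) \o gam') (h *: (1 : R^o) + t) -
        (cmap (chart1 G) \o gam') t)).
    apply/funext => h; congr (_ *: _); rewrite /eta /crd /=.
    by rewrite opprB addrA subrK.
  split; first by rewrite /derivable E.
  by rewrite /derive E.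
exists (vel (chart1 G) gam' t), (l (vel (chart1 G) gam' t)).
  apply: (@is_derive_expand eta _ (f \o gam) t l M K) => //.
    by rewrite /eta /gam' /= g1 crd1.
  have c' : {for t, continuous gam'}.
    apply: (@continuous_comp _ _ _ gam (fun x : G => a * x)%g) => //.
    exact: mull_continuous.
  have nd : \forall s \near t, chart_ball e (gam' s).
    by apply: c'; rewrite /gam' /= g1; exact: chart_ball_nbhs.
  apply: filterS nd => s [Ds hs]; have := hf _ hs.
  by rewrite /eta (crdK Ds) /gam' /= mulVKg.
split; first exact: l_le.
have /= M1 := @li a _ _ _ (vel c gam t) (vel c gam t) ac a1 gc d1.
by rewrite speed_vel -/c -M1 -D g1.
Qed.

(* The speed is continuous, so its integral [S] is differentiable, and [M / c * S] dominates the variation of [f]. *)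
Lemma growth_on_curve : exists2 c : R, 0 < c & forall gam (f : G -> R) M, C1_curve gam -> 0 <= M ->
  (forall t, t \in `[0, 1] -> tame f (gam t) M) -> forall t, t \in `[0, 1] ->
  `|f (gam t) - f (gam 0)| <= M * c * curve_length g gam.
Proof.
have [c c0 hc] := inner_lower (fun u => metric_pos g (atlas1 G) (cdom1 G) (u := u)).
exists c^-1; first by rewrite invr_gt0.
move=> gam f M C1 M0 tf t It.
have [U [oU IU cU dU sU]] := C1_curve_regular C1.
pose S x : R := \int[lebesgue_measure]_(s in `[0, x]) speed g gam s.
have cs : {within `[0, 1], continuous (speed g gam)}.
  by apply: continuous_in_subspaceT => s; rewrite inE => /IU; exact: sU.
have iS : lebesgue_measure.-integrable `[0, 1] (EFin \o speed g gam).
  by apply: continuous_compact_integrable => //; exact: segment_compact.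
have DS s : s \in `]0, 1[ -> derivable S s 1 /\ S^`()%classic s = speed g gam s.
  rewrite in_itv /= => /andP[s0 s1]; apply: (continuous_FTC1_closed s1) => //.
  by apply: sU; apply: IU; rewrite /= in_itv /= !ltW.
have cS : {within `[0, 1], continuous S}.
  exact: (parameterized_integral_continuous ler01 iS).
have df s : s \in `[0, 1] -> exists2 D, is_derive (s : R) 1 (f \o gam) D &
    `|D| <= M * c^-1 * speed g gam s.
  move=> Is; have Us := IU s Is.
  have [w [D hD [h1 h2]]] := derive_along_curve M0 (cU s Us) (fun d => dU s d Us) (tf s Is).
  exists D => //; apply: le_trans h1 _; rewrite -mulrA ler_wpM2l //.
  by rewrite h2 mulrC ler_pdivlMr // mulrC.
have zI : (0 : R) \in `[0, 1] by rewrite in_itv /= lexx ler01.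
have cfg : {within `[0, 1], continuous (f \o gam)}.
  by apply: derivable_within_continuous => s /df[D []].
have St : S t <= curve_length g gam.
  have S'0 s : s \in `]0, 1[ -> 0 <= S^`()%classic s by move=> /DS[_ ->]; exact: speed_ge0.
  have oI : (1 : R) \in `[0, 1] by rewrite in_itv /= lexx ler01.
  have := ger0_derive1_le_cc (fun s Is => (DS s Is).1) S'0 cS It oI.
  by move: It; rewrite in_itv /= => /andP[_ t1]; apply.
have S0 : S 0 = 0 by rewrite /S set_itv1 Rintegral_set1.
have mono (e : R) : `|e| = 1 -> e * (f (gam t) - f (gam 0)) <= M * c^-1 * S t.
  move=> e1; pose h s := M * c^-1 * S s - e * f (gam s).
  have hd s : s \in `]0, 1[ -> derivable h s 1 /\ 0 <= h^`()%classic s.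
    move=> Is; have [dS ES] := DS s Is; have [D hD hDle] := df s (subset_itv_oo_cc Is).
    have [dfs Ef] := hD.
    have d1 : is_derive (s : R) 1 (fun x => M * c^-1 * S x) (M * c^-1 * speed g gam s).
      have := is_deriveZ (M * c^-1) (derivableP dS); rewrite -derive1E ES.
      by [].
    have d2 : is_derive (s : R) 1 (fun x => e * f (gam x)) (e * D).
      exact: (is_deriveZ e hD).
    have [d3 E3] := is_deriveB d1 d2.
    split; first exact: d3.
    rewrite derive1E E3 subr_ge0; apply: le_trans hDle.
    by apply: le_trans (ler_norm _) _; rewrite normrM e1 mul1r.
  have ch : {within `[0, 1], continuous h}.
    move=> x; apply: cvgB; apply: cvgM; try exact: cvg_cst; [exact: cS|exact: cfg].
  have := ger0_derive1_le_cc (fun s Is => (hd s Is).1) (fun s Is => (hd s Is).2) ch zI It.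
  move: It; rewrite in_itv /= => /andP[t0 _]; move=> /(_ t0).
  by rewrite /h S0; lra.
have h1 := mono 1 (normr1 _); have := mono (-1); rewrite normrN normr1 => /(_ erefl) h2.
have h3 : M * c^-1 * S t <= M * c^-1 * curve_length g gam.
  by apply: ler_wpM2l => //; rewrite mulr_ge0 // invr_ge0 ltW.
by apply: le_trans h3; rewrite ler_norml; apply/andP; split; lra.
Qed.

End Length.

Section Segments.
Variables (R : realType) (n : nat) (G : lieGroupType R n) (g : riemannian_metric G).
Hypothesis li : left_invariant g.
Hypothesis sc : simply_connected R G.
Implicit Types (p q : G) (gam : R -> G) (t : R).
Local Notation pnt := (@pnt R n G).
Local Notation crd := (@crd R n G).
Local Notation d := (riemannian_dist g).

(** Segments of the chart through 0 have bounded speed, since the metric is bounded near the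
    identity. *)
Lemma segment_curve : exists rho K : R, [/\ 0 < rho, 0 <= K & forall u : G, chart_ball rho u ->
  exists gam : R -> G, [/\ C1_curve gam, gam 0 = 1%g, gam 1 = u & curve_length g gam <= K]].
Proof.
have [r [C [b law]]] := group_law_expansion G; have [r0 _ _ _ _] := law.
have a1 := atlas1 G; have [oc oi cK ccm cci] := chart1P G.
pose x0 := cmap (chart1 G) (1%g : G).
pose m y := metric_mx g (chart1 G) (pnt y).
have I0 : cimg (chart1 G) (x0 + 0) by rewrite addr0; exists 1%g => //; exact: cdom1.
have cm : {for (0 : 'rV[R]_n), continuous m}.
  have h := Ck_continuous (metric_smooth g a1 0) I0.
  apply: (@continuous_comp _ _ _ (fun y => x0 + y) (fun x => metric_mx g (chart1 G) (cinv (chart1 G) x))).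
    exact: continuous_addl.
  exact: h.
pose M := `|m 0| + 1.
have nM : \forall y \near (0 : 'rV[R]_n), `|m y| <= M.
  have /cvgrPdistC_le /(_ 1 ltr01) := cm; apply: filterS => y hy.
  rewrite -(subrK (m 0) (m y)); apply: le_trans (ler_normD _ _) _.
  by rewrite addrC /M lerD2l.
have /nbhs_ballP[e /= e0 he] := nM.
pose rho := Num.min r e.
have rho0 : 0 < rho by rewrite lt_min r0 e0.
pose K := Num.sqrt (n%:R * n%:R * M * rho ^+ 2).
exists rho, K; split; [exact: rho0|exact: sqrtr_ge0|].
move=> u [Du urho]; pose x := crd u; pose gam t := pnt (t *: x).
pose U : set R^o := [set t | `|t *: x| < rho].
have cts (t : R) : {for t, continuous (fun s : R => s *: x)}.
  by apply: cvgZr_tmp; exact: cvg_id.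
have oU : open U.
  by rewrite openE => t Ut; exact: (@near_norm_lt R n _ (fun s : R^o => s *: x) t rho (cts t) Ut).
have IU : `[0, 1] `<=` U.
  move=> t /=; rewrite in_itv /= => /andP[t0 t1]; rewrite /U /= normrZ ger0_norm //.
  by apply: le_lt_trans urho; rewrite ler_piMl.
have Ur t : U t -> `|t *: x| < r by rewrite /U /= lt_min => /andP[].
have Ue t : U t -> `|t *: x| < e by rewrite /U /= lt_min => /andP[].
have cgam t : U t -> {for t, continuous gam}.
  move=> Ut; apply: (@continuous_comp _ _ _ (fun s : R^o => s *: x) pnt); first exact: cts.
  by apply: (pnt_cont law); exact: Ur.
pose A (t : R^o) : 'rV[R]_n := x0 + t *: x.
have cA : continuous A.
  move=> t; apply: (@continuous_comp _ _ _ (fun s : R^o => s *: x) (fun y => x0 + y)).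
    exact: cts.
  exact: continuous_addl.
have hA (h : R) (v z : R^o) : A (h *: v + z) = h *: (v *: x) + A z.
  by rewrite /A scalerDl addrCA scalerA.
have CU c : atlas c -> Ck 1 (U `&` [set t | cdom c (gam t)]) (cmap c \o gam : R^o -> 'rV[R]_n).
  move=> ac; have [oD C1] := coord_rep_C1 a1 ac (@id_smooth R n G).
  have := Ck_comp_affine cA hA C1; apply: Ck_sub => t [Ut ht]; split => /=; last exact: ht.
  by case: law => _ _ _ _ /(_ _ _ (Ur _ Ut) (Ur _ Ut))[].
have C1g : C1_curve gam by exists U; split; [exact: oU|exact: IU|exact: cgam|exact: CU].
exists gam; split; [exact: C1g|by rewrite /gam scale0r pnt0|by rewrite /gam scale1r crdK|].
have [U' [oU' IU' cU' dU' sU']] := C1_curve_regular g C1g.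
have sp t : t \in `[0, 1] -> speed g gam t <= K.
  move=> It; have Ut := IU t It; have [Dt Et] := pnt_dom law (Ur t Ut).
  rewrite (speed_chart g a1 (cgam t Ut) Dt (dU' t _ (IU' t It) a1 Dt)).
  have -> : vel (chart1 G) gam t = x.
    have E : \forall s \near (t : R^o), A s = (cmap (chart1 G) \o gam) s.
      have := open_nbhs_nbhs (conj oU Ut); apply: filterS => s Us.
      have [_ Es] := pnt_dom law (Ur s Us).
      by rewrite /A /gam -[in LHS]Es /crd addrC subrK.
    have DA : is_derive (t : R^o) 1 A x.
      have F : (fun h : R => h^-1 *: (A (h *: (1 : R^o) + t) - A t)) @ 0^' --> x.
        have E2 : {near (0 : R)^', (fun _ : R => x) =1
            (fun h : R => h^-1 *: (A (h *: (1 : R^o) + t) - A t))}.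
          near=> h; have h0 : h != 0 by near: h; exact: nbhs_dnbhs_neq.
          by rewrite hA addrK scale1r scalerA mulVf // scale1r.
        by apply: cvg_trans (near_eq_cvg E2) _; exact: cvg_cst.
      by split; [apply/cvg_ex; exists x|apply: cvg_lim F].
    by have [_] := near_eq_is_derive E DA.
  rewrite /K; apply: ler_wsqrtr; apply: le_trans (ler_norm _) _.
  apply: le_trans (inner_le _ _) _; apply: ler_pM.
  - by rewrite !mulr_ge0.
  - exact: exprn_ge0.
  - by apply: ler_wpM2l; [rewrite mulr_ge0|apply: he; rewrite -ball_normE /= sub0r normrN; exact: Ue].
  by apply: lerXn2r; rewrite ?nnegrE //; exact: ltW.
have cs : {within `[0, 1], continuous (speed g gam)}.
  by apply: continuous_in_subspaceT => s; rewrite inE => /IU'; exact: sU'.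
have iS : lebesgue_measure.-integrable `[0, 1] (EFin \o speed g gam).
  by apply: continuous_compact_integrable => //; exact: segment_compact.
have cK' : {within `[0, 1], continuous (fun _ : R => K)}.
  by apply: continuous_in_subspaceT => s _; exact: cvg_cst.
have iK : lebesgue_measure.-integrable `[0, 1] (EFin \o (fun _ : R => K)).
  by apply: continuous_compact_integrable => //; exact: segment_compact.
rewrite /curve_length; apply: (@le_trans _ _ (\int[lebesgue_measure]_(t in `[0, 1]) K)).
  by apply: le_Rintegral => // t It; exact: sp.
by rewrite Rintegral_cst //= lebesgue_measure_itv /= lte01 oppr0 adde0 /= mulr1.
Unshelve. all: by end_near. Qed.

(** Ensures that the infimum defining the distance is genuine, and not the default value 0 of the
    empty set. *)
Lemma lengths_neq0 p q : lengths g p q !=set0.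
Proof.
have [rho [K [rho0 K0 hseg]]] := segment_curve; have [pc _] := sc.
suff h : forall q', exists s, piecewise_C1_from_to (1%g : G) s q'.
  have [s hs] := h (p^-1 * q)%g.
  have [] := path_translate li p hs; rewrite mulg1 mulVKg => h1 h2.
  by eexists; eexists; first exact: h1.
apply: (group_ind_nbhs pc (chart_ball_nbhs G rho0)) => [|p' u [s hs] hu]; first by exists [::].
have [gam [c1 g0 g1 _]] := hseg u hu.
have hu1 : piecewise_C1_from_to (1%g : G) [:: gam] u by split.
have [h1 _] := path_translate li p' hu1; rewrite mulg1 in h1.
by exists (s ++ [seq (fun t => p' * gam0 t)%g | gam0 <- [:: gam]]); exact: path_cat hs h1.
Qed.

Lemma dist_triangle p q q' : d p q' <= d p q + d q q'.
Proof.
apply/ler_addgt0Pr => e e0; rewrite addrAC -lerBlDr.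
have e2 : 0 < e / 2 by rewrite divr_gt0.
have [_ [s hs <-] h1] := inf_adherent e2 (conj (lengths_neq0 p q) (lengths_lb g p q)).
have [_ [s' hs' <-] h2] := inf_adherent e2 (conj (lengths_neq0 q q') (lengths_lb g q q')).
have : d p q' <= \sum_(gam <- s ++ s') curve_length g gam.
  apply: ge_inf; first exact: lengths_lb.
  by exists (s ++ s') => //; exact: path_cat hs hs'.
rewrite big_cat /=; rewrite -/(d p q) in h1; rewrite -/(d q q') in h2; lra.
Qed.

Lemma dist_bounded_near1 : exists rho K : R, [/\ 0 < rho, 0 <= K &
  forall u : G, chart_ball rho u -> d 1%g u <= K].
Proof.
have [rho [K [rho0 K0 hseg]]] := segment_curve; exists rho, K; split=> // u /hseg[gam [c1 g0 g1 hK]].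
apply: le_trans hK; apply: ge_inf; first exact: lengths_lb.
by exists [:: gam]; [split|rewrite big_seq1].
Qed.

Lemma dist_expg u k : d 1%g (u ^+ k)%g <= k%:R * d 1%g u.
Proof.
have d0 : d 1%g 1%g <= 0.
  apply: ge_inf; first exact: lengths_lb.
  by exists [::] => //; rewrite big_nil.
elim: k => [|k ih]; first by rewrite expg0 mul0r.
apply: le_trans (dist_triangle _ (u ^+ k)%g _) _.
have -> : d (u ^+ k)%g (u ^+ k.+1)%g = d 1%g u.
  by rewrite -{1}[(u ^+ k)%g]mulg1 expgSr dist_left.
by rewrite -natr1 mulrDl mul1r lerD2r.
Qed.

(* [phi] controls the derivative of [f]; the control is itself bounded by the length. *)
Lemma growth_from1 : exists2 c : R, 0 < c & forall (I : Type) (phi : I -> G -> R) (f : G -> R) (M0 M : R),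
  0 <= M0 -> 0 <= M ->
  (forall i p, tame (phi i) p M0) -> (forall i, phi i 1%g = 0) ->
  (forall p e, 0 <= e -> (forall i, `|phi i p| <= e) -> tame f p (M * (1 + e))) ->
  f 1%g = 0 ->
  forall p, `|f p| <= M * (1 + M0 * c * d 1%g p) * c * d 1%g p.
Proof.
have [c c0 hc] := growth_on_curve li; exists c => // I phi f M0 M M00 M1 th h0 tf f0 p.
suff key (l : R) : lengths g 1%g p l -> `|f p| <= M * (1 + M0 * c * l) * c * l.
  apply/ler_addgt0Pr => e e0.
  pose D := d 1%g p; have D0 : 0 <= D by exact: dist_ge0.
  (* Bounds the rate at which the estimate grows with [l] between [D] and [D + 1], so that [l] may
     be taken close enough to [D]. *)
  pose B := M * c * (1 + M0 * c * (2 * D + 1)) + 1.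
  have Mc : 0 <= M * c by rewrite mulr_ge0 // ltW.
  have M0c : 0 <= M0 * c by rewrite mulr_ge0 // ltW.
  have D21 : 0 <= 2 * D + 1 by lra.
  have B0 : 0 < B by rewrite ltr_wpDl // mulr_ge0 // addr_ge0 // mulr_ge0.
  pose eta := Num.min 1 (e / B); have eta0 : 0 < eta by rewrite lt_min ltr01 divr_gt0.
  have [l hl h1] := inf_adherent eta0 (conj (lengths_neq0 1%g p) (lengths_lb g 1%g p)).
  have h2 : D <= l by apply: ge_inf hl; exact: lengths_lb.
  rewrite -/(d 1%g p) -/D in h1.
  apply: le_trans (key l hl) _; rewrite -/D.
  have e1 : eta <= 1 by rewrite ge_min lexx.
  have e2 : B * eta <= e by rewrite mulrC -ler_pdivlMr // ge_min lexx orbT.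
  have -> : M * (1 + M0 * c * l) * c * l = M * (1 + M0 * c * D) * c * D +
     M * c * (1 + M0 * c * (l + D)) * (l - D) by ring.
  rewrite lerD2l; apply: le_trans e2.
  have lD0 : 0 <= l - D by rewrite subr_ge0.
  apply: ler_pM => //; [|rewrite /B|by lra].
    by rewrite mulr_ge0 // addr_ge0 // mulr_ge0 // addr_ge0 //; lra.
  apply: (@le_trans _ _ (M * c * (1 + M0 * c * (2 * D + 1)))); last by rewrite lerDl.
  by apply: ler_wpM2l => //; rewrite lerD2l; apply: ler_wpM2l => //; lra.
move=> [s hs <-] {l}.
set L := \sum_(gam <- s) _.
(* [a] bounds the length travelled before [q]; through it [phi] stays controlled along the remaining
   pieces. *)
suff gen q s' a : piecewise_C1_from_to q s' p ->
    a + \sum_(gam <- s') curve_length g gam <= L -> 0 <= a ->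
    (forall i, `|phi i q| <= M0 * c * a) ->
    `|f p - f q| <= M * (1 + M0 * c * L) * c * \sum_(gam <- s') curve_length g gam.
  have := gen 1%g s 0 hs; rewrite add0r f0 subr0; apply=> // i.
  by rewrite h0 // normr0 mulr0.
have M0c : 0 <= M0 * c by rewrite mulr_ge0 // ltW.
elim: s' q a => [|gam s' ih] q a /=.
  by move=> -> _ _ _; rewrite subrr normr0 big_nil mulr0.
move=> [c1 g0 hp]; rewrite !big_cons => hL a0 ha.
have lg0 := curve_length_ge0 g gam.
have ls0 : 0 <= \sum_(j <- s') curve_length g j by apply: sumr_ge0 => j _; exact: curve_length_ge0.
have oI : (1 : R) \in `[0, 1] by rewrite in_itv /= lexx ler01.
have hgam t i : t \in `[0, 1] -> `|phi i (gam t)| <= M0 * c * (a + curve_length g gam).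
  move=> It; have := hc gam (phi i) M0 c1 M00 (fun t _ => th i (gam t)) t It.
  rewrite g0 => h1; have h2 := ha i; rewrite mulrDr.
  rewrite -(subrK (phi i q) (phi i (gam t))) addrC; apply: le_trans (ler_normD _ _) _.
  exact: lerD.
have aL : a + curve_length g gam <= L by lra.
have L0 : 0 <= L by lra.
have tft t : t \in `[0, 1] -> tame f (gam t) (M * (1 + M0 * c * L)).
  move=> It; apply: tf => [|i]; first exact: mulr_ge0.
  by apply: le_trans (hgam t i It) _; exact: ler_wpM2l.
have ML : 0 <= M * (1 + M0 * c * L) by rewrite mulr_ge0 // addr_ge0 // mulr_ge0.
have h1 := hc gam f _ c1 ML tft 1 oI; rewrite g0 in h1.
have h2 := ih (gam 1) (a + curve_length g gam) hp.
rewrite mulrDr -(subrK (f (gam 1)) (f p)) -addrA addrC.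
apply: le_trans (ler_normD _ _) _; apply: lerD; first exact: h1.
apply: h2; [by rewrite -addrA|by rewrite addr_ge0|move=> i; exact: hgam].
Qed.

End Segments.

(** * Quadratic growth of commutators *)

Section QuadraticGrowth.
Variables (R : realType) (n : nat) (G : lieGroupType R n) (g : riemannian_metric G).
Hypothesis li : left_invariant g.
Hypothesis sc : simply_connected R G.
Implicit Types (p q : G) (x y u v w : 'rV[R]_n).
Local Notation pnt := (@pnt R n G).
Local Notation crd := (@crd R n G).
Local Notation d := (riemannian_dist g).

Lemma tame_le (f : G -> R) p (M M' : R) : M <= M' -> tame f p M -> tame f p M'.
Proof.
move=> MM' [l [K [e [lD lZ l_le e0 h]]]]; exists l, K, e; split=> // x.
by apply: le_trans (l_le x) _; exact: ler_wpM2r.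
Qed.

Lemma linear_growth : exists2 c : R, 0 < c & forall (f : G -> R) (M : R), 0 <= M ->
  (forall p, tame f p M) -> f 1%g = 0 -> forall p, `|f p| <= M * c * d 1%g p.
Proof.
have [c c0 hc] := growth_from1 li sc; exists c => // f M M0 tf f1 p.
have := hc void (fun i => match i with end) f 0 M (lexx 0) M0 _ _ _ f1 p.
rewrite !mul0r addr0 mulr1; apply=> // p' e e0 _.
by apply: tame_le (tf p'); rewrite ler_peMr // lerDl.
Qed.

Variables (r C : R) (b : 'rV[R]_n -> 'rV[R]_n -> 'rV[R]_n).
Hypothesis law : @local_law R n G r C b.
Local Notation lie := (bracket b).

Lemma character_tame m (A : 'M[R]_(n, m)) (phi : G -> 'rV[R]_m) (e K : R) :
  (forall p q, phi (p * q)%g = phi p + phi q) -> 0 < e ->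
  (forall x, `|x| < e -> `|phi (pnt x) - x *m A| <= K * `|x| ^+ 2) ->
  forall j p, tame (fun q => phi q 0 j) p (n%:R * `|A|).
Proof.
move=> phiM e0 h j p; exists (fun x => (x *m A) 0 j), K, e; split=> //.
- by move=> x y; rewrite mulmxDl mxE.
- by move=> a x; rewrite -scalemxAl mxE.
- by move=> x; apply: le_trans (normr_coord _ _) (normr_mulmx _ _).
move=> x /h; apply: le_trans.
apply: le_trans (normr_coord _ j); rewrite phiM !mxE.
by rewrite [X in `|X - _|]addrAC subrr add0r.
Qed.

Hypothesis nilG : nilpotent_group G.
Hypothesis nab : ~ abelian_group G.

Lemma ler_half (a c : R) : 0 <= a -> a <= c -> 2^-1 * a <= c.
Proof. by move=> a0 ac; lra. Qed.

(** The derivative of the primitive [F] at [p] is bounded by a multiple of [1 + |phi p|], and [phi]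
    grows at most linearly, so [F] grows at most quadratically. On commutators of [k]-th powers it
    takes values of order [k ^ 2]. *)
Lemma nonabelian_quadratic_growth : exists (z1 z2 : G) (a1 a2 : R), [/\ 0 < a1, 0 < a2 &
  forall k : nat, a1 * k%:R ^+ 2 <= a2 * (1 + d 1%g [~ z1 ^+ k, z2 ^+ k]%g) ^+ 2].
Proof.
have [r0 C0 _ _ _] := law.
have lDl := bracketDl law; have lDr := bracketDr law.
have lZl := bracketZl law; have lZr := bracketZr law.
have l_le := bracket_le law.
have nz : exists x y, lie x y != 0.
  apply: contrapT => h; apply: nab; apply: (bracket0_abelian law sc) => x y.
  by apply/eqP/negPn/negP => hxy; apply: h; exists x, y.
have [s hs] := nested_bracket_nilpotent law nilG.
have [om [omW [x0 [y0 hxy]]]] :=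
  exists_quadratic_functional lDl lDr lZl lZr (ex_intro _ s hs) nz.
set W := derived_mx lie in omW.
(* [A] projects onto the quotient by the derived algebra and its pseudo-inverse [A'] chooses
   representatives; [phi] integrates [A] to the group. *)
pose A := cokermx W; pose A' := pinvmx A.
have lieW u v : (lie u v <= W)%MS by exact: lie_derived.
have lieA u v : lie u v *m A = 0 by apply/eqP; rewrite -submxE.
have [phi [phiM [e [K [e0 K0 hphi]]]]] := exists_character law sc lieA.
pose U p := phi p *m A'.
have UM p q : U (p * q)%g = U p + U q by rewrite /U phiM mulmxDl.
pose l x := (x *m om) 0 0.
have lD x y : l (x + y) = l x + l y by rewrite /l mulmxDl mxE.
have lZ (a : R) x : l (a *: x) = a * l x by rewrite /l -scalemxAl mxE.
pose Ml := n%:R * `|om|; have Ml0 : 0 <= Ml by rewrite mulr_ge0.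
have lle x : `|l x| <= Ml * `|x| by apply: le_trans (normr_coord _ _) (normr_mulmx _ _).
(* Biadditive because [U] is additive; nothing is lost in passing to representatives, as [om] kills
   brackets with derived elements. *)
pose beta p q := 2^-1 * l (lie (U p) (U q)).
have bl p q k : beta (p * q)%g k = beta p k + beta q k.
  by rewrite /beta UM lDl lD mulrDr.
have br p q k : beta p (q * k)%g = beta p q + beta p k.
  by rewrite /beta UM lDr lD mulrDr.
pose x' x : 'rV[R]_n := x *m A *m A'.
have x'W x : (x - x' x <= W)%MS.
  by rewrite submxE mulmxBl /x' mulmxKpV ?submxMl // subrr.
have lieN u v : l (lie u v) = - l (lie v u) by rewrite bracketC /l mulNmx mxE.
have lie' x y : l (lie (x' x) (x' y)) = l (lie x y).
  have h1 u v : l (lie (x' u) v) = l (lie u v).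
    apply: esym; rewrite -(subrK (x' u) u) lDl lD subrK.
    by rewrite [X in X + _](_ : _ = 0) ?add0r // /l omW // mxE.
  by rewrite h1 lieN h1 -lieN.
pose N := n%:R * `|A'|; have N0 : 0 <= N by rewrite mulr_ge0.
pose N1 := N * (n%:R * `|A|); have N10 : 0 <= N1 by rewrite !mulr_ge0.
have x'le x : `|x' x| <= N1 * `|x|.
  apply: le_trans (normr_mulmx _ _) _; rewrite -/N /N1 -[X in _ <= X]mulrA ler_wpM2l //.
  exact: normr_mulmx.
have Unear x : `|x| < e -> `|U (pnt x) - x' x| <= N * K * `|x| ^+ 2.
  move=> xe; rewrite /U /x' -mulmxBl; apply: le_trans (normr_mulmx _ _) _.
  by rewrite -/N -[X in _ <= X]mulrA; apply: ler_wpM2l => //; exact: hphi.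
pose B := 2 * C; have B0 : 0 <= B by rewrite mulr_ge0.
have [K2 K20 hK2] := second_order_law law lD lZ lle Ml0.
pose e1 := Num.min r (Num.min e 1).
have e10 : 0 < e1 by rewrite !lt_min r0 e0 ltr01.
pose K3 := Ml * (B * (N * K) * (N1 + N * K) + B * N1 * (N * K)).
have K30 : 0 <= K3 by rewrite !(mulr_ge0, addr_ge0).
have hbeta x y : `|x| < e1 -> `|y| < e1 ->
    `|beta (pnt x) (pnt y) - 2^-1 * l (lie x y)| <= K3 * (`|x| + `|y|) ^+ 3.
  rewrite !lt_min => /andP[xr /andP[xe x1]] /andP[yr /andP[ye y1]].
  rewrite -lie' /beta -mulrBr.
  rewrite normrM ger0_norm ?invr_ge0 //.
  pose rx := U (pnt x) - x' x; pose ry := U (pnt y) - x' y.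
  have hx := Unear x xe; have hy := Unear y ye; rewrite -/rx -/ry in hx hy.
  have [nx ny] := (normr_ge0 x, normr_ge0 y).
  set sxy := `|x| + `|y|.
  have sx : `|x| <= sxy by rewrite lerDl.
  have sy : `|y| <= sxy by rewrite lerDr.
  have s0 : 0 <= sxy by rewrite addr_ge0.
  have sq (z : R) : 0 <= z -> z <= sxy -> z ^+ 2 <= sxy ^+ 2.
    by move=> z0 zs; apply: lerXn2r; rewrite ?nnegrE.
  have Uy : `|U (pnt y)| <= (N1 + N * K) * `|y|.
    rewrite -(subrK (x' y) (U (pnt y))) -/ry; apply: le_trans (ler_normD _ _) _.
    rewrite mulrDl addrC; apply: lerD; first exact: x'le.
    apply: le_trans hy _; apply: ler_wpM2l; first by rewrite mulr_ge0.
    by rewrite expr2 ler_piMl // ltW.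
  have -> : l (lie (U (pnt x)) (U (pnt y))) - l (lie (x' x) (x' y)) =
      l (lie rx (U (pnt y))) + l (lie (x' x) ry).
    have {1}-> : U (pnt x) = rx + x' x by rewrite subrK.
    rewrite lDl lD; have {2}-> : U (pnt y) = ry + x' y by rewrite subrK.
    by rewrite lDr lD; ring.
  have h1 : `|l (lie rx (U (pnt y)))| <= Ml * (B * (N * K * sxy ^+ 2) * ((N1 + N * K) * sxy)).
    apply: le_trans (lle _) _; apply: ler_wpM2l => //; apply: le_trans (l_le _ _) _.
    apply: ler_pM; [by rewrite mulr_ge0|by []| |].
      apply: ler_wpM2l => //; apply: le_trans hx _; apply: ler_wpM2l; last exact: sq.
      by rewrite mulr_ge0.
    by apply: le_trans Uy _; rewrite ler_wpM2l // addr_ge0 // mulr_ge0.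
  have h2 : `|l (lie (x' x) ry)| <= Ml * (B * (N1 * sxy) * (N * K * sxy ^+ 2)).
    apply: le_trans (lle _) _; apply: ler_wpM2l => //; apply: le_trans (l_le _ _) _.
    apply: ler_pM; [by rewrite mulr_ge0|by []| |].
      by apply: ler_wpM2l => //; apply: le_trans (x'le x) _; rewrite ler_wpM2l.
    by apply: le_trans hy _; apply: ler_wpM2l; [rewrite mulr_ge0|exact: sq].
  have -> : K3 * sxy ^+ 3 = Ml * (B * (N * K * sxy ^+ 2) * ((N1 + N * K) * sxy)) +
      Ml * (B * (N1 * sxy) * (N * K * sxy ^+ 2)) by rewrite /K3; ring.
  have h3 := ler_normD (l (lie rx (U (pnt y)))) (l (lie (x' x) ry)).
  by apply: ler_half => //; apply: le_trans h3 _; exact: lerD.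
have hdelta x y : `|x| < e1 -> `|y| < e1 ->
    `|second_order b l (crd (pnt x * pnt y)%g) - second_order b l x - second_order b l y -
      beta (pnt x) (pnt y)| <= (K2 + K3) * (`|x| + `|y|) ^+ 3.
  move=> hx hy; have h3 := hbeta x y hx hy; move: hx hy.
  rewrite !lt_min => /andP[xr /andP[xe x1]] /andP[yr /andP[ye y1]].
  have h2 := hK2 x y xr yr.
  have shift (t u v : R) : t - u = (t - v) - (u - v) by ring.
  rewrite (shift _ (beta _ _) (2^-1 * l (lie x y))).
  apply: le_trans (ler_normD _ _) _; rewrite mulrDl normrN; exact: lerD.
have [F [FM [e2 [K4 [e20 K40 hF]]]]] :=
  global_primitive law sc bl br e10 (addr_ge0 K20 K30) hdelta.
have beta1 p : beta p 1%g = 0 by apply: (addrI (beta p 1%g)); rewrite -br mulg1 addr0.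
have F1 : F 1%g = 0.
  by apply: (addrI (F 1%g)); have := FM 1%g 1%g; rewrite mulg1 beta1 !addr0 => <-.
have phi1 : phi 1%g = 0 by apply: (addrI (phi 1%g)); rewrite -phiM mulg1 addr0.
have [c c0 hc] := growth_from1 li sc.
pose M0 := n%:R * `|A|; have M00 : 0 <= M0 by rewrite mulr_ge0.
pose M := Ml + Ml * (B * N * N1); have M_0 : 0 <= M by rewrite !(addr_ge0, mulr_ge0).
have tF p eps : 0 <= eps -> (forall j, `|phi p 0 j| <= eps) -> tame F p (M * (1 + eps)).
  move=> eps0 hp.
  have phip : `|phi p| <= eps by exact: normr_row_le.
  have Up : `|U p| <= N * eps.
    by apply: le_trans (normr_mulmx _ _) _; rewrite ler_wpM2l.
  (* The law of [F] gives its derivative at [p]: that of [F] at 1 plus the differential of [beta p]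
     at 1, which is linear in [U p]. *)
  exists (fun x => l x + 2^-1 * l (lie (U p) (x' x))),
    (K4 + Ml * C + Ml * (B * `|U p| * (N * K))), (Num.min e2 (Num.min e 1)).
  have x'D x y : x' (x + y) = x' x + x' y by rewrite /x' !mulmxDl.
  have x'Z (a : R) x : x' (a *: x) = a *: x' x by rewrite /x' -!scalemxAl.
  split.
  - by move=> x y; rewrite x'D lDr !lD; ring.
  - by move=> a x; rewrite x'Z lZr !lZ; ring.
  - move=> x; have h1 := lle x.
    have h2 : `|l (lie (U p) (x' x))| <= Ml * (B * (N * eps) * (N1 * `|x|)).
      apply: le_trans (lle _) _; apply: ler_wpM2l => //; apply: le_trans (l_le _ _) _.
      by apply: ler_pM => //; [rewrite mulr_ge0|exact: ler_wpM2l].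
    have h3 := ler_normD (l x) (2^-1 * l (lie (U p) (x' x))).
    rewrite normrM [`|2^-1|]ger0_norm ?invr_ge0 // in h3.
    have h4 : M * (1 + eps) * `|x| = Ml * `|x| + Ml * (B * (N * eps) * (N1 * `|x|)) +
        (Ml * eps * `|x| + Ml * (B * N * N1) * `|x|) by rewrite /M; ring.
    have h5 : 0 <= Ml * eps * `|x| + Ml * (B * N * N1) * `|x| by rewrite !(addr_ge0, mulr_ge0).
    apply: le_trans h3 _; apply: le_trans (lerD h1 (ler_half _ h2)) _ => //.
    by rewrite h4 lerDl.
  - by rewrite !lt_min e20 e0 ltr01.
  move=> x; rewrite !lt_min => /andP[xe2 /andP[xe x1]].
  rewrite FM /beta.
  have -> : F p + F (pnt x) + 2^-1 * l (lie (U p) (U (pnt x))) - F p -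
      (l x + 2^-1 * l (lie (U p) (x' x))) = (F (pnt x) - second_order b l x) +
      (second_order b l x - l x) + 2^-1 * l (lie (U p) (U (pnt x) - x' x)).
    have {1}-> : U (pnt x) = (U (pnt x) - x' x) + x' x by rewrite subrK.
    by rewrite lDr lD; ring.
  have h1 := hF x xe2; have h2 := second_order_near law lle Ml0 x.
  have h3 : `|l (lie (U p) (U (pnt x) - x' x))| <= Ml * (B * `|U p| * (N * K * `|x| ^+ 2)).
    apply: le_trans (lle _) _; apply: ler_wpM2l => //; apply: le_trans (l_le _ _) _.
    by apply: ler_wpM2l; [rewrite mulr_ge0|exact: Unear].
  have h4 : K4 * `|x| ^+ 3 <= K4 * `|x| ^+ 2.
    by apply: ler_wpM2l => //; rewrite exprS ler_piMl ?exprn_ge0 // ltW.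
  apply: le_trans (ler_normD _ _) _; apply: le_trans (lerD (ler_normD _ _) (lexx _)) _.
  rewrite normrM [`|2^-1|]ger0_norm ?invr_ge0 //.
  have -> : (K4 + Ml * C + Ml * (B * `|U p| * (N * K))) * `|x| ^+ 2 =
    K4 * `|x| ^+ 2 + Ml * C * `|x| ^+ 2 + Ml * (B * `|U p| * (N * K * `|x| ^+ 2)) by ring.
  by apply: lerD (lerD (le_trans h1 h4) h2) (ler_half _ h3).
have growth p : `|F p| <= M * (1 + M0 * c * d 1%g p) * c * d 1%g p.
  apply: (hc 'I_n (fun j q => phi q 0 j) F M0 M M00 M_0) => //.
    exact: character_tame hphi.
  by move=> j; rewrite phi1 mxE.
(* If [beta] vanished, comparison with the bracket at [t *: x0], [t *: y0] would bound a nonzero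
   multiple of [t ^ 2] by one of [t ^ 3]. *)
have [z1 [z2 hz]] : exists z1 z2, beta z1 z2 != 0.
  apply: contrapT => hn.
  have hb p q : beta p q = 0.
    by apply/eqP/negPn/negP => h; apply: hn; exists p, q.
  case/negP: hxy; apply/eqP; rewrite -/(l (lie x0 y0)).
  pose m := `|x0| + `|y0| + 1; have m0 : 0 < m by rewrite ltr_wpDl // addr_ge0.
  have [h3 h4] := (normr_ge0 x0, normr_ge0 y0).
  have ht (t : R) : 0 < t -> t * m < e1 -> `|l (lie x0 y0)| <= 2 * K3 * m ^+ 3 * t.
    move=> t0 te.
    have hsc (x : 'rV[R]_n) : `|x| <= m -> `|t *: x| <= t * m.
      by move=> xm; rewrite normrZ gtr0_norm // ler_pM2l.
    have hx : `|t *: x0| <= t * m by apply: hsc; rewrite /m -addrA lerDl addr_ge0.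
    have hy : `|t *: y0| <= t * m by apply: hsc; rewrite /m addrAC lerDr addr_ge0.
    have := hbeta (t *: x0) (t *: y0) (le_lt_trans hx te) (le_lt_trans hy te).
    rewrite hb sub0r normrN lZl lZr !lZ !normrM [`|2^-1|]ger0_norm ?invr_ge0 // gtr0_norm //.
    have h5 : (`|t *: x0| + `|t *: y0|) ^+ 3 <= (t * m) ^+ 3.
      apply: lerXn2r; rewrite ?nnegrE; first by rewrite addr_ge0.
        by rewrite mulr_ge0 // ltW.
      by rewrite !normrZ gtr0_norm // -mulrDr ler_pM2l // lerDl.
    move=> h6; have := le_trans h6 (ler_wpM2l K30 h5).
    have -> : 2^-1 * (t * (t * `|l (lie x0 y0)|)) = (t ^+ 2 * 2^-1) * `|l (lie x0 y0)| by ring.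
    have -> : K3 * (t * m) ^+ 3 = (t ^+ 2 * 2^-1) * (2 * K3 * m ^+ 3 * t) by field.
    by rewrite ler_pM2l // mulr_gt0 ?exprn_gt0 ?invr_gt0.
  set Z := l (lie x0 y0) in ht *; set Q := 2 * K3 * m ^+ 3 in ht.
  have Q0 : 0 <= Q by apply: mulr_ge0; [exact: mulr_ge0|exact/exprn_ge0/ltW].
  apply/eqP; rewrite -normr_le0 leNgt; apply/negP => Z0.
  pose t := Num.min (e1 / (2 * m)) (`|Z| / (2 * (Q + 1))).
  have t0 : 0 < t by rewrite lt_min !divr_gt0 ?mulr_gt0 // ltr_wpDl.
  have t1 : t * m < e1.
    have : t <= e1 / (2 * m) by rewrite ge_min lexx.
    rewrite ler_pdivlMr ?mulr_gt0 // => h; have : 0 < t * m by rewrite mulr_gt0.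
    by rewrite mulrCA in h; lra.
  have t2 : t * (2 * (Q + 1)) <= `|Z|.
    by rewrite -ler_pdivlMr ?mulr_gt0 ?ltr_wpDl // ge_min lexx orbT.
  by have := ht t t0 t1; lra.
have betaN p q : beta p q = - beta q p by rewrite /beta lieN mulrN.
have betaC p q z : beta z [~ p, q]%g = 0.
  have phiV q' : phi q'^-1%g = - phi q'.
    by apply/eqP; rewrite -addr_eq0 -phiM mulVg phi1.
  have U0 : U [~ p, q]%g = 0.
    rewrite /U commgEl /conjg !phiM !phiV.
    by rewrite [phi p + phi q]addrC addKr addNr mul0mx.
  by rewrite /beta U0 -(scale0r (0 : 'rV[R]_n)) lZr lZ mul0r mulr0.
(* Two expansions of [F (p * q)], the second through [p q = q p [p, q]]; [beta] vanishes on
   commutators and is antisymmetric. *)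
have Fcomm p q : F [~ p, q]%g = 2 * beta p q.
  have : F (p * q)%g = F (q * p * [~ p, q])%g.
    by rewrite commgEl /conjg !mulgA mulgK mulgV mul1g.
  rewrite (FM _ [~ p, q]%g) betaC addr0 !FM [beta q p]betaN => h; lra.
have betaXl p q k : beta (p ^+ k)%g q = k%:R * beta p q.
  elim: k => [|k IH]; first by rewrite expg0 betaN beta1 oppr0 mul0r.
  by rewrite expgS bl IH -natr1 mulrDl mul1r addrC.
have betaX p q k : beta (p ^+ k)%g (q ^+ k)%g = k%:R ^+ 2 * beta p q.
  by rewrite betaXl (betaN p (q ^+ k)%g) betaXl (betaN q p); ring.
exists z1, z2, (2 * `|beta z1 z2|), (M * c * (1 + M0 * c) + 1).
have c_0 := ltW c0.
split; first by rewrite mulr_gt0 // normr_gt0.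
  by rewrite ltr_wpDl // !(mulr_ge0, addr_ge0).
move=> k; have := growth [~ z1 ^+ k, z2 ^+ k]%g.
rewrite Fcomm betaX !normrM !normr_nat.
set D := d _ _; have D0 : 0 <= D by exact: dist_ge0.
clearbody D => h.
apply: (@le_trans _ _ (M * (1 + M0 * c * D) * c * D)).
  by apply: le_trans h; rewrite le_eqVlt; apply/orP; left; apply/eqP; ring.
have -> : (M * c * (1 + M0 * c) + 1) * (1 + D) ^+ 2 = M * (1 + M0 * c * D) * c * D +
   (M * c * (1 + D + D ^+ 2 + M0 * c * (1 + 2 * D)) + (1 + D) ^+ 2) by ring.
by rewrite lerDl !(mulr_ge0, addr_ge0, exprn_ge0).
Qed.

End QuadraticGrowth.

(** * The abelian case *)

HB.instance Definition _ (R : realType) (m n : nat) := Complete.on (matrix R m n).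

(** Banach's fixed point theorem for [x |-> v + (x - f x)], a contraction of ratio 1/2 that
    preserves the ball of radius [rho]. *)
Lemma near_identity_onto (R : realType) (n : nat) (f : 'rV[R]_n -> 'rV[R]_n) (rho : R) :
  0 <= rho -> f 0 = 0 ->
  (forall x y, `|x| <= rho -> `|y| <= rho -> `|f y - f x - (y - x)| <= 2^-1 * `|y - x|) ->
  forall v, `|v| <= rho / 2 -> exists2 x, `|x| <= rho & f x = v.
Proof.
move=> rho0 f0 hf v hv.
pose U : set 'rV[R]_n := [set x | `|x| <= rho].
pose T (x : 'rV[R]_n) := v + (x - f x).
have TU : {homo T : x / U x >-> U x}.
  move=> x /= xU; have := hf 0 x; rewrite normr0 f0 !subr0 => /(_ rho0 xU) h.
  rewrite /U /= /T; apply: le_trans (ler_normD _ _) _; rewrite -normrN opprB in h.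
  by move: xU; rewrite /U /=; lra.
pose TF := HB.pack_for {fun U >-> U} T (isFun.Build _ _ _ _ _ TU).
have [] := @banach_fixed_point R _ U TF.
- exists 2^-1%:nng; split; first by rewrite /= invf_lt1 // ltr1n.
  move=> [x y] /= [xU yU]; rewrite /TF /= /T.
  have := hf y x yU xU; rewrite -normrN; congr (`|_| <= _).
  by apply/rowP => i; rewrite !mxE; ring.
- have -> : U = (fun x : 'rV[R]_n => `|x|) @^-1` [set z | z <= rho] by [].
  by apply: closed_comp; [move=> x _; exact: norm_continuous|exact: closed_le].
- by exists 0; rewrite /U /= normr0.
move=> x xU; rewrite /TF /= /T => h; exists x => //.
by apply/rowP => i; move/rowP/(_ i): h; rewrite !mxE => h; lra.
Qed.

Section AbelianCoordinates.
Variables (R : realType) (n : nat) (G : lieGroupType R n).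
Variables (r C : R) (b : 'rV[R]_n -> 'rV[R]_n -> 'rV[R]_n).
Hypothesis law : @local_law R n G r C b.
Variables (phi : G -> 'rV[R]_n) (e K : R).
Hypothesis phiM : forall p q, phi (p * q)%g = phi p + phi q.
Hypothesis e0 : 0 < e.
Hypothesis K0 : 0 <= K.
Local Notation pnt := (@pnt R n G).
Local Notation crd := (@crd R n G).
Hypothesis hphi : forall x, `|x| < e -> `|phi (pnt x) - x| <= K * `|x| ^+ 2.
Implicit Types (p q u : G) (x y v w : 'rV[R]_n).

Let phi1 : phi 1%g = 0. Proof. by apply: (addrI (phi 1%g)); rewrite -phiM mulg1 addr0. Qed.

(** As [phi] is a homomorphism, the difference of its values is its value at the quotient, whose
    coordinates are close to [y - x]. *)
Lemma coordinates_near_id : exists2 rho, 0 < rho < r & forall x y, `|x| <= rho -> `|y| <= rho ->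
  `|phi (pnt y) - phi (pnt x) - (y - x)| <= 2^-1 * `|y - x|.
Proof.
have [d [K' [d0 dr K'0 hd]]] := quotient_estimate law.
(* [8 K] comes from the remainder of [phi] and [2 K'] from [quotient_estimate]; [rho] is chosen so
   that [rho * S <= 1/2]. *)
pose S := 8 * K + 2 * K' + 1; have S0 : 0 < S by rewrite ltr_wpDl // addr_ge0 // mulr_ge0.
pose rho := Num.min (d / 2) (Num.min (e / 8) (2^-1 / S)).
have rho0 : 0 < rho by rewrite !lt_min !divr_gt0.
have rd : rho <= d / 2 by rewrite ge_min lexx.
have re : rho <= e / 8 by rewrite !ge_min lexx !orbT.
have rS : rho * S <= 2^-1 by rewrite -ler_pdivlMr // !ge_min lexx !orbT.
exists rho; first by apply/andP; split=> //; lra.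
move=> x y xr yr.
have [hg h1 h2 _] := hd x y (ltac:(lra)) (ltac:(lra)).
set g := (_ * _)%g in hg h1 h2; set z := crd g in h1 h2.
have gE : pnt z = g by apply: crdK; case: hg.
have -> : phi (pnt y) - phi (pnt x) = phi (pnt z).
  rewrite gE /g phiM addrC; congr (_ + _).
  by apply/eqP; rewrite eq_sym -addr_eq0 -phiM mulVg phi1.
have xy : `|y - x| <= 2 * rho by apply: le_trans (ler_normB _ _) _; lra.
have -> : phi (pnt z) - (y - x) = (phi (pnt z) - z) + (z - (y - x)) by rewrite addrA subrK.
apply: le_trans (ler_normD _ _) _.
have ze : `|z| < e by lra.
have h3 : K * `|z| ^+ 2 <= 8 * K * rho * `|y - x|.
  have -> : 8 * K * rho * `|y - x| = K * (4 * rho * (2 * `|y - x|)) by ring.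
  by apply: ler_wpM2l => //; rewrite expr2; apply: ler_pM => //; lra.
have h4 : K' * `|x| * `|z| <= 2 * K' * rho * `|y - x|.
  have -> : 2 * K' * rho * `|y - x| = K' * rho * (2 * `|y - x|) by ring.
  by apply: ler_pM => //; [rewrite mulr_ge0|exact: ler_wpM2l].
have h5 : rho * S * `|y - x| <= 2^-1 * `|y - x| by exact: ler_wpM2r.
have h6 : 0 <= rho * `|y - x| by rewrite mulr_ge0 // ltW.
have h7 : rho * S * `|y - x| = 8 * K * rho * `|y - x| + 2 * K' * rho * `|y - x| + rho * `|y - x|.
  by rewrite /S; ring.
have := hphi ze; lra.
Qed.

(** [phi] is bijective near the identity; its local inverse [s] is additive because [phi] is
    additive and locally injective. *)
Lemma local_section rho0 : 0 < rho0 -> exists (dl : R) (s : 'rV[R]_n -> G), [/\ 0 < dl,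
  forall v, `|v| <= dl -> phi (s v) = v /\ chart_ball rho0 (s v),
  forall v w, `|v| <= dl -> `|w| <= dl -> `|v + w| <= dl -> (s v * s w)%g = s (v + w) &
  nbhs (1%g : G) [set u | exists2 v, `|v| <= dl & u = s v]].
Proof.
move=> rho0_gt; have [rho /andP[rh0 rhr] hrho] := coordinates_near_id.
have inj x y : `|x| <= rho -> `|y| <= rho -> phi (pnt x) = phi (pnt y) -> x = y.
  move=> xr yr h; have := hrho x y xr yr; rewrite h subrr sub0r normrN => h2.
  by apply/eqP; rewrite eq_sym -subr_eq0 -normr_le0; have := normr_ge0 (y - x); lra.
have rho_ge0 := ltW rh0.
have z_le : `|0 : 'rV[R]_n| <= rho by rewrite normr0.
have lip x : `|x| <= rho -> `|x| <= 2 * `|phi (pnt x)| /\ `|phi (pnt x)| <= 2 * `|x|.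
  move=> xr; have := hrho 0 x z_le xr; rewrite pnt0 phi1 !subr0.
  have := lerB_dist (phi (pnt x)) x; have := lerB_dist x (phi (pnt x)); rewrite distrC.
  by split; lra.
have onto v : exists x, `|v| <= rho / 2 -> `|x| <= rho /\ phi (pnt x) = v.
  have [h|h] := pselect (`|v| <= rho / 2); last by exists 0 => /h.
  have [||x xr xv] := @near_identity_onto R n (phi \o pnt) rho rho_ge0 _ _ v h.
  - by rewrite /= pnt0.
  - exact: hrho.
  by exists x.
have [X hX] := choice onto.
have [_ C0 _ _ _] := law; have r0 : 0 < r by lra.
pose S := 4 + 4 * (C * (1 + 2 * r)).
have S4 : 4 <= S by rewrite lerDl !mulr_ge0 // addr_ge0 // mulr_ge0 // ltW.
have S0 : 0 < S by lra.
pose dl := Num.min (rho0 / 4) (Num.min 1 (rho / S)).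
have dl0 : 0 < dl by rewrite !lt_min !divr_gt0 ?ltr01.
have dlS : dl * S <= rho by rewrite -ler_pdivlMr // !ge_min lexx !orbT.
have dl1 : dl <= 1 by rewrite !ge_min lexx !orbT.
have dlr : dl <= rho0 / 4 by rewrite !ge_min lexx.
have dl4 : 4 * dl <= rho.
  by apply: le_trans dlS; rewrite mulrC; apply: ler_wpM2l => //; exact: ltW.
have hX2 v : `|v| <= dl -> [/\ `|X v| <= rho, phi (pnt (X v)) = v & `|X v| <= 2 * `|v|].
  move=> h; have [|Xr Xv] := hX v; first lra.
  by split=> //; have [] := lip (X v) Xr; rewrite Xv.
exists dl, (pnt \o X); split=> //.
- move=> v h; have [Xr Xv X2] := hX2 v h; split; first exact: Xv.
  have [h1 h2] : cdom (chart1 G) (pnt (X v)) /\ crd (pnt (X v)) = X v.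
    by apply: (pnt_dom law); lra.
  by split; [exact: h1|rewrite /= h2; lra].
- move=> v w hv hw hvw /=.
  have [vr vE v2] := hX2 v hv; have [wr wE w2] := hX2 w hw; have [vwr vwE vw2] := hX2 _ hvw.
  have vr' : `|X v| < r by lra. have wr' : `|X w| < r by lra.
  have [_ hdom _] : [/\ cimg (chart1 G) (cmap (chart1 G) 1%g + X v),
      cdom (chart1 G) (pnt (X v) * pnt (X w))%g &
      `|crd (pnt (X v) * pnt (X w))%g - X v - X w - b (X v) (X w)| <=
        C * `|X v| * `|X w| * (`|X v| + `|X w|)].
    by case: law => _ _ _ _ h; exact: h.
  have h := law_le law vr' wr'; set z := crd _ in h.
  have zE : pnt z = (pnt (X v) * pnt (X w))%g by exact: crdK.
  rewrite -zE; congr pnt; apply: inj => //; last by rewrite vwE zE phiM vE wE.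
  have -> : z = (z - X v - X w) + (X v + X w) by apply/rowP => i; rewrite !mxE; ring.
  apply: le_trans (ler_normD _ _) _; have h2 := ler_normD (X v) (X w).
  have h3 : C * (1 + 2 * r) * `|X v| * `|X w| <= C * (1 + 2 * r) * (2 * dl) * 2.
    apply: ler_pM => //; last lra.
      by rewrite !mulr_ge0 // addr_ge0 // mulr_ge0 // ltW.
    by apply: ler_wpM2l; [rewrite mulr_ge0 // addr_ge0 // mulr_ge0 // ltW|lra].
  have h4 : dl * S = 4 * dl + C * (1 + 2 * r) * (2 * dl) * 2 by rewrite /S; ring.
  lra.
have := @chart_ball_nbhs R n G _ (divr_gt0 dl0 (ltr0Sn _ 1)); apply: filterS => u [ud uc].
have uE : pnt (crd u) = u by exact: crdK.
have ur : `|crd u| <= rho by lra.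
have [_ h] := lip _ ur; have h1 : `|phi u| <= dl by rewrite -uE; lra.
exists (phi u) => //=; have [Xr XE _] := hX2 _ h1.
by rewrite -{1}uE; congr pnt; apply: inj => //; rewrite XE uE.
Qed.

Hypothesis ab : abelian_group G.
Hypothesis sc : simply_connected R G.

Lemma bounded_roots rho0 : 0 < rho0 -> exists2 dl, 0 < dl &
  forall p (k : nat), (0 < k)%N -> `|phi p| <= dl * k%:R ->
  exists2 u, chart_ball rho0 u & p = (u ^+ k)%g.
Proof.
move=> /local_section[dl [s [dl0 hs sM nV]]]; exists dl => //.
have s0 : s 0 = 1%g.
  by apply: (@mulgI _ (s 0)); rewrite mulg1 sM ?addr0 // normr0 ltW.
have sX v j : `|j%:R *: v| <= dl -> (s v ^+ j)%g = s (j%:R *: v).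
  elim: j => [|j IH] h; first by rewrite scale0r s0.
  have h1 (i : nat) : (i <= j.+1)%N -> `|i%:R *: v| <= dl.
    move=> ij; apply: le_trans h; rewrite !normrZ !normr_nat.
    by apply: ler_wpM2r => //; rewrite ler_nat.
  have e1 : j.+1%:R *: v = v + j%:R *: v by rewrite -natr1 scalerDl scale1r addrC.
  rewrite expgS IH ?h1 // e1 sM ?h1 //; last by rewrite -e1.
  by have := h1 1%N isT; rewrite scale1r.
have small (v : 'rV[R]_n) (k : nat) : (0 < k)%N -> `|v| <= dl * k%:R -> `|k%:R^-1 *: v| <= dl.
  move=> k0 h; rewrite normrZ normfV normr_nat mulrC ler_pdivrMr ?ltr0n //.
have large (v : 'rV[R]_n) : exists N, forall k, (N <= k)%N -> `|v| <= dl * k%:R.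
  exists (Num.truncn (`|v| / dl)).+1 => k hk; rewrite mulrC -ler_pdivrMr //.
  by apply: le_trans (ltW (truncnS_gt _)) _; rewrite ler_nat.
have ev p : exists N, forall k, (N <= k)%N -> (0 < k)%N -> p = (s (k%:R^-1 *: phi p) ^+ k)%g.
  move: p; apply: (group_ind_nbhs (proj1 sc) nV) => [|p u [N hN] [v hv uE]].
    by exists 0%N => k _ _; rewrite phi1 scaler0 s0 expg1n.
  have pu : phi (p * u)%g = phi p + v by rewrite phiM uE (proj1 (hs v hv)).
  have [[[N1 h1] [N2 h2]] [N3 h3]] := (large (phi p), large v, large (phi p + v)).
  exists (N + N1 + N2 + N3)%N => k hk k0.
  have k1 : (k%:R : R) != 0 by rewrite pnatr_eq0 -lt0n.
  rewrite pu scalerDr -sM; first last.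
  - by rewrite -scalerDr; apply/small/h3 => //; lia.
  - by apply/small/h2 => //; lia.
  - by apply/small/h1 => //; lia.
  rewrite expgMn; last exact: ab.
  rewrite -hN //; last lia.
  rewrite sX; first by rewrite scalerA mulfV // scale1r -uE.
  by rewrite scalerA mulfV // scale1r.
move=> p k k0 hp; have [N hN] := ev p.
exists (s (k%:R^-1 *: phi p)); first by have [] := hs _ (small _ _ k0 hp).
(* [p] is known to be a power with exponent [N.+1 * k]; grouping the factors by [N.+1] gives the
   desired [k]-th power. *)
have m0 : (0 < N.+1 * k)%N by rewrite muln_gt0.
rewrite {1}(hN (N.+1 * k)%N _ m0); last by rewrite (leq_trans (leqnSn N)) // leq_pmulr.
have k1 : (k%:R : R) != 0 by rewrite pnatr_eq0 -lt0n.
have e1 : N.+1%:R *: ((N.+1 * k)%:R^-1 *: phi p) = k%:R^-1 *: phi p.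
  by rewrite scalerA natrM invfM mulrA mulfV ?pnatr_eq0 // mul1r.
by rewrite expgnA (sX _ N.+1) e1 //; exact: small.
Qed.

End AbelianCoordinates.

Section L1Facts.
Variable R : realType.
Local Notation mu := (lebesgue01 R).
Local Notation L1 := (L1 R).

Lemma lebesgue01_setI (A : set R) : mu A = lebesgue_measure (A `&` `[0, 1]%classic).
Proof. by []. Qed.

Lemma lebesgue01_setT : mu setT = 1%E.
Proof. by rewrite lebesgue01_setI setTI lebesgue_measure_itv /= lte_fin ltr01 oppr0 adde0. Qed.

Lemma L1_measurable (u : L1) : measurable_fun setT (u : measurableTypeR R -> R).
Proof. exact: (@measurable_funPT _ _ (measurableTypeR R) (measurableTypeR R)). Qed.

Lemma L1_integrable (u : L1) : mu.-integrable setT (fun x => (u x)%:E).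
Proof.
apply/integrableP; split; first by apply/measurable_EFinP; exact: L1_measurable.
have := @Lebesgue_finite _ _ _ _ _ _ u.
by rewrite /finite_norm Lnorm1.
Qed.

Lemma L1_integrableB (u v : L1) : mu.-integrable setT (fun x => (u x - v x)%:E).
Proof.
have := integrableB measurableT (L1_integrable u) (L1_integrable v).
exact.
Qed.

Lemma L1_distE (u v : L1) : L1_dist u v = \int[mu]_x `|u x - v x|.
Proof. by rewrite /L1_dist Lnorm1. Qed.

Lemma L1_of_fun (h : R -> R) : mu.-integrable setT (fun x => (h x)%:E) ->
  exists u : L1, {ae mu, forall x, u x = h x}.
Proof.
move=> ih; have mh : measurable_fun setT (h : measurableTypeR R -> measurableTypeR R).
  by have /integrableP[/measurable_EFinP] := ih.
pose hm : {mfun measurableTypeR R >-> measurableTypeR R} :=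
  HB.pack (h : measurableTypeR R -> measurableTypeR R) (@isMeasurableFun.Build _ _ (measurableTypeR R) (measurableTypeR R) h mh).
pose u0 : {mfun_ mu, measurableTypeR R >-> measurableTypeR R} := (\pi_({mfun_ mu, measurableTypeR R >-> measurableTypeR R}) hm)%qT.
have u0h : {ae mu, forall x, u0 x = h x}.
  have : (repr u0 == hm %[mod {mfun_ mu, measurableTypeR R >-> measurableTypeR R}])%qT.
    by rewrite reprK.
  by rewrite eqmodE => /asboolP; apply: filterS => x /(_ I).
have fin : finite_norm mu 1 u0.
  rewrite /finite_norm Lnorm1.
  have /integrableP[_] := ih; apply: le_lt_trans.
  rewrite le_eqVlt; apply/orP; left; apply/eqP; apply: ge0_ae_eq_integral => //.
  - by apply: measurableT_comp => //; apply/measurable_EFinP; exact: (@measurable_funPT _ _ (measurableTypeR R) (measurableTypeR R)).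
  - by apply: measurableT_comp => //; apply/measurable_EFinP.
  - by apply: filterS u0h => x /= ->.
pose u : L1 := HB.pack u0 (isFinLebesgue.Build _ _ _ mu 1%E (lexx _) u0 fin).
by exists u.
Qed.

Lemma bounded_integrable01 (f : measurableTypeR R -> R) M : measurable_fun setT f ->
  (forall x, `|f x| <= M) -> mu.-integrable setT (fun x => (f x)%:E).
Proof.
move=> mf fM; apply: measurable_bounded_integrable => //.
  by rewrite [X in (X < _)%E]lebesgue01_setT ltry.
exists M; split; first exact: num_real.
by move=> N MN x _ /=; apply: le_trans (fM x) (ltW MN).
Qed.

Definition step n (v : 'rV[R]_n) (t : R) : R :=
  \sum_(i < n) v 0 i * \1_(`[i%:R / n%:R, i.+1%:R / n%:R[%classic : set R) t.

Lemma step_measurable n (v : 'rV[R]_n) : measurable_fun setT (step v : measurableTypeR R -> R).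
Proof.
apply: (@measurable_sum _ (measurableTypeR R)) => i.
apply: measurable_funM; first exact: measurable_cst.
by apply: measurable_indic; exact: measurable_itv.
Qed.

Lemma stepB n (v w : 'rV[R]_n) t : step v t - step w t = step (v - w) t.
Proof. by rewrite /step -sumrB; apply: eq_bigr => i _; rewrite !mxE mulrBl. Qed.

Lemma step_le n (v : 'rV[R]_n) t : `|step v t| <= n%:R * `|v|.
Proof.
apply: le_trans (ler_norm_sum _ _ _) _.
have -> : n%:R * `|v| = \sum_(i < n) `|v| by rewrite sumr_const card_ord mulr_natl.
apply: ler_sum => i _; rewrite normrM -[leRHS]mulr1; apply: ler_pM => //.
  exact: normr_entry.
by rewrite indicE; case: (_ \in _); rewrite ?normr1 ?normr0.
Qed.

Lemma step_eq n (v : 'rV[R]_n) (i : 'I_n) t :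
  i%:R / n%:R <= t < i.+1%:R / n%:R -> step v t = v 0 i.
Proof.
move=> /andP[t1 t2]; have n0 : 0 < n%:R :> R by rewrite ltr0n (leq_trans _ (ltn_ord i)).
have ti : t \in (`[i%:R / n%:R, i.+1%:R / n%:R[%classic : set R).
  by rewrite inE /= in_itv /= t1 t2.
rewrite /step (bigD1 i) //= indicE ti mulr1 big1 ?addr0 // => j ji.
rewrite indicE memNset ?mulr0 //= in_itv /= => /andP[t3 t4]; move/eqP: ji; apply.
move: (le_lt_trans t1 t4) (le_lt_trans t3 t2).
by rewrite !ltr_pM2r ?invr_gt0 // !ltr_nat !ltnS => h1 h2; apply/val_inj/eqP; rewrite eqn_leq h1 h2.
Qed.

Lemma step_integrable n (v : 'rV[R]_n) : mu.-integrable setT (fun x => (step v x)%:E).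
Proof. by apply: (bounded_integrable01 (step_measurable v)) => x; exact: step_le. Qed.

(** Coordinates become the values on [n] intervals of length [1 / n], so the sup norm and the
    distance in L1 agree up to the factor [n]. *)
Lemma row_space_L1 n : exists h : 'rV[R]_n -> L1, forall v w,
  `|v - w| <= n%:R * L1_dist (h v) (h w) /\ L1_dist (h v) (h w) <= n%:R * `|v - w|.
Proof.
have [h hE] := choice (fun v : 'rV[R]_n => L1_of_fun (step_integrable v)).
exists h => v w.
have -> : L1_dist (h v) (h w) = \int[mu]_x `|step (v - w) x|.
  rewrite L1_distE; congr (fine _); apply: ge0_ae_eq_integral => //.
  - by apply/measurable_EFinP/measurableT_comp => //; apply: measurable_funB; exact: L1_measurable.
  - by apply/measurable_EFinP/measurableT_comp => //; exact: step_measurable.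
  - by apply: filterS2 (hE v) (hE w) => x h1 h2 _; rewrite h1 h2 -stepB.
set u := v - w.
have iu : mu.-integrable setT (fun x => `|step u x|%:E).
  by apply: (bounded_integrable01 (M := n%:R * `|u|)); [apply: measurableT_comp => //; exact: step_measurable|move=> x; rewrite normr_id; exact: step_le].
split.
  apply: normr_row_le => [|i]; first by rewrite mulr_ge0 // Rintegral_ge0.
  have n0' : 0 < n%:R :> R by rewrite ltr0n (leq_trans _ (ltn_ord i)).
  pose I : set R := `[i%:R / n%:R, i.+1%:R / n%:R[%classic.
  have mI : measurable (I : set (measurableTypeR R)) by exact: measurable_itv.
  have iI : mu.-integrable setT (fun x => (\1_I x : R)%:E).
    apply: (bounded_integrable01 (M := 1)); first exact: measurable_indic.
    by move=> x; rewrite indicE; case: (_ \in _); rewrite ?normr1 ?normr0.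
  have muI : \int[mu]_x \1_I x = n%:R^-1.
    rewrite /Rintegral integral_indic // setIT lebesgue01_setI setIidl.
      rewrite lebesgue_measure_itv /= lte_fin ltr_pM2r ?invr_gt0 // ltr_nat ltnSn /=.
      by rewrite -mulrBl -natrB // subSnn mul1r.
    move=> t; rewrite /I /= !in_itv /= => /andP[t1 t2]; apply/andP; split.
      by apply: le_trans t1; rewrite divr_ge0.
    by apply: le_trans (ltW t2) _; rewrite ler_pdivrMr // mul1r ler_nat.
  have : \int[mu]_x (`|u 0 i| * \1_I x) <= \int[mu]_x `|step u x|.
    apply: le_Rintegral => //.
      have := integrableZl measurableT (`|u 0 i|) iI; exact.
    move=> x _; rewrite indicE; have [xI|xI] := boolP (x \in I); last by rewrite mulr0.
    by rewrite mulr1 (@step_eq _ u i) //; move: xI; rewrite inE /I /= in_itv.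
  by rewrite RintegralZl // muI ler_pdivrMr // mulrC.
have -> : n%:R * `|u| = \int[mu]_(x in setT) (n%:R * `|u|).
  by rewrite Rintegral_cst // lebesgue01_setT mulr1.
apply: le_Rintegral => //; last by move=> x _; exact: step_le.
by apply: (bounded_integrable01 (f := cst _) (M := `|n%:R * `|u| |)) => // x; exact: lexx.
Qed.
End L1Facts.

Section AbelianEmbedding.
Variables (R : realType) (n : nat) (G : lieGroupType R n) (g : riemannian_metric G).
Hypothesis li : left_invariant g.
Hypothesis sc : simply_connected R G.
Hypothesis ab : abelian_group G.
Local Notation d := (riemannian_dist g).

Lemma abelian_coordinates : exists (phi : G -> 'rV[R]_n) (c1 c2 : R),
  [/\ 0 <= c1, 0 <= c2, forall p q, phi (p * q)%g = phi p + phi q &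
    forall p, `|phi p| <= c1 * d 1%g p /\ d 1%g p <= c2 * (`|phi p| + 1)].
Proof.
have [r [C [b law]]] := @group_law_expansion R n G.
have lie0 x y : bracket b x y *m (1%:M : 'M[R]_n) = 0.
  by rewrite mulmx1 (abelian_bracket0 law).
have [phi [phiM [e [K [e0 K0 hphi]]]]] := exists_character law sc lie0.
have [c c0 lin] := linear_growth li sc.
have [rho [D [rho0 D0 hD]]] := dist_bounded_near1 g.
have phi1 : phi 1%g = 0 by apply: (addrI (phi 1%g)); rewrite -phiM mulg1 addr0.
have hphi' (x : 'rV[R]_n) : `|x| < e -> `|phi (pnt G x) - x| <= K * `|x| ^+ 2.
  by move/hphi; rewrite mulmx1.
have [dl dl0 roots] := bounded_roots law phiM e0 K0 hphi' ab sc rho0.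
pose M := n%:R * `|1%:M : 'M[R]_n|; have M0 : 0 <= M by rewrite mulr_ge0.
exists phi, (M * c), (D * (dl^-1 + 1)); split=> //.
- by rewrite mulr_ge0 // ltW.
- by rewrite mulr_ge0 // addr_ge0 // invr_ge0 ltW.
move=> p; split.
  apply: normr_row_le => [|j]; first by rewrite !mulr_ge0 ?dist_ge0 // ltW.
  apply: (lin (fun q => phi q 0 j)) => //; last by rewrite phi1 mxE.
  by move=> q; exact: (character_tame phiM e0 hphi).
(* The least number of factors that keeps the root in a fixed ball; the extra unit produces the
   additive constant of the upper bound. *)
pose k := (Num.truncn (`|phi p| / dl)).+1.
have x0 : 0 <= `|phi p| / dl by rewrite divr_ge0 // ltW.
have /andP[k1 k2] := truncn_itv x0.
have [|u hu pE] := roots p k isT; first by rewrite mulrC -ler_pdivrMr // ltW.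
rewrite {1}pE; apply: le_trans (dist_expg li sc u k) _.
apply: (@le_trans _ _ (k%:R * D)); first by apply: ler_wpM2l => //; exact: hD.
have -> : D * (dl^-1 + 1) * (`|phi p| + 1) =
  (`|phi p| / dl + 1) * D + D * (`|phi p| + dl^-1) by ring.
rewrite -natr1; apply: (@le_trans _ _ ((`|phi p| / dl + 1) * D)).
  by apply: ler_wpM2r => //; rewrite lerD2r.
by rewrite lerDl mulr_ge0 // addr_ge0 // invr_ge0 ltW.
Qed.

Lemma abelian_qi_embeds : qi_embeds d (@L1_dist R).
Proof.
have [phi [c1 [c2 [c1_ge0 c2_ge0 phiM hphi]]]] := abelian_coordinates.
have [h hE] := row_space_L1 R n.
exists (h \o phi); pose L := n%:R * c1 + n%:R * c2 + 1.
have a0 : 0 <= n%:R * c1 by rewrite mulr_ge0.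
have b0 : 0 <= n%:R * c2 by rewrite mulr_ge0.
have L0 : 0 < L by rewrite /L; lra.
exists L, (c2 / L); split; [by rewrite /L; lra|by rewrite divr_ge0 // ltW|move=> p q].
have phi1 : phi 1%g = 0 by apply: (addrI (phi 1%g)); rewrite -phiM mulg1 addr0.
have -> : d p q = d 1%g (p^-1 * q)%g by rewrite -(dist_left li p 1%g) mulg1 mulVKg.
have phiE : phi (p^-1 * q)%g = phi q - phi p.
  rewrite phiM addrC; congr (_ + _); apply/eqP.
  by rewrite -addr_eq0 -phiM mulVg phi1.
have [h1 h2] := hphi (p^-1 * q)%g; have [h3 h4] := hE (phi p) (phi q).
rewrite phiE distrC in h1 h2.
set D := d _ _ in h1 h2 *; set N := L1_dist _ _ in h3 h4 *.
set z := `|_| in h1 h2 h3 h4.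
apply/andP; split; last first.
  have D0 : 0 <= D by exact: dist_ge0.
  have h5 : n%:R * z <= n%:R * (c1 * D) by rewrite ler_wpM2l.
  have h6 : 0 <= c2 / L by rewrite divr_ge0 // ltW.
  have h7 : 0 <= n%:R * c2 * D by rewrite mulr_ge0.
  have h8 : L * D = n%:R * (c1 * D) + n%:R * c2 * D + D by rewrite /L; ring.
  lra.
rewrite [c2 / L]mulrC -mulrBr mulrC ler_pdivrMr //.
have h5 : c2 * z <= c2 * (n%:R * N) by rewrite ler_wpM2l.
have N0 : 0 <= N by rewrite /N L1_distE Rintegral_ge0.
have h6 : 0 <= n%:R * c1 * N by rewrite mulr_ge0.
have h7 : N * L = c2 * (n%:R * N) + n%:R * c1 * N + N by rewrite /L; ring.
lra.
Qed.
End AbelianEmbedding.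

(** * Functionals from an embedding in L1 *)

Section MeanOfEmbedding.
Variables (R : realType) (G : groupType).
Local Notation mu := (lebesgue01 R).
Local Notation Om := (G * R)%type.
Implicit Types (Phi Psi : Om -> R).

Definition fiber_act (w : Om) (p : G) : Om := ((w.1 * p)%g, w.2).
Local Notation rt := (rt fiber_act).

Definition fiber_mean Phi (q : G) : R := \int[mu]_t Phi (q, t).

(** The norm bound is uniform in [q], which keeps all translates of a function bounded and lets
    their averages be taken. *)
Definition fiber_integrable : set (Om -> R) := [set Phi |
  (forall q, mu.-integrable setT (fun t => (Phi (q, t))%:E)) /\
  exists C, forall q, fiber_mean (absf Phi) q <= C].
Local Notation B := fiber_integrable.

Lemma fiber_integrable_abs Phi q : B Phi -> mu.-integrable setT (fun t => `|Phi (q, t)|%:E).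
Proof. by move=> [h _]; have := integrable_norm (h q); exact. Qed.

Lemma fiber_meanD Phi Psi q : B Phi -> B Psi ->
  fiber_mean (Phi + Psi) q = fiber_mean Phi q + fiber_mean Psi q.
Proof. by move=> [h _] [h' _]; apply: RintegralD => //; [exact: h|exact: h']. Qed.

Lemma fiber_meanZ a Phi q : B Phi -> fiber_mean (a *: Phi) q = a * fiber_mean Phi q.
Proof. by move=> [h _]; apply: RintegralZl => //; exact: h. Qed.

Lemma fiber_mean_rt p Phi q : fiber_mean (rt p Phi) q = fiber_mean Phi (q * p)%g.
Proof. by []. Qed.

Lemma fiber_mean_norm Phi q : B Phi -> `|fiber_mean Phi q| <= fiber_mean (absf Phi) q.
Proof. by move=> [h _]; apply: le_normr_Rintegral => //; exact: h. Qed.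

Lemma fiber_integrable_dominated Phi Psi : B Psi ->
  (forall q, measurable_fun setT (fun t : measurableTypeR R => Phi (q, t))) ->
  (forall w, `|Phi w| <= `|Psi w|) -> B Phi.
Proof.
move=> BPsi mPhi le; have [h [C hC]] := BPsi.
have iPhi q : mu.-integrable setT (fun t => (Phi (q, t))%:E).
  apply: le_integrable (h q) => //; first by apply/measurable_EFinP; exact: mPhi.
  by move=> t _; rewrite lee_fin; exact: le.
split=> //; exists C => q; apply: le_trans (hC q).
apply: le_Rintegral => //; last by move=> t _; exact: le.
  by have := integrable_norm (iPhi q); exact.
exact: fiber_integrable_abs.
Qed.

Lemma fiber_measurable Phi q : B Phi -> measurable_fun setT (fun t : measurableTypeR R => Phi (q, t)).
Proof. by move=> [h _]; have /integrableP[/measurable_EFinP] := h q. Qed.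

Lemma fiber_integrable0 : B 0.
Proof.
split=> [q|]; first exact: integrable0.
exists 0 => q; have -> : absf 0 = cst 0 :> (Om -> R) by apply/funext => w; exact: normr0.
by rewrite /fiber_mean Rintegral_cst // mul0r.
Qed.

Lemma fiber_integrable_absf Phi : B Phi -> B (absf Phi).
Proof.
move=> BPhi; apply: (fiber_integrable_dominated BPhi) => [q|w]; last by rewrite /absf normr_id.
by apply: measurableT_comp => //; exact: fiber_measurable.
Qed.

Lemma fiber_integrableD Phi Psi : B Phi -> B Psi -> B (Phi + Psi).
Proof.
move=> BPhi BPsi; have [h [C hC]] := BPhi; have [h' [C' hC']] := BPsi.
have iD q : mu.-integrable setT (fun t => ((Phi + Psi) (q, t))%:E).
  by have := integrableD measurableT (h q) (h' q); exact.
split=> //; exists (C + C') => q; apply: le_trans (lerD (hC q) (hC' q)).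
rewrite -fiber_meanD; try exact: fiber_integrable_absf.
apply: le_Rintegral => //.
- by have := integrable_norm (iD q); exact.
- by have := integrableD measurableT (fiber_integrable_abs q BPhi) (fiber_integrable_abs q BPsi); exact.
- by move=> t _; exact: ler_normD.
Qed.

Lemma fiber_integrableZ a Phi : B Phi -> B (a *: Phi).
Proof.
move=> BPhi; have [h [C hC]] := BPhi.
have iZ q : mu.-integrable setT (fun t => ((a *: Phi) (q, t))%:E).
  by have := integrableZl measurableT a (h q); exact.
split=> //; exists (`|a| * C) => q; have -> : absf (a *: Phi) = `|a| *: absf Phi.
  by apply/funext => w; rewrite /absf /= normrM.
by rewrite fiber_meanZ; [exact: ler_wpM2l|exact: fiber_integrable_absf].
Qed.

Lemma fiber_integrable_sg Phi Psi : B Phi -> B Psi -> B (fun w => Num.sg (Phi w) * Psi w).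
Proof.
move=> BPhi BPsi; apply: (fiber_integrable_dominated BPsi) => [q|w]; last first.
  by rewrite normrM normr_sg; case: (_ != 0); rewrite ?mul1r // mul0r.
apply: measurable_funM; last exact: fiber_measurable.
have mPhi := fiber_measurable q BPhi.
have -> : (fun t => Num.sg (Phi (q, t))) =
    (fun t => if 0 < Phi (q, t) then 1 else if Phi (q, t) < 0 then -1 else 0).
  by apply/funext => t; case: sgrP.
apply: measurable_fun_ifT; [|exact: measurable_cst|apply: measurable_fun_ifT];
  by [apply: measurable_fun_ltr|exact: measurable_cst].
Qed.

Lemma fiber_integrable_rt p Phi : B Phi -> B (rt p Phi).
Proof.
move=> [h [C hC]]; split=> [q|]; first exact: (h (q * p)%g).
by exists C => q; exact: (hC (q * p)%g).
Qed.

Hypothesis nilG : nilpotent_group G.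

(* Descending induction along the lower central series: a functional invariant under one term is averaged over the next larger one. *)
Lemma fiber_mean_on : exists2 xi : (Om -> R) -> R, mean_on fiber_act B xi &
  forall Phi c, B Phi -> (forall q, fiber_mean Phi q <= c) -> xi Phi <= c.
Proof.
have actM (w : Om) p q : fiber_act (fiber_act w p) q = fiber_act w (p * q)%g.
  by rewrite /fiber_act /= mulgA.
have act1 (w : Om) : fiber_act w 1%g = w by case: w => p t; rewrite /fiber_act /= mulg1.
have BN Phi : B Phi -> B (- Phi) by rewrite -scaleN1r; exact: fiber_integrableZ.
pose good j (xi : (Om -> R) -> R) := [/\ linear_on B xi,
  invariant_under fiber_act B (lcs j.+1) xi &
  forall Phi c, B Phi -> (forall q, fiber_mean Phi q <= c) -> xi Phi <= c].
suff [xi [lxi ixi xi_le]] : exists xi, good 0%N xi.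
  exists xi => //; split; last exact: ixi.
  split=> // Phi BPhi Phi0; rewrite -oppr_le0 -(linear_onN lxi) //.
  apply: xi_le => [|q]; first exact: BN.
  rewrite -scaleN1r fiber_meanZ // mulN1r oppr_le0.
  by apply: Rintegral_ge0.
have [s hs] := lcs_trivial nilG.
have base : exists xi, good s xi.
  exists (fun Phi => fiber_mean Phi 1%g); split=> //.
  - by split=> [Phi Psi|a Phi]; [exact: fiber_meanD|exact: fiber_meanZ].
  - by move=> k Phi /hs -> _; rewrite fiber_mean_rt mulg1.
have stp j : (exists xi, good j.+1 xi) -> exists xi, good j xi.
  move=> [xi [lxi ixi xi_le]].
  have [h k ? _|a b ? _|Phi BPhi|xi' [lxi' ixi' xi'_le]] :=
    average_invariant actM act1 fiber_integrable0 fiber_integrableD fiber_integrableZ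
      fiber_integrable_rt lxi (lcs_subgroup G j.+1) _ _ ixi _.
  - exact: lcsJ.
  - exact: lcsR1.
  - have [_ [C hC]] := BPhi; exists C => k _.
    have Bk : B (rt k Phi) by exact: fiber_integrable_rt.
    have bnd q : `|fiber_mean (rt k Phi) q| <= C.
      by apply: le_trans (fiber_mean_norm _ _) (hC (q * k)%g).
    rewrite ler_norml lerNl -(linear_onN lxi) //; apply/andP; split; apply: xi_le => [|q].
    + exact: BN.
    + by rewrite -scaleN1r fiber_meanZ // mulN1r lerNl; have := bnd q; rewrite ler_norml => /andP[].
    + by [].
    + by apply: le_trans (ler_norm _) (bnd q).
  exists xi'; split=> // Phi c BPhi h; apply: xi'_le => // k _.
  by apply: xi_le => [|q]; [exact: fiber_integrable_rt|rewrite fiber_mean_rt].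
by elim: s base {hs} => // j IH /stp.
Qed.

Variables (dist : G -> G -> R) (f : G -> L1 R) (L C : R).
Hypothesis dist_inv : forall a p q, dist (a * p)%g (a * q)%g = dist p q.
Hypothesis L0 : 0 < L.
Hypothesis qi : forall p q, L^-1 * dist p q - C <= L1_dist (f p) (f q) <= L * dist p q + C.

(** The fiberwise norm of [b v] at [q] is the distance between [f q] and [f (q v)]. Its lower bound
    by [d(1, v)] holds for every [q], hence survives in the mean, where commutators are
    sublinear. *)
Lemma embedded_commutator_sublinear x y e : 0 < e -> exists2 A, (0 < A)%N &
  forall k, (0 < k)%N -> (A %| k)%N ->
    dist 1%g [~ x ^+ k, y ^+ k]%g <= L * (e * k%:R + C).
Proof.
move=> e0; pose b (v : G) : Om -> R := fun w => f (w.1 * v)%g w.2 - f w.1 w.2.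
have bE v q : fiber_mean (absf (b v)) q = L1_dist (f q) (f (q * v)%g).
  by rewrite L1_distE /fiber_mean /absf /b /=; apply: eq_Rintegral => t _; rewrite distrC.
have dE v q : dist q (q * v)%g = dist 1%g v by rewrite -(dist_inv q 1%g v) mulg1.
have Bb v : B (b v).
  split=> [q|]; first by have := L1_integrableB (f (q * v)%g) (f q); exact.
  by exists (L * dist 1%g v + C) => q; rewrite bE -(dE v q); case/andP: (qi q (q * v)%g).
have bM v w : b (v * w)%g = b v + rt v (b w).
  by apply/funext => -[q t]; rewrite addrfctE /b /rt /= mulgA addrC subrKA.
have [xi mxi xi_le] := fiber_mean_on.
have [[lxi _] _] := mxi.
have lower v : L^-1 * dist 1%g v - C <= len b xi v.
  rewrite /len; have Ba := fiber_integrable_absf (Bb v).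
  rewrite -lerN2 -(linear_onN lxi) //; apply: xi_le => [|q].
    by rewrite -scaleN1r; exact: fiber_integrableZ.
  by rewrite -scaleN1r fiber_meanZ // mulN1r lerN2 bE -(dE v q); case/andP: (qi q (q * v)%g).
have actM (w : Om) p q : fiber_act (fiber_act w p) q = fiber_act w (p * q)%g.
  by rewrite /fiber_act /= mulgA.
have act1 (w : Om) : fiber_act w 1%g = w by case: w => p t; rewrite /fiber_act /= mulg1.
have [A A0 hA] := commutator_sublinear actM act1 fiber_integrable0 fiber_integrableD
  fiber_integrableZ fiber_integrable_absf fiber_integrable_sg fiber_integrable_rt Bb bM
  nilG mxi x y e0.
exists A => // k k0 Ak; have h := le_trans (lower _) (hA k k0 Ak).
by rewrite mulrC -ler_pdivrMr // mulrC -lerBlDr.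
Qed.

End MeanOfEmbedding.

Theorem theorem1p1 (R : realType) (n : nat) (G : lieGroupType R n)
    (g : riemannian_metric G) :
  simply_connected R G -> nilpotent_group G -> left_invariant g ->
  (qi_embeds (riemannian_dist g) (@L1_dist R) <-> abelian_group G).
Proof.
move=> sc nilG li; split; last exact: abelian_qi_embeds.
move=> [f [L [C [L1 C0 qi]]]]; apply: contrapT => nab.
have [r [c [b law]]] := @group_law_expansion R n G.
have [z1 [z2 [a1 [a2 [a1_gt0 a2_gt0 quad]]]]] := nonabelian_quadratic_growth li sc law nilG nab.
have L0 : 0 < L by apply: lt_le_trans L1.
(* with [D = d(1, [z1^k, z2^k])]: [a1 k^2 <= a2 (1 + D)^2] while [1 + D <= L e k + O(1)], where [a2 (2 L e)^2 < a1] *)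
pose e := Num.min 1 (a1 / (8 * a2 * L ^+ 2)).
have e0 : 0 < e by rewrite lt_min ltr01 divr_gt0 // !mulr_gt0 // exprn_gt0.
have e1 : e <= 1 by rewrite ge_min lexx.
have e_le : e * (8 * a2 * L ^+ 2) <= a1.
  by rewrite -ler_pdivlMr ?ge_min ?lexx ?orbT // !mulr_gt0 // exprn_gt0.
have [A A0 hA] := embedded_commutator_sublinear nilG (dist_left li) L0 qi z1 z2 e0.
pose Q := 1 + L * C; have Q0 : 0 <= Q by rewrite addr_ge0 // mulr_ge0 // ltW.
(* Makes [k] so large that the additive constants contribute at most [L e k]. *)
pose m := (Num.truncn (Q / (L * e))).+1.
have Le0 : 0 < L * e by rewrite mulr_gt0.
pose k := (A * m)%N.
have k0 : (0 < k)%N by rewrite muln_gt0 A0.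
have Qk : Q <= L * e * k%:R.
  rewrite mulrC -ler_pdivrMr //; apply: le_trans (ltW (truncnS_gt _)) _.
  by rewrite ler_nat leq_pmull.
have := quad k; rewrite leNgt => /negP; apply.
set D := riemannian_dist _ _ _.
have D0 : 0 <= D by exact: dist_ge0.
have hD : 1 + D <= 2 * L * e * k%:R.
  have := hA k k0 (dvdn_mulr _ (dvdnn _)); rewrite -/D => h.
  have h2 : L * (e * k%:R + C) = L * e * k%:R + (Q - 1) by rewrite /Q; ring.
  lra.
have h3 : (1 + D) ^+ 2 <= (2 * L * e * k%:R) ^+ 2.
  by apply: lerXn2r => //; rewrite nnegrE ?addr_ge0 //; apply: le_trans hD; rewrite addr_ge0.
apply: (@le_lt_trans _ _ (a2 * (2 * L * e * k%:R) ^+ 2)); first by rewrite ler_pM2l.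
have -> : a2 * (2 * L * e * k%:R) ^+ 2 = (e * (e * (8 * a2 * L ^+ 2)) / 2) * k%:R ^+ 2.
  by field.
rewrite ltr_pM2r ?exprn_gt0 ?ltr0n //.
have : e * (e * (8 * a2 * L ^+ 2)) <= 1 * a1.
  by apply: ler_pM => //; [exact: ltW|rewrite !mulr_ge0 ?exprn_ge0 // ltW].
lra.
Qed.
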